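(* Let $s,r\ge4$. If the quotient algebra $\widetilde\Lambda(s,r)=k\widetilde Q(s,r)/I$ is a stable $2$-translation algebra with trivial $2$-translation, then there is a family $C(a,b,c)=\{a_{\mathbf i},b_{\mathbf i},c_{\mathbf i}\mid\mathbf i\in\mathbb Z/s\mathbb Z\times\mathbb Z/r\mathbb Z\}\subseteq k^*$ such that $I$ is generated by the set $$\widetilde\rho(s,r,C(a,b,c))=\{z(\alpha,\mathbf i,a_{\mathbf i}),\,z(\beta,\mathbf i,b_{\mathbf i}),\,z(\gamma,\mathbf i,c_{\mathbf i})\mid\mathbf i\}\cup\{\alpha_{\mathbf i+\mathbf e_1}\alpha_{\mathbf i},\ \beta_{\mathbf i+\mathbf e_2}\beta_{\mathbf i},\ \gamma_{\mathbf i-\mathbf e}\gamma_{\mathbf i}\mid\mathbf i\},$$ with $\mathbf i$ running over $\mathbb Z/s\mathbb Z\times\mathbb Z/r\mathbb Z$, where $$z(\gamma,\mathbf i,c_{\mathbf i})=c_{\mathbf i}\beta_{\mathbf i+\mathbf e_1}\alpha_{\mathbf i}+\alpha_{\mathbf i+\mathbf e_2}\beta_{\mathbf i},\quad z(\beta,\mathbf i,b_{\mathbf i})=b_{\mathbf i}\alpha_{\mathbf i-\mathbf e}\gamma_{\mathbf i}+\gamma_{\mathbf i+\mathbf e_1}\alpha_{\mathbf i},\quad z(\alpha,\mathbf i,a_{\mathbf i})=a_{\mathbf i}\beta_{\mathbf i-\mathbf e}\gamma_{\mathbf i}+\gamma_{\mathbf i+\mathbf e_2}\beta_{\mathbf 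i}.$$
   Context: $k$ is a field and $k^*$ its set of nonzero elements. Paths are composed from right to left. $\widetilde Q(s,r)$ is the McKay quiver of $\mathbb Z/s\mathbb Z\times\mathbb Z/r\mathbb Z$ embedded diagonally in $\mathrm{SL}(3,\mathbb C)$: its vertex set is $\mathbb Z/s\mathbb Z\times\mathbb Z/r\mathbb Z$, and for each vertex $\mathbf i$ there are arrows $\alpha_{\mathbf i}:\mathbf i\to\mathbf i+\mathbf e_1$, $\beta_{\mathbf i}:\mathbf i\to\mathbf i+\mathbf e_2$, $\gamma_{\mathbf i}:\mathbf i\to\mathbf i-\mathbf e$, where $\mathbf e_1=(1,0)$, $\mathbf e_2=(0,1)$, $\mathbf e=\mathbf e_1+\mathbf e_2$. The ideal $I$ is generated by linear combinations of paths of length at least $2$ (each of constant length with common start and end) and the quotient is graded by path length. A stable $2$-translation algebra is such a graded self-injective algebra $\widetilde\Lambda$ whose indecomposable projectives have Loewy length $4$ and which is $(3,q)$-Koszul for some $q\ge2$ or $q=\infty$: $\widetilde\Lambda_0$ has a minimal graded projective resolution with $P^t$ generated in degree $t$ for $t\le q$ and $\ker(P^q\to P^{q-1})$ concentrated in degree $q+3$ (for $q=\infty$: $P^t$ generated in degree $t$ for all $t$). Trivial $2$-translation means the Nakayama permutation is the identity, i.e. $\widetilde\Lambda_3e_{\mathbf i}\simeq\widetilde\Lambda_0e_{\mathbf i}$ for every vertex $\mathbf i$. *)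

(* Defs.v *)
From HB Require Import structures.
From mathcomp Require Export all_boot all_algebra.
From mathcomp Require Import generic_quotient ring_quotient finmap.
From mathcomp Require Export boolp classical_sets functions.
From mathcomp.multinomials Require Export monalg.

Set Implicit Arguments.
Unset Strict Implicit.
Unset Printing Implicit Defensive.

Import GRing.Theory.
Local Open Scope classical_set_scope.
Local Open Scope quotient_scope.
Local Open Scope ring_scope.

(** * Two-sided ideals and quotient rings *)

Definition is_ideal (R : pzRingType) (J : set R) : Prop :=
  [/\ J 0,
      forall x y, J x -> J y -> J (x - y),
      forall a x, J x -> J (a * x)
    & forall a x, J x -> J (x * a)].

Record ideal (R : pzRingType) :=
  Ideal { ideal_set :> set R; idealP : is_ideal ideal_set }.

Section GeneratedIdeal.
Variables (R : pzRingType) (S : set R).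

Definition ideal_gen_set : set R :=
  [set x | forall J : ideal R, S `<=` J -> ideal_set J x].

Lemma ideal_gen_subproof : is_ideal ideal_gen_set.
Proof.
split=> [J|x y Ix Iy J|a x Ix J|a x Ix J] SJ; have [J0 JB Jl Jr] := idealP J.
- by [].
- exact: JB (Ix J SJ) (Iy J SJ).
- exact/Jl/Ix.
- exact/Jr/Ix.
Qed.

Definition ideal_gen : ideal R := Ideal ideal_gen_subproof.

End GeneratedIdeal.

Section QuotientRing.
Variables (R : pzRingType) (J : ideal R).

Definition ideal_pred : {pred R} := fun x => `[< ideal_set J x >].

Lemma ideal_pred_zmod : zmod_closed ideal_pred.
Proof.
have [J0 JB _ _] := idealP J.
by split=> [|x y /asboolP Jx /asboolP Jy]; apply/asboolP => //; apply: JB.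
Qed.

HB.instance Definition _ :=
  GRing.isZmodClosed.Build R ideal_pred ideal_pred_zmod.

Definition quot_ring : Type := Quotient.quot ideal_pred.
HB.instance Definition _ := GRing.Zmodule.on quot_ring.
HB.instance Definition _ := EqQuotient.on quot_ring.

Definition to_quot (x : R) : quot_ring := \pi_quot_ring x.

Lemma to_quotP x y : to_quot x = to_quot y <-> ideal_set J (x - y).
Proof.
rewrite /to_quot; split.
  by move=> /eqP; rewrite -Quotient.idealrBE => /asboolP.
by move=> h; apply/eqP; rewrite -Quotient.idealrBE; apply/asboolP.
Qed.

Lemma repr_quotP x : ideal_set J (repr (to_quot x) - x).
Proof. by apply/to_quotP; rewrite /to_quot reprK. Qed.

Lemma to_quotD x y : to_quot (x + y) = to_quot x + to_quot y.
Proof. by rewrite /to_quot !piE. Qed.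

Definition quot_mul (u v : quot_ring) : quot_ring := to_quot (repr u * repr v).

Lemma to_quotM x y : to_quot (x * y) = quot_mul (to_quot x) (to_quot y).
Proof.
have [_ JB Jl Jr] := idealP J; apply/esym/to_quotP.
set x' := repr _; set y' := repr _.
have -> : x' * y' - x * y = x' * (y' - y) - (x - x') * y.
  by rewrite mulrBr mulrBl opprB addrA addrNK.
apply: (JB); first exact/Jl/repr_quotP.
have J0 : ideal_set J 0 by have [] := idealP J.
by apply: Jr; rewrite -opprB -[- _]sub0r; apply: JB J0 (repr_quotP x).
Qed.

Lemma to_quot_surj (P : quot_ring -> Prop) :
  (forall x, P (to_quot x)) -> forall u, P u.
Proof. by move=> h u; rewrite -[u]reprK; apply: h. Qed.

Lemma quot_mulA : associative quot_mul.
Proof.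
elim/to_quot_surj=> x; elim/to_quot_surj=> y; elim/to_quot_surj=> z.
by rewrite -!to_quotM mulrA.
Qed.

Lemma quot_mul1r : left_id (to_quot 1) quot_mul.
Proof. by elim/to_quot_surj=> x; rewrite -to_quotM mul1r. Qed.

Lemma quot_mulr1 : right_id (to_quot 1) quot_mul.
Proof. by elim/to_quot_surj=> x; rewrite -to_quotM mulr1. Qed.

Lemma quot_mulDl : left_distributive quot_mul +%R.
Proof.
elim/to_quot_surj=> x; elim/to_quot_surj=> y; elim/to_quot_surj=> z.
by rewrite -to_quotD -!to_quotM -to_quotD mulrDl.
Qed.

Lemma quot_mulDr : right_distributive quot_mul +%R.
Proof.
elim/to_quot_surj=> x; elim/to_quot_surj=> y; elim/to_quot_surj=> z.
by rewrite -to_quotD -!to_quotM -to_quotD mulrDr.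
Qed.

HB.instance Definition _ := GRing.Zmodule_isPzRing.Build quot_ring
  quot_mulA quot_mul1r quot_mulr1 quot_mulDl quot_mulDr.

End QuotientRing.

(** * Left modules *)

Definition is_submod (R : pzRingType) (M : lmodType R) (U : set M) : Prop :=
  U 0 /\ forall (a : R) u v, U u -> U v -> U (a *: u + v).

Record submod (R : pzRingType) (M : lmodType R) :=
  Submod { submod_set :> set M; submodP : is_submod submod_set }.

Section GeneratedSubmodule.
Variables (R : pzRingType) (M : lmodType R) (S : set M).

Definition submod_gen_set : set M :=
  [set x | forall U : submod M, S `<=` U -> submod_set U x].

Lemma submod_gen_subproof : is_submod submod_gen_set.
Proof.
split=> [U|a u v hu hv U] SU; have [U0 Ulin] := submodP U => //.
exact: Ulin (hu U SU) (hv U SU).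
Qed.

Definition submod_gen : submod M := Submod submod_gen_subproof.

End GeneratedSubmodule.

Section QuotientModule.
Variables (R : pzRingType) (M : lmodType R) (U : submod M).

Definition submod_pred : {pred M} := fun x => `[< submod_set U x >].

Lemma submod_pred_zmod : zmod_closed submod_pred.
Proof.
have [U0 Ulin] := submodP U.
split=> [|x y /asboolP Ux /asboolP Uy]; apply/asboolP => //.
by rewrite addrC -scaleN1r; apply: Ulin.
Qed.

HB.instance Definition _ :=
  GRing.isZmodClosed.Build M submod_pred submod_pred_zmod.

Definition quot_mod : Type := Quotient.quot submod_pred.
HB.instance Definition _ := GRing.Zmodule.on quot_mod.
HB.instance Definition _ := EqQuotient.on quot_mod.

Definition to_quotmod (x : M) : quot_mod := \pi_quot_mod x.

Lemma to_quotmodP x y : to_quotmod x = to_quotmod y <-> submod_set U (x - y).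
Proof.
rewrite /to_quotmod; split.
  by move=> /eqP; rewrite -Quotient.idealrBE => /asboolP.
by move=> h; apply/eqP; rewrite -Quotient.idealrBE; apply/asboolP.
Qed.

Lemma to_quotmodD x y : to_quotmod (x + y) = to_quotmod x + to_quotmod y.
Proof. by rewrite /to_quotmod !piE. Qed.

Definition quotmod_scale (a : R) (u : quot_mod) : quot_mod :=
  to_quotmod (a *: repr u).

Lemma to_quotmodZ a x : to_quotmod (a *: x) = quotmod_scale a (to_quotmod x).
Proof.
have [U0 Ulin] := submodP U; apply/esym/to_quotmodP.
rewrite -scalerBr -[a *: _]addr0; apply: Ulin => //.
by apply/to_quotmodP; rewrite /to_quotmod reprK.
Qed.

Lemma to_quotmod_surj (P : quot_mod -> Prop) :
  (forall x, P (to_quotmod x)) -> forall u, P u.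
Proof. by move=> h u; rewrite -[u]reprK; apply: h. Qed.

Lemma quotmod_scaleA a b u :
  quotmod_scale a (quotmod_scale b u) = quotmod_scale (a * b) u.
Proof. by elim/to_quotmod_surj: u => x; rewrite -!to_quotmodZ scalerA. Qed.

Lemma quotmod_scale1 : left_id 1 quotmod_scale.
Proof. by elim/to_quotmod_surj=> x; rewrite -to_quotmodZ scale1r. Qed.

Lemma quotmod_scaleDr : right_distributive quotmod_scale +%R.
Proof.
move=> a; elim/to_quotmod_surj=> x; elim/to_quotmod_surj=> y.
by rewrite -to_quotmodD -!to_quotmodZ -to_quotmodD scalerDr.
Qed.

Lemma quotmod_scaleDl u : {morph quotmod_scale^~ u : a b / a + b}.
Proof.
move=> a b; elim/to_quotmod_surj: u => x.
by rewrite /= -!to_quotmodZ -to_quotmodD scalerDl.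
Qed.

HB.instance Definition _ := GRing.Zmodule_isLmodule.Build R quot_mod
  quotmod_scaleA quotmod_scale1 quotmod_scaleDr quotmod_scaleDl.

End QuotientModule.

Section ModuleNotions.
Variable R : pzRingType.
Implicit Types M N P : lmodType R.

Definition projective P : Prop :=
  forall M N (g : {linear M -> N}) (f : {linear P -> N}),
    (forall y, exists x, g x = y) ->
    exists h : {linear P -> M}, forall x, g (h x) = f x.

Definition injective_module P : Prop :=
  forall M N (g : {linear M -> N}) (f : {linear M -> P}),
    injective g -> exists h : {linear N -> P}, forall x, h (g x) = f x.

Definition self_injective : Prop := injective_module (R^o : lmodType R).

Definition indecomposable M : Prop :=
  (exists x : M, x <> 0) /\
  forall U W : submod M,
    U `&` W = [set 0] ->
    (forall x, exists u w, [/\ submod_set U u, submod_set W w & x = u + w]) ->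
    (U = [set 0] :> set M) \/ (W = [set 0] :> set M).

Definition superfluous M (U : set M) : Prop :=
  forall W : submod M,
    (forall x, exists u w, [/\ U u, submod_set W w & x = u + w]) ->
    W = setT :> set M.

Definition maximal_submod M (U : submod M) : Prop :=
  U <> setT :> set M /\
  forall W : submod M, U `<=` W -> W <> setT :> set M -> W = U :> set M.

(* The Jacobson radical: the intersection of the maximal left ideals. *)
Definition jacobson : set R :=
  [set x | forall L : submod (R^o : lmodType R), maximal_submod L ->
    submod_set L x].

(* rad^n M = J^n M *)
Fixpoint rad_power M (n : nat) : set M :=
  if n is m.+1 then
    submod_gen [set y | exists a u,
      [/\ jacobson a, rad_power m u & y = a *: u]]
  else setT.

Definition loewy_length M (n : nat) : Prop :=
  @rad_power M n = [set 0] /\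
  forall m, (m < n)%N -> @rad_power M m <> [set 0].

End ModuleNotions.

(** * Graded modules and resolutions

   Below, [G : nat -> set A] is the grading of the ring [A]: [G t] is A_t. *)

(* The last clause says that the sum of the H n is direct. *)
Definition direct_sum_decomposition (M : zmodType) (H : int -> set M) : Prop :=
  [/\ forall n, H n 0 /\ (forall x y, H n x -> H n y -> H n (x - y)),
      forall x, exists (ns : seq int) (c : int -> M),
        (forall n, H n (c n)) /\ x = \sum_(n <- ns) c n
    & forall (ns : seq int) (c : int -> M),
        uniq ns -> (forall n, H n (c n)) -> \sum_(n <- ns) c n = 0 ->
        forall n, n \in ns -> c n = 0].

Section Graded.
Variables (A : pzRingType) (G : nat -> set A).

Definition graded_module (M : lmodType A) (H : int -> set M) : Prop :=
  direct_sum_decomposition H /\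
  forall (i : nat) (n : int) (a : A) (x : M),
    G i a -> H n x -> H (n + i%:Z) (a *: x).

Definition generated_in_degree (M : lmodType A) (H : int -> set M) (n : int) :=
  submod_gen (H n) = setT :> set M.

(* The graded module A_0 = A / A_{>=1}, concentrated in degree 0. *)
Definition positive_part : submod (A^o : lmodType A) :=
  submod_gen [set x : A^o | exists i, (0 < i)%N /\ G i x].

Definition degree_zero : lmodType A := quot_mod positive_part.

Definition degree_zero_grading (n : int) : set degree_zero :=
  if n == 0 then setT else [set 0].

(* ker (P^t -> P^{t-1}), with P^{-1} := S *)
Definition syzygy (S : lmodType A) (P : nat -> lmodType A)
    (d : forall t, {linear P t.+1 -> P t}) (eps : {linear P 0%N -> S})
    (t : nat) : set (P t) :=
  match t return set (P t) with
  | 0%N => [set x | eps x = 0]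
  | t'.+1 => [set x | d t' x = 0]
  end.
Arguments syzygy [S P] d eps t _.

Record minimal_graded_projective_resolution
    (S : lmodType A) (HS : int -> set S) := MinGrProjRes {
  res_mod : nat -> lmodType A;
  res_deg : forall t, int -> set (res_mod t);
  res_diff : forall t, {linear res_mod t.+1 -> res_mod t};
  res_aug : {linear res_mod 0%N -> S};
  res_graded : forall t, graded_module (@res_deg t);
  res_projective : forall t, projective (res_mod t);
  res_diff_deg : forall t n x, @res_deg t.+1 n x -> @res_deg t n (res_diff t x);
  res_aug_deg : forall n x, @res_deg 0%N n x -> HS n (res_aug x);
  res_aug_surj : forall y, exists x, res_aug x = y;
  res_exact : forall t, range (res_diff t) = syzygy res_diff res_aug t;
  (* Each P^t -> im (P^t -> P^{t-1}) is a projective cover *)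
  res_minimal : forall t, superfluous (syzygy res_diff res_aug t)
}.

(* (p,q)-Koszul; [q = None] stands for q = infinity. *)
Definition almost_koszul (p : nat) (q : option nat) : Prop :=
  exists r : minimal_graded_projective_resolution degree_zero_grading,
    match q with
    | Some m =>
        (forall t, (t <= m)%N -> generated_in_degree (@res_deg _ _ r t) t%:Z) /\
        syzygy (res_diff r) (res_aug r) m `<=` @res_deg _ _ r m (m + p)%:Z
    | None => forall t, generated_in_degree (@res_deg _ _ r t) t%:Z
    end.

Definition stable_translation_algebra (n : nat) : Prop :=
  [/\ self_injective A,
      forall P : lmodType A, projective P -> indecomposable P ->
        loewy_length P n.+2
    & exists q : option nat,
        (if q is Some m then (2 <= m)%N : Prop else True) /\
        almost_koszul n.+1 q].

Definition column (t : nat) (e : A) : set A := [set x * e | x in G t].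

(* A_{n+1} e_i ~ A_0 e_i as left A_0-modules, for every i *)
Definition trivial_translation (n : nat) (V : Type) (e : V -> A) : Prop :=
  forall i, exists f : A -> A,
    [/\ set_bij (column n.+1 (e i)) (column 0 (e i)) f,
        forall x y, column n.+1 (e i) x -> column n.+1 (e i) y ->
          f (x + y) = f x + f y
      & forall a x, G 0%N a -> column n.+1 (e i) x -> f (a * x) = a * f x].

End Graded.

(** * Quivers and path algebras *)

Record quiver := Quiver {
  vertex : finType;
  arrow : finType;
  source : arrow -> vertex;
  target : arrow -> vertex
}.

Section Paths.
Variable Q : quiver.

Fixpoint composable (v : vertex Q) (s : seq (arrow Q)) : bool :=
  if s is a :: s' then (source a == v) && composable (target a) s' else true.

Fixpoint endpoint (v : vertex Q) (s : seq (arrow Q)) : vertex Q :=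
  if s is a :: s' then endpoint (target a) s' else v.

(* A path is its starting vertex together with its arrows in the order in which
   they are traversed: [:: a_1; ...; a_n] is the path written a_n ... a_1. *)
Record qpath := QPath {
  qpath_val : vertex Q * seq (arrow Q);
  _ : composable qpath_val.1 qpath_val.2
}.

HB.instance Definition _ := [isSub for qpath_val].
HB.instance Definition _ := [Choice of qpath by <:].

Definition path_source (p : qpath) : vertex Q := (val p).1.
Definition path_target (p : qpath) : vertex Q := endpoint (val p).1 (val p).2.
Definition path_length (p : qpath) : nat := size (val p).2.

Lemma composable_nil (v : vertex Q) :
  composable (v, [::] : seq (arrow Q)).1 (v, [::] : seq (arrow Q)).2.
Proof. by []. Qed.
Definition trivial_path (v : vertex Q) : qpath := QPath (composable_nil v).

Lemma composable_arrow (a : arrow Q) :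
  composable (source a, [:: a]).1 (source a, [:: a]).2.
Proof. by rewrite /= eqxx. Qed.
Definition arrow_path (a : arrow Q) : qpath := QPath (composable_arrow a).

(* The product p q of paths is "first q, then p"; [None] when it is 0. *)
Definition path_mul (p q : qpath) : option qpath :=
  if path_target q == path_source p
  then insub ((val q).1, (val q).2 ++ (val p).2) else None.

Lemma composable_cat v s1 s2 :
  composable v (s1 ++ s2) = composable v s1 && composable (endpoint v s1) s2.
Proof. by elim: s1 v => //= a s1 IHs v; rewrite IHs andbA. Qed.

Lemma endpoint_cat v s1 s2 :
  endpoint v (s1 ++ s2) = endpoint (endpoint v s1) s2.
Proof. by elim: s1 v => /=. Qed.

Lemma path_mulP (p q : qpath) : path_target q = path_source p ->
  exists r, [/\ path_mul p q = Some r, (val r).1 = (val q).1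
              & (val r).2 = (val q).2 ++ (val p).2].
Proof.
case: p q => [[v s] /= cs] [[w u] /= cu].
rewrite /path_target /path_source /= => def_v.
have c : composable w (u ++ s) by rewrite composable_cat cu def_v.
exists (@QPath (w, u ++ s) c); rewrite /path_mul /path_target /path_source /=.
rewrite def_v eqxx; split=> //; case: insubP => [r _ def_r|]; last by rewrite c.
by congr Some; apply/val_inj.
Qed.

Lemma path_mul_none (p q : qpath) :
  path_target q <> path_source p -> path_mul p q = None.
Proof. by rewrite /path_mul => /eqP/negbTE->. Qed.

Lemma path_mulA (p q r : qpath) :
  obind (fun u => path_mul p u) (path_mul q r) =
  obind (fun u => path_mul u r) (path_mul p q).
Proof.
have [rq|nrq] := eqVneq (path_target r) (path_source q); last first.
  rewrite [path_mul q r]path_mul_none /=; last exact/eqP.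
  have [qp|/eqP nqp] := eqVneq (path_target q) (path_source p); last first.
    by rewrite path_mul_none.
  have [u [-> us _]] := path_mulP qp => /=; rewrite path_mul_none //.
  by rewrite /path_source us; apply/eqP.
have [u [-> us uv]] := path_mulP rq => /=.
have ut : path_target u = path_target q.
  by rewrite /path_target us uv endpoint_cat -/(path_target r) rq.
have [qp|/eqP nqp] := eqVneq (path_target q) (path_source p); last first.
  by rewrite !path_mul_none // ut.
have [w [-> ws wv]] := path_mulP qp => /=.
have up : path_target u = path_source p by rewrite ut.
have rw : path_target r = path_source w by rewrite /path_source ws.
have [x [-> xs xv]] := path_mulP up; have [y [-> ys yv]] := path_mulP rw.
congr Some; apply/val_inj.
rewrite [val x]surjective_pairing [val y]surjective_pairing.
by rewrite xs us ys xv uv yv wv catA.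
Qed.

Lemma path_mul1p (v : vertex Q) (p : qpath) :
  path_mul (trivial_path v) p = if v == path_target p then Some p else None.
Proof.
have [->|nv] := eqVneq v (path_target p); last first.
  by rewrite path_mul_none //; apply/eqP; rewrite eq_sym.
have [|r [-> rs rv]] := @path_mulP (trivial_path (path_target p)) p.
  by rewrite /path_source.
congr Some; apply/val_inj.
by rewrite [val r]surjective_pairing rs rv /= cats0 -surjective_pairing.
Qed.

Lemma path_mulp1 (v : vertex Q) (p : qpath) :
  path_mul p (trivial_path v) = if v == path_source p then Some p else None.
Proof.
have [->|nv] := eqVneq v (path_source p); last first.
  by rewrite path_mul_none //; apply/eqP.
have [|r [-> rs rv]] := @path_mulP p (trivial_path (path_source p)).
  by rewrite /path_target.
congr Some; apply/val_inj.
by rewrite [val r]surjective_pairing rs rv /= -surjective_pairing.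
Qed.

End Paths.

Section PathAlgebra.
Variables (k : fieldType) (Q : quiver).

(* Finitely supported functions on the set of paths; {malg k[_]} is only the
   free k-module here, the product is defined below. *)
Definition path_algebra : Type := {malg k[qpath Q]}.
HB.instance Definition _ := GRing.Lmodule.on path_algebra.

Definition of_path (p : qpath Q) : path_algebra := << p >>.

Definition monomial (c : k) (o : option (qpath Q)) : path_algebra :=
  if o is Some p then << c *g p >> else 0.

Definition palg_one : path_algebra :=
  \sum_(v : vertex Q) of_path (trivial_path v).

Definition palg_mul (x y : path_algebra) : path_algebra :=
  \sum_(p <- msupp x) \sum_(q <- msupp y)
     monomial (x@_p * y@_q) (path_mul p q).

Lemma monomial0 o : monomial 0 o = 0.
Proof. by case: o => //= p; rewrite monalgU0. Qed.

Lemma monomialD c1 c2 o : monomial (c1 + c2) o = monomial c1 o + monomial c2 o.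
Proof. by case: o => [p|] /=; rewrite ?monalgUD ?addr0. Qed.

Lemma palg_mulw (d1 d2 : {fset qpath Q}) (x y : path_algebra) :
  fsubset (msupp x) d1 -> fsubset (msupp y) d2 ->
  palg_mul x y =
  \sum_(p <- d1) \sum_(q <- d2) monomial (x@_p * y@_q) (path_mul p q).
Proof.
move=> le_d1 le_d2; rewrite /palg_mul (big_fset_incl _ le_d1) /=.
  apply: eq_bigr => p _; apply: big_fset_incl => // q _ /mcoeff_outdom ->.
  by rewrite mulr0 monomial0.
move=> p _ /mcoeff_outdom xp.
by rewrite big1 // => q _; rewrite xp mul0r monomial0.
Qed.

Lemma palg_mulDl : left_distributive palg_mul +%R.
Proof.
move=> x y z.
pose d := fsetU (msupp x) (msupp y).
rewrite (palg_mulw (d1 := d) (msuppD_le _ _) (fsubset_refl _)).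
rewrite (palg_mulw (d1 := d) (fsubsetUl _ _) (fsubset_refl (msupp z))).
rewrite (palg_mulw (d1 := d) (fsubsetUr _ _) (fsubset_refl (msupp z))).
rewrite -big_split /=; apply: eq_bigr => p _.
rewrite -big_split /=; apply: eq_bigr => q _.
by rewrite mcoeffD mulrDl monomialD.
Qed.

Lemma palg_mulDr : right_distributive palg_mul +%R.
Proof.
move=> z x y.
pose d := fsetU (msupp x) (msupp y).
rewrite (palg_mulw (d2 := d) (fsubset_refl _) (msuppD_le _ _)).
rewrite (palg_mulw (d2 := d) (fsubset_refl (msupp z)) (fsubsetUl _ _)).
rewrite (palg_mulw (d2 := d) (fsubset_refl (msupp z)) (fsubsetUr _ _)).
rewrite -big_split /=; apply: eq_bigr => p _.
rewrite -big_split /=; apply: eq_bigr => q _.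
by rewrite mcoeffD mulrDr monomialD.
Qed.

Lemma palg_mul0r x : palg_mul 0 x = 0.
Proof. by rewrite /palg_mul msupp0 big_seq_fset0. Qed.

Lemma palg_mulr0 x : palg_mul x 0 = 0.
Proof. by rewrite /palg_mul; apply: big1 => p _; rewrite msupp0 big_seq_fset0. Qed.

Lemma palg_mulUU c1 c2 p q :
  palg_mul << c1 *g p >> << c2 *g q >> = monomial (c1 * c2) (path_mul p q).
Proof.
by rewrite (palg_mulw msuppU_le msuppU_le) !big_seq_fset1 !mcoeffUU.
Qed.

Lemma palg_mul_suml I (s : seq I) (F : I -> path_algebra) y :
  palg_mul (\sum_(i <- s) F i) y = \sum_(i <- s) palg_mul (F i) y.
Proof.
exact: (big_morph (palg_mul^~ y) (fun a b => palg_mulDl a b y) (palg_mul0r y)).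
Qed.

Lemma palg_mul_sumr I (s : seq I) (F : I -> path_algebra) x :
  palg_mul x (\sum_(i <- s) F i) = \sum_(i <- s) palg_mul x (F i).
Proof.
exact: (big_morph (palg_mul x) (palg_mulDr x) (palg_mulr0 x)).
Qed.

Lemma palg_mulA : associative palg_mul.
Proof.
move=> x y z; rewrite [x]monalgE; move: (msupp x) => dx.
rewrite (palg_mul_suml dx _ (palg_mul y z)) (palg_mul_suml dx _ y).
rewrite (palg_mul_suml dx _ z); apply: eq_bigr => p _; move: (x@_p) => c1.
rewrite [y]monalgE; move: (msupp y) => dy.
rewrite (palg_mul_suml dy _ z) (palg_mul_sumr dy _ << c1 *g p >>).
rewrite (palg_mul_sumr dy _ << c1 *g p >>) (palg_mul_suml dy _ z).
apply: eq_bigr => q _; move: (y@_q) => c2.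
rewrite [z]monalgE; move: (msupp z) => dz; set xy := palg_mul _ << c2 *g q >>.
rewrite (palg_mul_sumr dz _ xy) (palg_mul_sumr dz _ << c2 *g q >>).
rewrite palg_mul_sumr; apply: eq_bigr => r _; move: (z@_r) => c3.
rewrite /xy !palg_mulUU; have := path_mulA p q r.
case: (path_mul q r) => [u|] /=; case: (path_mul p q) => [w|] /= e.
- by rewrite !palg_mulUU e mulrA.
- by rewrite palg_mulUU e palg_mul0r.
- by rewrite palg_mulUU -e palg_mulr0.
- by rewrite palg_mul0r palg_mulr0.
Qed.

Lemma palg_mul1r : left_id palg_one palg_mul.
Proof.
move=> x; rewrite {1}(monalgE x) [RHS]monalgE palg_mul_sumr.
apply: eq_bigr => p _; rewrite palg_mul_suml (bigD1 (path_target p)) //=.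
rewrite palg_mulUU path_mul1p eqxx mul1r big1 ?addr0 // => v /negbTE nv.
by rewrite palg_mulUU path_mul1p nv.
Qed.

Lemma palg_mulr1 : right_id palg_one palg_mul.
Proof.
move=> x; rewrite {1}(monalgE x) [RHS]monalgE palg_mul_suml.
apply: eq_bigr => p _; rewrite palg_mul_sumr (bigD1 (path_source p)) //=.
rewrite palg_mulUU path_mulp1 eqxx mulr1 big1 ?addr0 // => v /negbTE nv.
by rewrite palg_mulUU path_mulp1 nv.
Qed.

HB.instance Definition _ := GRing.Zmodule_isPzRing.Build path_algebra
  palg_mulA palg_mul1r palg_mulr1 palg_mulDl palg_mulDr.

Lemma monomialZ c c' o : monomial (c * c') o = c *: monomial c' o.
Proof.
case: o => [p|] /=; last by rewrite scaler0.
by apply/malgP=> q; rewrite mcoeffZ !mcoeffU mulrnAr.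
Qed.

Lemma palg_scalerAl (c : k) (x y : path_algebra) : c *: (x * y) = (c *: x) * y.
Proof.
apply/esym; apply: etrans (palg_mulw (msuppZ_le c x) (fsubset_refl _)) _.
apply/esym.
rewrite scaler_sumr; apply: eq_bigr => p _; rewrite scaler_sumr.
by apply: eq_bigr => q _; rewrite mcoeffZ -mulrA -monomialZ.
Qed.

Lemma palg_scalerAr (c : k) (x y : path_algebra) : c *: (x * y) = x * (c *: y).
Proof.
apply/esym; apply: etrans (palg_mulw (fsubset_refl _) (msuppZ_le c y)) _.
apply/esym.
rewrite scaler_sumr; apply: eq_bigr => p _; rewrite scaler_sumr.
by apply: eq_bigr => q _; rewrite mcoeffZ mulrCA -monomialZ.
Qed.

(* (kQ)_t, the span of the paths of length t *)
Definition homogeneous (t : nat) : set path_algebra :=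
  [set x | forall p, p \in msupp x -> path_length p = t].

(* The lengths, sources and targets of the paths occurring in x agree. *)
Definition is_relation (x : path_algebra) : Prop :=
  exists (n : nat) (i j : vertex Q), (2 <= n)%N /\
    forall p, p \in msupp x ->
      [/\ path_length p = n, path_source p = i & path_target p = j].

Section BoundQuiverAlgebra.
Variable I : ideal path_algebra.

Definition bound_algebra : pzRingType := quot_ring I.

Definition bound_grading (t : nat) : set bound_algebra :=
  [set to_quot I x | x in homogeneous t].

Definition bound_idempotent (i : vertex Q) : bound_algebra :=
  to_quot I (of_path (trivial_path i)).

End BoundQuiverAlgebra.

End PathAlgebra.

Arguments bound_grading {k Q} I t _.

(** * The McKay quiver of Z/s x Z/r *)

Inductive mckay_dir := Alpha | Beta | Gamma.

Definition nat_of_dir (x : mckay_dir) : 'I_3 :=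
  match x with Alpha => inord 0 | Beta => inord 1 | Gamma => inord 2 end.
Definition dir_of_nat (i : 'I_3) : mckay_dir :=
  match val i with 0%N => Alpha | 1%N => Beta | _ => Gamma end.
Lemma nat_of_dirK : cancel nat_of_dir dir_of_nat.
Proof. by case; rewrite /dir_of_nat /= inordK. Qed.
HB.instance Definition _ := Equality.copy mckay_dir (can_type nat_of_dirK).
HB.instance Definition _ := Choice.copy mckay_dir (can_type nat_of_dirK).
HB.instance Definition _ := Countable.copy mckay_dir (can_type nat_of_dirK).
HB.instance Definition _ := Finite.copy mckay_dir (can_type nat_of_dirK).

Section McKay.
(* 'Z_n is Z/n only for n >= 2. *)
Variables s r : nat.

Definition mckay_vertex : Type := ('Z_s * 'Z_r)%type.

Definition e1 : mckay_vertex := (1, 0).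
Definition e2 : mckay_vertex := (0, 1).
Definition e : mckay_vertex := e1 + e2.

Definition shift (x : mckay_dir) : mckay_vertex :=
  match x with Alpha => e1 | Beta => e2 | Gamma => - e end.

Definition mckay : quiver :=
  @Quiver mckay_vertex (mckay_vertex * mckay_dir)%type
    (fun a => a.1) (fun a => a.1 + shift a.2).

Variable k : fieldType.
Implicit Types (i : mckay_vertex) (c : k).
Local Notation kQ := (path_algebra k mckay).

Definition alpha i : kQ := of_path k (@arrow_path mckay (i, Alpha)).
Definition beta i : kQ := of_path k (@arrow_path mckay (i, Beta)).
Definition gamma i : kQ := of_path k (@arrow_path mckay (i, Gamma)).

Definition z_gamma i c : kQ :=
  c *: (beta (i + e1) * alpha i) + alpha (i + e2) * beta i.
Definition z_beta i c : kQ :=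
  c *: (alpha (i - e) * gamma i) + gamma (i + e1) * alpha i.
Definition z_alpha i c : kQ :=
  c *: (beta (i - e) * gamma i) + gamma (i + e2) * beta i.

Definition rho (a b c : mckay_vertex -> k) : set kQ :=
  [set x | exists i,
     [\/ x = z_alpha i (a i), x = z_beta i (b i) | x = z_gamma i (c i)]] `|`
  [set x | exists i,
     [\/ x = alpha (i + e1) * alpha i, x = beta (i + e2) * beta i
       | x = gamma (i - e) * gamma i]].

End McKay.

(* Main.v *)
From HB Require Import structures.
From mathcomp Require Import finmap.
From mathcomp Require Import zify.
Require Import Defs.
Import GRing.Theory.
Set Implicit Arguments.
Unset Strict Implicit.
Unset Printing Implicit Defensive.
Local Open Scope classical_set_scope.
Local Open Scope ring_scope.

(** Write A = kQ/I, graded by length, and let x, y, z stand for the three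
    directions alpha, beta, gamma in some order.  A word is read from right to
    left, like a composed path: yx is a step x followed by a step y.

    The argument has four parts.

    Frobenius behaviour of A.  Since A_0 has a graded projective cover with
    superfluous kernel, the elements of positive degree lie in the Jacobson
    radical ([positive_jacobson]); the modules A e_i are indecomposable
    projective, so Loewy length four gives A_4 = 0 ([G4_zero]).  Triviality of
    the translation makes A_3 e_i a line of loops at i ([socle]).  By
    self-injectivity, an element u killed by all arrows is obtained from a socle
    generator by a right multiplication, so that u = 0 if its degree is less
    than three ([left_nondegenerate]).

    Rhombi.  As s, r >= 4, three steps form a loop only if their directions are
    distinct.  Hence xx = 0 ([step_square]), the space of degree two between
    opposite corners of a rhombus is a line ([degree2_line]), at least one of the
    two paths around the rhombus is nonzero ([nz_or]), and nonvanishing is shared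
    by the three paths yx, zy, xz of length two on a triangle with sides x, y, z
    ([nz_rot]).  So I contains all squares and, for every rhombus, one relation
    up to scalars; it remains to see that both of its coefficients are nonzero.

    Degenerate rhombi.  This is where the resolution P of A_0 is used.  An
    element of degree t of P^t has a coefficient along every word of length t
    ([fcoef]); these coefficients are orthogonal to the relations of A
    ([fcoef_relation]), and the boundaries of degree t+2 in P^t are controlled by
    the coefficients of words of length t+1 ([boundary_coef]).  Because zz = 0,
    the powers of z give a cycle in every degree, so the linear part of the
    resolution is infinite ([linear_range_infinite]).  Suppose that yx vanishes
    at v, and walk along v_n = v + n z.  The triangles with sides x, z, y at the
    v_n do not vanish, since otherwise zy applied after a power of z would
    give a cycle which is not a boundary ([down_nonzero]).  The walk is periodic, so yx
    vanishes at some v_t with t > 0; take the first one.  Then a combination of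
    yz x z^(t-1) and xy z^t is a cycle, and it is not a boundary because its
    coefficient yz along x z^(t-1) is not zero ([no_second_zero]).  Hence no
    rhombus is degenerate ([two_step_neq0]).

    Sufficiency of the relations.  Modulo the squares and nondegenerate rhombus
    relations, every path of length two or three is zero or a multiple of one
    path with the same source and target, and longer paths vanish
    ([degree2_line_presented], [degree3_line_presented], [degree4_presented]).
    These paths are nonzero in A, so a homogeneous element of I is zero modulo
    the relations ([ideal_sub_rho]). *)

(** * The length grading of a path algebra *)
Local Opaque palg_mul monalg.fgadd monalg.fgopp monalg.fgscale monalg.fgzero.
Section PathAlgebraGrading.
Variables (k : fieldType) (Q : quiver).
Local Notation kQ := (path_algebra k Q).
Implicit Types (x y : kQ) (p : qpath Q) (c : k) (t : nat).

(** Coefficients, monomials and homogeneous components are locked: all that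
    matters below are their values on paths. *)
Fact cf_key : unit. Proof. by []. Qed.
Definition cf : qpath Q -> kQ -> k := locked_with cf_key (fun p x => x@_p).
Lemma cfE p x : cf p x = x@_p. Proof. by rewrite /cf unlock. Qed.
Fact mono_key : unit. Proof. by []. Qed.
Definition mono : k -> qpath Q -> kQ := locked_with mono_key (fun c p => << c *g p >>).
Lemma monoU c p : mono c p = << c *g p >>. Proof. by rewrite /mono unlock. Qed.

Lemma cf_is_additive p : additive (cf p).
Proof. by move=> x y; rewrite !cfE; apply: (@mcoeff_is_additive _ k p). Qed.
HB.instance Definition _ p := GRing.isAdditive.Build kQ k (cf p) (cf_is_additive p).

Lemma cfZ p c x : cf p (c *: x) = c * cf p x.
Proof. by rewrite !cfE; apply: mcoeffZ. Qed.

Lemma cfP x y : (forall p, cf p x = cf p y) -> x = y.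
Proof. by move=> h; apply/malgP => p; move: (h p); rewrite !cfE. Qed.

Lemma cf_out p x : p \notin msupp x -> cf p x = 0.
Proof. by rewrite cfE; apply: mcoeff_outdom. Qed.

Lemma cf_in p x : (p \in msupp x) = (cf p x != 0).
Proof. by rewrite cfE -mcoeff_neq0. Qed.

Lemma palg_ind (P : kQ -> Prop) :
  P 0 -> (forall x y, P x -> P y -> P (x + y)) -> (forall c p, P (mono c p)) ->
  forall x, P x.
Proof.
move=> P0 PD PU x; rewrite (monalgE x).
by apply: (big_ind P) => // p _; rewrite -monoU; apply: PU.
Qed.

Lemma cf_mono c p p' : cf p' (mono c p) = if p' == p then c else 0.
Proof. by rewrite cfE monoU mcoeffU eq_sym; case: eqP; rewrite ?mulr1n ?mulr0n. Qed.

Lemma monoM c c' p p' : mono c p * mono c' p' = monomial (c * c') (path_mul p p').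
Proof. by rewrite !monoU; apply: palg_mulUU. Qed.

Lemma monoE c p : mono c p = c *: of_path k p.
Proof.
apply/cfP => p'; rewrite cfZ /of_path -monoU !cf_mono.
by case: eqP; rewrite ?mulr1 ?mulr0.
Qed.

Lemma path_mul_length p p' p'' :
  path_mul p p' = Some p'' -> path_length p'' = (path_length p + path_length p')%N.
Proof.
rewrite /path_mul; case: eqP => // e.
have [r [+ _ h2]] := path_mulP e.
rewrite /path_mul e eqxx => -> [<-].
by rewrite /path_length h2 size_cat addnC.
Qed.

Fact hpart_key : unit. Proof. by []. Qed.
Definition hpart : nat -> kQ -> kQ := locked_with hpart_key
  (fun t x => \sum_(p <- msupp x | path_length p == t) mono (cf p x) p).

Lemma cf_hpart t x p : cf p (hpart t x) = if path_length p == t then cf p x else 0.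
Proof.
rewrite /hpart unlock raddf_sum /=.
under eq_bigr do rewrite cf_mono.
have [xp|xp] := boolP (p \in msupp x).
  rewrite big_mkcond (bigD1_seq p) ?fset_uniq //= eqxx big1 ?addr0 // => p' np.
  by rewrite [p == _]eq_sym (negbTE np) if_same.
rewrite big_seq_cond big1 => [|p' /andP[p'x _]]; first by rewrite (cf_out xp) if_same.
by case: eqP => // e; rewrite -e (negbTE xp) in p'x.
Qed.

Lemma hpart_is_additive t : additive (hpart t).
Proof.
move=> x y; apply/cfP => p.
by rewrite raddfB /= !cf_hpart raddfB /=; case: eqP => //; rewrite subrr.
Qed.
HB.instance Definition _ t := GRing.isAdditive.Build kQ kQ (hpart t) (hpart_is_additive t).

Lemma hpartZ t c x : hpart t (c *: x) = c *: hpart t x.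
Proof.
by apply/cfP => p; rewrite cfZ !cf_hpart cfZ; case: eqP => //; rewrite mulr0.
Qed.

Lemma homogeneousP t x : homogeneous t x <-> hpart t x = x.
Proof.
split=> [h | h p].
  apply/cfP => p; rewrite cf_hpart; case: eqP => // np.
  by rewrite cf_out //; apply/negP => /h.
by rewrite cf_in -h cf_hpart; case: (_ =P t) => // _; rewrite eqxx.
Qed.

Lemma hpart_hpart t t' x : hpart t (hpart t' x) = if t == t' then hpart t x else 0.
Proof.
apply/cfP => p; rewrite !cf_hpart; case: (eqVneq t t') => [->|nt].
  by rewrite cf_hpart; case: eqP.
by rewrite raddf0; case: eqP => // ->; rewrite (negbTE nt).
Qed.

Lemma hpart_homogeneous t x : homogeneous t (hpart t x).
Proof. by apply/homogeneousP; rewrite hpart_hpart eqxx. Qed.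

Lemma sum_hpart x : exists N, x = \sum_(t < N) hpart t x.
Proof.
exists (\max_(p <- msupp x) (path_length p)).+1; apply/cfP => p.
rewrite raddf_sum /=; under eq_bigr do rewrite cf_hpart.
have [xp|xp] := boolP (p \in msupp x); last first.
  by rewrite big1 ?(cf_out xp) // => t _; rewrite if_same.
have lp : (path_length p < (\max_(p <- msupp x) (path_length p)).+1)%N.
  by rewrite ltnS; apply: (@leq_bigmax_seq _ _ xpredT (fun p => path_length p)).
by rewrite (bigD1 (Ordinal lp)) //= eqxx big1 ?addr0 // => t;
  rewrite -val_eqE /= eq_sym => /negbTE ->.
Qed.

Lemma homogeneous_mono c p : homogeneous (path_length p) (mono c p).
Proof.
apply/homogeneousP/cfP => p'; rewrite cf_hpart cf_mono.
by case: (p' =P p) => [->|]; rewrite ?eqxx ?if_same.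
Qed.

Lemma homogeneous_monomial t c o :
  (forall p, o = Some p -> path_length p = t) -> homogeneous t (monomial c o : kQ).
Proof.
case: o => [p|] h /=; last by move=> p'; rewrite msupp0 inE.
by rewrite -(h p erefl) -monoU; apply: homogeneous_mono.
Qed.

Lemma homogeneous_sum (J : Type) (l : seq J) (P : pred J) t (F : J -> kQ) :
  (forall j, P j -> homogeneous t (F j)) -> homogeneous t (\sum_(j <- l | P j) F j).
Proof.
move=> h; apply/homogeneousP; rewrite raddf_sum.
by apply: eq_bigr => j Pj; apply/homogeneousP/h.
Qed.

Local Transparent palg_mul.
Lemma homogeneousM m n x y : homogeneous m x -> homogeneous n y -> homogeneous (m + n) (x * y).
Proof.
move=> hx hy; change (homogeneous (m + n) (palg_mul x y)); rewrite /palg_mul.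
rewrite big_seq; apply: homogeneous_sum => p /hx lp.
rewrite big_seq; apply: homogeneous_sum => p' /hy lp'.
by apply: homogeneous_monomial => p'' /path_mul_length ->; rewrite lp lp'.
Qed.
Local Opaque palg_mul.

Lemma hpart_homog t t' x : homogeneous t' x -> hpart t x = if t == t' then x else 0.
Proof.
by move=> /homogeneousP h; rewrite -{1}h hpart_hpart; case: eqP => // ->.
Qed.

Lemma hpart_mull m x y t : homogeneous m x ->
  hpart (m + t) (x * y) = x * hpart t y.
Proof.
move=> hx; elim/palg_ind: y => [|y z hy hz|c p].
- by rewrite mulr0 !raddf0 mulr0.
- rewrite mulrDr (raddfD (hpart _)) [hpart _ (y + z)](raddfD (hpart _)) /=;
  apply: etrans (congr2 +%R hy hz) (esym (mulrDr _ _ _)).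
have hp := @homogeneous_mono c p.
rewrite (hpart_homog _ (homogeneousM hx hp)) (hpart_homog _ hp) eqn_add2l.
by case: eqP; rewrite ?mulr0.
Qed.

Lemma hpart_mull0 m x y t : homogeneous m x -> (t < m)%N -> hpart t (x * y) = 0.
Proof.
move=> hx lt; elim/palg_ind: y => [|y z hy hz|c p].
- by rewrite mulr0 raddf0.
- by rewrite mulrDr (raddfD (hpart _)); apply: etrans (congr2 +%R hy hz) (addr0 0).
have hp := @homogeneous_mono c p.
rewrite (hpart_homog _ (homogeneousM hx hp)); case: eqP => // e.
by move: lt; rewrite e ltnNge leq_addr.
Qed.

Lemma hpart_mulr m x y t : homogeneous m y ->
  hpart (t + m) (x * y) = hpart t x * y.
Proof.
move=> hy; elim/palg_ind: x => [|x z hx hz|c p].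
- by rewrite mul0r !raddf0 mul0r.
- rewrite mulrDl (raddfD (hpart _)) [hpart _ (x + z)](raddfD (hpart _)) /=;
  apply: etrans (congr2 +%R hx hz) (esym (mulrDl _ _ _)).
have hp := @homogeneous_mono c p.
rewrite (hpart_homog _ (homogeneousM hp hy)) (hpart_homog _ hp) eqn_add2r.
by case: eqP; rewrite ?mul0r.
Qed.

Lemma hpart_mulr0 m x y t : homogeneous m y -> (t < m)%N -> hpart t (x * y) = 0.
Proof.
move=> hy lt; elim/palg_ind: x => [|x z hx hz|c p].
- by rewrite mul0r raddf0.
- by rewrite mulrDl (raddfD (hpart _)); apply: etrans (congr2 +%R hx hz) (addr0 0).
have hp := @homogeneous_mono c p.
rewrite (hpart_homog _ (homogeneousM hp hy)); case: eqP => // e.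
by move: lt; rewrite e ltnNge leq_addl.
Qed.

End PathAlgebraGrading.

Lemma mulr_absorb (R : pzRingType) (x y z : R) :
  x * y = y -> z * z = z -> x * (y * z) = y * z * z.
Proof. by move=> exy ez; rewrite mulrA exy -mulrA ez. Qed.

(** * Paths of length at most one *)
Section LowDegree.
Variables (k : fieldType) (Q : quiver).
Local Notation kQ := (path_algebra k Q).
Implicit Types (x y : kQ) (p : qpath Q) (c : k) (t : nat) (v : vertex Q) (a : arrow Q).

Lemma path_length0 p : path_length p = 0%N -> p = trivial_path (path_source p).
Proof.
move=> /size0nil h; apply/val_inj.
by rewrite /= /path_source [LHS]surjective_pairing h.
Qed.

Lemma path_length1 p : path_length p = 1%N -> exists a, p = arrow_path a.
Proof.
case: p => [[v s] /= cs]; rewrite /path_length /=; case: s cs => [//|a [|//]] cs _.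
by exists a; apply/val_inj => /=; move: cs; rewrite /= andbT => /eqP ->.
Qed.

Lemma path_mul_trivialE p p' v :
  (path_mul p p' == Some (trivial_path v)) = (p == trivial_path v) && (p' == trivial_path v).
Proof.
apply/eqP/andP => [h | [/eqP -> /eqP ->]]; last by rewrite path_mul1p eqxx.
have := path_mul_length h; rewrite [LHS]/= => /esym/eqP;
  rewrite addn_eq0 => /andP[/eqP l1 /eqP l2].
move: h; rewrite (path_length0 l1) path_mul1p; case: eqP => // -> [->].
by rewrite !eqxx.
Qed.

Lemma path_mul_arrowE p p' a :
  (path_mul p p' == Some (arrow_path a)) =
  ((p == trivial_path (target a)) && (p' == arrow_path a)) ||
  ((p == arrow_path a) && (p' == trivial_path (source a))).
Proof.
apply/eqP/orP => [h | [] /andP[/eqP -> /eqP ->]]; last 2 first.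
- by rewrite path_mul1p eqxx.
- by rewrite path_mulp1 eqxx.
have := path_mul_length h; rewrite [LHS]/=.
case l1: (path_length p) => [|[|n]]; rewrite /= ?add1n //.
  by move: h; rewrite (path_length0 l1) path_mul1p; case: eqP => // -> [->] _; left;
    rewrite !eqxx.
case=> /esym l2; right; move: h; rewrite (path_length0 l2) path_mulp1.
by case: eqP => // -> [->]; rewrite !eqxx.
Qed.

Lemma cf_monomial p c o : cf p (monomial c o : kQ) = if o == Some p then c else 0.
Proof.
case: o => [p'|] /=; last by rewrite raddf0.
by rewrite -monoU cf_mono -[Some p' == _]/(p' == p) eq_sym.
Qed.

Lemma cf_trivialM v x y :
  cf (trivial_path v) (x * y) = cf (trivial_path v) x * cf (trivial_path v) y.
Proof.
elim/palg_ind: x => [|x z hx hz|c p]; first by rewrite mul0r raddf0 mul0r.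
  rewrite (mulrDl x) (raddfD (cf _)) [cf _ (x + z)](raddfD (cf _)) /=.
  by apply: etrans (congr2 +%R hx hz) (esym (mulrDl _ _ _)).
elim/palg_ind: y => [|x z hx hz|c' p']; first by rewrite mulr0 raddf0 mulr0.
  rewrite (mulrDr _ x) (raddfD (cf _)) [cf _ (x + z)](raddfD (cf _)) /=.
  by apply: etrans (congr2 +%R hx hz) (esym (mulrDr _ _ _)).
rewrite monoM cf_monomial !cf_mono path_mul_trivialE ![trivial_path v == _]eq_sym.
by do 2 case: eqP; rewrite ?mulr0 ?mul0r.
Qed.

Lemma cf_arrowM a x y :
  cf (arrow_path a) (x * y) =
  cf (trivial_path (target a)) x * cf (arrow_path a) y +
  cf (arrow_path a) x * cf (trivial_path (source a)) y.
Proof.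
elim/palg_ind: x => [|x z hx hz|c p]; first by rewrite mul0r !raddf0 !mul0r addr0.
  rewrite (mulrDl x) (raddfD (cf _)) ![cf _ (x + z)](raddfD (cf _)) /=.
  by apply: etrans (congr2 +%R hx hz) _; rewrite !mulrDl addrACA.
elim/palg_ind: y => [|x z hx hz|c' p']; first by rewrite mulr0 !raddf0 !mulr0 addr0.
  rewrite (mulrDr _ x) (raddfD (cf _)) ![cf _ (x + z)](raddfD (cf _)) /=.
  by apply: etrans (congr2 +%R hx hz) _; rewrite !mulrDr addrACA.
rewrite monoM cf_monomial !cf_mono path_mul_arrowE.
rewrite ![trivial_path _ == _]eq_sym ![arrow_path _ == _]eq_sym.
have [->|n1] := eqVneq p (trivial_path (target a)); have [->|n2] :=
  eqVneq p' (arrow_path a) => /=.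
- have -> : (trivial_path (target a) == arrow_path a) = false
  by apply/eqP => /(congr1 (@path_length Q)).
  by rewrite mul0r addr0.
- have -> : (trivial_path (target a) == arrow_path a) = false
  by apply/eqP => /(congr1 (@path_length Q)).
  by rewrite mul0r mulr0 addr0.
- have -> : (arrow_path a == trivial_path (source a)) = false
  by apply/eqP => /(congr1 (@path_length Q)).
  by rewrite andbF mul0r mulr0 addr0.
- by do 2 case: eqP; rewrite /= ?mul0r ?mulr0 ?addr0 ?add0r.
Qed.

Lemma hpart0E x : hpart 0 x = \sum_v cf (trivial_path v) x *: of_path k (trivial_path v).
Proof.
apply/cfP => p; rewrite cf_hpart (raddf_sum (cf p)) /=.
under eq_bigr do rewrite cfZ /of_path -monoU cf_mono.
case: eqP => [/path_length0 e|n]; last first.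
  by rewrite big1 // => v _; case: eqP => [e|]; rewrite ?mulr0 //; case: n; rewrite e.
rewrite (bigD1 (path_source p)) //= -e eqxx mulr1 big1 ?addr0 // => v nv.
by case: eqP => [e'|]; rewrite ?mulr0 //; case/eqP: nv; rewrite e'.
Qed.

Lemma hpart1E x : hpart 1 x = \sum_a cf (arrow_path a) x *: of_path k (arrow_path a).
Proof.
apply/cfP => p; rewrite cf_hpart (raddf_sum (cf p)) /=.
under eq_bigr do rewrite cfZ /of_path -monoU cf_mono.
case: eqP => [/path_length1[a e]|n]; last first.
  by rewrite big1 // => v _; case: eqP => [e|]; rewrite ?mulr0 //; case: n; rewrite e.
rewrite (bigD1 a) //= -e eqxx mulr1 big1 ?addr0 // => b nb.
by case: eqP => [e'|]; rewrite ?mulr0 //; case/eqP: nb; move: e'; rewrite e => /(congr1 val) [].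
Qed.

Lemma of_pathM p p' : of_path k p * of_path k p' = monomial 1 (path_mul p p').
Proof. by rewrite /of_path -!monoU monoM mulr1. Qed.

(** Sequences of arrows that do not compose are allowed and give zero, so that
    a path can be taken apart arrow by arrow. *)
Fixpoint word v (s : seq (arrow Q)) : kQ :=
  if s is a :: s' then word (target a) s' * (of_path k (arrow_path a) * of_path k
    (trivial_path v))
  else of_path k (trivial_path v).

Lemma of_pathE p : of_path k p = word (path_source p) (val p).2.
Proof.
case: p => [[v s] cs]; rewrite /path_source /=.
elim: s v cs => [|a s IHs] v cs /=; first by congr of_path; apply/val_inj.
have /= /andP[/eqP ev cs'] := cs; case: _ / ev cs => cs.
rewrite -(IHs _ cs') (of_pathM (arrow_path a)) path_mulp1 eqxx /=.
rewrite -/(of_path k _) of_pathM.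
have [|r [-> rs rv]] := @path_mulP _ (@QPath Q (target a, s) cs') (arrow_path a); first by [].
congr of_path; apply/val_inj.
by rewrite [val r]surjective_pairing rs rv.
Qed.

Lemma homogeneous_word v s : homogeneous (size s) (word v s).
Proof.
elim: s v => [|a s IHs] v /=; first by rewrite /of_path -monoU; apply: homogeneous_mono.
rewrite -addn1 -[1%N]addn0; apply: homogeneousM => //; apply: homogeneousM.
  by rewrite /of_path -monoU; apply: (@homogeneous_mono _ _ _ (arrow_path a)).
by rewrite /of_path -monoU; apply: (@homogeneous_mono _ _ _ (trivial_path v)).
Qed.

Lemma word_rcons v s a : exists v', word v (rcons s a) =
  of_path k (arrow_path a) * of_path k (trivial_path v') * word v s.
Proof.
elim: s v => [|b s IHs] v /=.
  exists v; apply: mulr_absorb; apply: etrans (of_pathM _ _) _.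
    by rewrite path_mul1p eqxx.
  by rewrite path_mul1p eqxx.
have [v' e] := IHs (target b); exists v'.
exact: etrans (congr1 (fun z => z * _) e) (esym (mulrA _ _ _)).
Qed.

End LowDegree.

(** * Quotients of path algebras by relations *)
(** What a quotient of kQ by relations retains of kQ.  Relations have length at
    least two, so elements of A still have a coefficient [qr_vcoef v] at the
    trivial path of [v] and [qr_acoef a] at the arrow [a]; [qr_part n] is the
    projection to degree [n], and [qr_sc] the embedding of the scalars. *)
Record quiver_ring (k : fieldType) (Q : quiver) (A : pzRingType)
    (G : nat -> set A) (E : vertex Q -> A) := QuiverRing {
  qr_sc : k -> A;
  qr_arrow : arrow Q -> A;
  qr_part : nat -> A -> A;
  qr_vcoef : vertex Q -> A -> k;
  qr_acoef : arrow Q -> A -> k;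
  scD : {morph qr_sc : c d / c + d};
  scM : {morph qr_sc : c d / c * d};
  sc1 : qr_sc 1 = 1;
  scC : forall c u, qr_sc c * u = u * qr_sc c;
  idemM : forall v w, E v * E w = if v == w then E v else 0;
  sum_idem : \sum_v E v = 1;
  target_arrow : forall a, E (target a) * qr_arrow a = qr_arrow a;
  arrow_source : forall a, qr_arrow a * E (source a) = qr_arrow a;
  GD : forall n u w, G n u -> G n w -> G n (u + w);
  GM : forall m n u w, G m u -> G n w -> G (m + n)%N (u * w);
  G_idem : forall v, G 0%N (E v);
  G_sc : forall c, G 0%N (qr_sc c);
  G_arrow : forall a, G 1%N (qr_arrow a);
  G_decomp : forall n u, G n.+1 u -> exists F : arrow Q -> A,
    (forall a, G n (F a)) /\ u = \sum_a qr_arrow a * F a;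
  partD : forall n, {morph qr_part n : u w / u + w};
  partG : forall n u, G n (qr_part n u);
  part_homog : forall m n u, G n u -> qr_part m u = if m == n then u else 0;
  part_mull : forall m n u w, G m u -> qr_part (m + n)%N (u * w) = u * qr_part n w;
  part_mull0 : forall m n u w, G m u -> (n < m)%N -> qr_part n (u * w) = 0;
  part_mulr : forall m n u w, G m w -> qr_part (n + m)%N (u * w) = qr_part n u * w;
  part_mulr0 : forall m n u w, G m w -> (n < m)%N -> qr_part n (u * w) = 0;
  sum_part : forall u, exists N, u = \sum_(n < N) qr_part n u;
  vcoefD : forall v, {morph qr_vcoef v : u w / u + w};
  acoefD : forall a, {morph qr_acoef a : u w / u + w};
  vcoefM : forall v, {morph qr_vcoef v : u w / u * w};
  acoefM : forall a u w, qr_acoef a (u * w) =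
    qr_vcoef (target a) u * qr_acoef a w + qr_acoef a u * qr_vcoef (source a) w;
  vcoef_idem : forall v w, qr_vcoef v (E w) = (v == w)%:R;
  vcoef_sc : forall v c, qr_vcoef v (qr_sc c) = c;
  acoef_arrow : forall a b, qr_acoef a (qr_arrow b) = (a == b)%:R;
  part0E : forall u, qr_part 0 u = \sum_v qr_sc (qr_vcoef v u) * E v;
  part1E : forall u, qr_part 1 u = \sum_a qr_sc (qr_acoef a u) * qr_arrow a
}.

Section IdealClosure.
Variables (R : pzRingType) (J : ideal R).
Local Notation inJ := (ideal_set J).
Lemma ideal0 : inJ 0. Proof. by have [] := idealP J. Qed.
Lemma idealB x y : inJ x -> inJ y -> inJ (x - y).
Proof. by have [_ h _ _] := idealP J; apply: h. Qed.
Lemma idealN x : inJ x -> inJ (- x).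
Proof. by rewrite -[- x]sub0r; apply: idealB; apply: ideal0. Qed.
Lemma idealD x y : inJ x -> inJ y -> inJ (x + y).
Proof. by move=> hx hy; rewrite -[y]opprK; apply: idealB => //; apply: idealN. Qed.
Lemma idealMl a x : inJ x -> inJ (a * x).
Proof. by have [_ _ h _] := idealP J; apply: h. Qed.
Lemma idealMr a x : inJ x -> inJ (x * a).
Proof. by have [_ _ _ h] := idealP J; apply: h. Qed.
Lemma ideal_sum (K : Type) (l : seq K) (P : pred K) (F : K -> R) :
  (forall j, P j -> inJ (F j)) -> inJ (\sum_(j <- l | P j) F j).
Proof. by apply: (big_ind inJ) => [|x y]; [apply: ideal0 | apply: idealD]. Qed.
End IdealClosure.

Section RelationIdeal.
Variables (k : fieldType) (Q : quiver) (I : ideal (path_algebra k Q)).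
Local Notation kQ := (path_algebra k Q).
Hypothesis hI : exists S : set kQ,
       (forall x, S x -> is_relation x) /\ I = ideal_gen S :> set kQ.
Local Notation inI := (ideal_set I).

Lemma relation_length_ge2 (x : kQ) : is_relation x -> hpart 0 x = 0 /\ hpart 1 x = 0.
Proof.
case=> n [i [j [n2 h]]].
have hx : homogeneous n x by move=> p /h [].
by rewrite !(hpart_homog _ hx); split; case: eqP => // e; rewrite -e in n2.
Qed.

(** The elements all of whose components lie in I form an ideal, and it contains
    the generators, which are homogeneous. *)
Lemma ideal_hpart x t : inI x -> inI (hpart t x).
Proof.
have [S [Srel ->]] := hI; move: t.
have J_ideal : is_ideal [set x | forall t, ideal_set (ideal_gen S) (hpart t x)].
  split=> [t|y z hy hz t|a y hy t|a y hy t].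
  - by rewrite (raddf0 (hpart t)); apply: ideal0.
  - by rewrite (raddfB (hpart t)); apply: idealB; [apply: hy | apply: hz].
  - have [N ->] := sum_hpart a; rewrite mulr_suml (raddf_sum (hpart t)) /=.
    apply: (@ideal_sum _ (ideal_gen S)) => n _; have hn := @hpart_homogeneous _ _ n a.
    have [le|lt] := leqP n t.
      by rewrite -(subnKC le) (hpart_mull _ _ hn); apply: idealMl; apply: hy.
    by rewrite (hpart_mull0 _ hn lt); apply: ideal0.
  - have [N ->] := sum_hpart a; rewrite mulr_sumr (raddf_sum (hpart t)) /=.
    apply: (@ideal_sum _ (ideal_gen S)) => n _; have hn := @hpart_homogeneous _ _ n a.
    have [le|lt] := leqP n t.
      by rewrite -(subnK le) (hpart_mulr _ _ hn); apply: idealMr; apply: hy.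
    by rewrite (hpart_mulr0 _ hn lt); apply: ideal0.
move=> t0 Ix; suff H : ideal_set (Ideal J_ideal) x by exact: (H t0).
apply: Ix => y Sy t /=.
have [n [i [j [_ h]]]] := Srel _ Sy.
have hy : homogeneous n y by move=> p /h [].
rewrite (hpart_homog _ hy); case: (t == n); last exact: (@ideal0 _ (ideal_gen S)).
by move=> J SJ; apply: SJ.
Qed.

(** Vanishing of the components of degree zero and one is a condition that
    defines an ideal, and the generators satisfy it. *)
Lemma ideal_length_ge2 x : inI x -> hpart 0 x = 0 /\ hpart 1 x = 0.
Proof.
have [S [Srel ->]] := hI.
have vertex0 (y : kQ) : hpart 0 y = 0 -> forall v, cf (trivial_path v) y = 0.
  by move=> h v; have := cf_hpart 0 y (trivial_path v); rewrite h raddf0 /= => <-.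
have J_ideal : is_ideal [set x : kQ | hpart 0 x = 0 /\ hpart 1 x = 0].
  split=> [|y z [y0 y1] [z0 z1]|a y [y0 y1]|a y [y0 y1]].
  - by split; apply: raddf0.
  - by split; rewrite (raddfB (hpart _)) /= ?y0 ?z0 ?y1 ?z1; apply: subrr.
  - have [N ->] := sum_hpart a; split=> /=; rewrite mulr_suml (raddf_sum (hpart _)) /=;
    apply: big1 => -[[|[|n]] lt] _ /=.
    + by rewrite -[0%N]addn0 (hpart_mull _ _ (@hpart_homogeneous _ _ _ _)) y0 mulr0.
    + by rewrite (hpart_mull0 _ (@hpart_homogeneous _ _ _ _)).
    + by rewrite (hpart_mull0 _ (@hpart_homogeneous _ _ _ _)).
    + by rewrite -[1%N]add0n (hpart_mull _ _ (@hpart_homogeneous _ _ _ _)) y1 mulr0.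
    + by rewrite -[1%N]addn0 (hpart_mull _ _ (@hpart_homogeneous _ _ _ _)) y0 mulr0.
    + by rewrite (hpart_mull0 _ (@hpart_homogeneous _ _ _ _)).
  - have [N ->] := sum_hpart a; split=> /=; rewrite mulr_sumr (raddf_sum (hpart _)) /=;
    apply: big1 => -[[|[|n]] lt] _ /=.
    + by rewrite -[0%N]addn0 (hpart_mulr _ _ (@hpart_homogeneous _ _ _ _)) y0 mul0r.
    + by rewrite (hpart_mulr0 _ (@hpart_homogeneous _ _ _ _)).
    + by rewrite (hpart_mulr0 _ (@hpart_homogeneous _ _ _ _)).
    + by rewrite -[1%N]addn0 (hpart_mulr _ _ (@hpart_homogeneous _ _ _ _)) y1 mul0r.
    + by rewrite -[1%N]add0n (hpart_mulr _ _ (@hpart_homogeneous _ _ _ _)) y0 mul0r.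
    + by rewrite (hpart_mulr0 _ (@hpart_homogeneous _ _ _ _)).
by move=> Ix; apply: (Ix (Ideal J_ideal)) => y /Srel h; apply: relation_length_ge2.
Qed.

End RelationIdeal.

Section BoundQuiver.
Variables (k : fieldType) (Q : quiver) (I : ideal (path_algebra k Q)).
Local Notation kQ := (path_algebra k Q).
Hypothesis hI : exists S : set kQ,
       (forall x, S x -> is_relation x) /\ I = ideal_gen S :> set kQ.
Local Notation A := (bound_algebra I).
Local Notation q := (to_quot I).
Local Notation inI := (ideal_set I).
Implicit Types (x y : kQ) (u w : A).

Lemma to_quot0 : q 0 = 0 :> A.
Proof. by apply: (@addrI A (q 0)); rewrite -[LHS]to_quotD !addr0. Qed.

Lemma to_quot_sum (K : Type) (l : seq K) (P : pred K) (F : K -> kQ) :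
  q (\sum_(j <- l | P j) F j) = \sum_(j <- l | P j) q (F j) :> A.
Proof. exact: (big_morph q (to_quotD I) to_quot0). Qed.

Lemma cf_ideal (p : qpath Q) x : (path_length p < 2)%N -> inI x -> cf p x = 0.
Proof.
move=> lp /(ideal_length_ge2 hI)[x0 x1].
case lp': (path_length p) lp => [|[|n]] // _.
  by have := cf_hpart 0 x p; rewrite x0 raddf0 lp' /= => <-.
by have := cf_hpart 1 x p; rewrite x1 raddf0 lp' /= => <-.
Qed.

(** Computed on a representative, which is harmless for [bhpart] and [bsc], and
    for [bcf] on paths of length less than two. *)
Definition bhpart (t : nat) u : A := q (hpart t (repr u)).
Definition bcf (p : qpath Q) u : k := cf p (repr u).
Definition bsc (c : k) : A := q (c *: (1 : kQ)).

Lemma bhpartq t x : bhpart t (q x) = q (hpart t x).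
Proof.
apply/to_quotP; have := ideal_hpart hI t (repr_quotP I x).
by rewrite (raddfB (hpart t)).
Qed.

Lemma bcfq p x : (path_length p < 2)%N -> bcf p (q x) = cf p x.
Proof.
move=> lp; apply/eqP; rewrite -subr_eq0 -(raddfB (cf p)); apply/eqP.
by apply: cf_ideal => //; apply: repr_quotP.
Qed.

Lemma bscMl c x : bsc c * q x = q (c *: x).
Proof.
by rewrite -[LHS]to_quotM -palg_scalerAl mul1r.
Qed.

Lemma bscMr c x : q x * bsc c = q (c *: x).
Proof.
by rewrite -[LHS]to_quotM -palg_scalerAr mulr1.
Qed.

Lemma to_quot_mul x y : q x * q y = q (x * y) :> A.
Proof. by rewrite [RHS]to_quotM. Qed.

Lemma to_quot_add x y : q x + q y = q (x + y) :> A.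
Proof. by rewrite to_quotD. Qed.

Lemma bgradingP n x : homogeneous n x -> bound_grading I n (q x).
Proof. by move=> h; exists x. Qed.

Lemma homogeneousD n (x y : kQ) : homogeneous n x -> homogeneous n y -> homogeneous n (x + y).
Proof.
move=> /homogeneousP hx /homogeneousP hy; apply/homogeneousP.
by rewrite (raddfD (hpart n)) /= hx hy.
Qed.

Lemma homogeneousZ n c (x : kQ) : homogeneous n x -> homogeneous n (c *: x).
Proof. by move=> /homogeneousP hx; apply/homogeneousP; rewrite hpartZ hx. Qed.

Lemma homogeneous0 n : homogeneous n (0 : kQ).
Proof. by apply/homogeneousP; rewrite (raddf0 (hpart n)). Qed.

Lemma homogeneous_path (p : qpath Q) : homogeneous (path_length p) (of_path k p).
Proof. by rewrite /of_path -monoU; apply: homogeneous_mono. Qed.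

Lemma homogeneous1 : homogeneous 0 (1 : kQ).
Proof.
change (homogeneous 0 (palg_one k Q)); rewrite /palg_one.
apply: homogeneous_sum => v _. by exact: (@homogeneous_path (trivial_path v)).
Qed.

Lemma bgrading_dec n u : bound_grading I n.+1 u -> exists F : arrow Q -> A,
    (forall a, bound_grading I n (F a)) /\ u = \sum_a q (of_path k (arrow_path a)) * F a.
Proof.
case=> x hx <-{u}; rewrite [x in q x]monalgE to_quot_sum big_seq.
apply: (big_ind (fun u => exists F : arrow Q -> A,
    (forall a, bound_grading I n (F a)) /\ u = \sum_a q (of_path k (arrow_path a)) * F a)).
- exists (fun=> q 0); split=> [a|]; first exact/bgradingP/homogeneous0.
  by rewrite big1 // => a _; rewrite to_quot0 mulr0.
- move=> u w [F [hF ->]] [F' [hF' ->]]; exists (fun a => F a + F' a); split=> [a|].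
    have [y hy <-] := hF a; have [z hz <-] := hF' a.
    by rewrite to_quot_add; apply/bgradingP/homogeneousD.
  by rewrite -big_split /=; apply: eq_bigr => a _; rewrite mulrDr.
move=> p /hx lp; rewrite -monoU monoE; move: (x@_p) => c.
rewrite of_pathE; move: lp; rewrite /path_length.
case/lastP: (val p).2 => [//|s a]; rewrite size_rcons => -[sn].
have [v' ->] := word_rcons k (path_source p) s a.
set y := of_path k (trivial_path v'); set z := word _ _ _.
have hyz : homogeneous n (y * z).
  by rewrite -[n]add0n; apply: homogeneousM; [exact: (@homogeneous_path (trivial_path
    v'))|rewrite -sn; apply: homogeneous_word].
exists (fun b => if b == a then q (c *: (y * z)) else q 0); split=> [b|].
  by case: eqP => _; apply: bgradingP; [apply: homogeneousZ | apply: homogeneous0].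
rewrite (bigD1 a) //= eqxx big1 ?addr0 => [|b /negbTE ->]; last by rewrite to_quot0 mulr0.
by rewrite to_quot_mul -palg_scalerAr mulrA.
Qed.

Lemma cf_trivial1 v : cf (trivial_path v) (1 : kQ) = 1.
Proof.
change (cf (trivial_path v) (palg_one k Q) = 1); rewrite /palg_one raddf_sum /=.
rewrite (bigD1 v) //= /of_path -monoU cf_mono eqxx big1 ?addr0 // => w nw.
rewrite -monoU cf_mono; case: eqP => // /(congr1 (@path_source Q)) e.
by case/eqP: nw; rewrite -[w]/(path_source (trivial_path w)) -e.
Qed.

(** The laws are those of kQ: the projections to the homogeneous components pass
    to the quotient since I is homogeneous, the coefficients in degrees zero and
    one since they vanish on I. *)
Lemma bound_quiver_ring :
  exists X : quiver_ring k (bound_grading I) (bound_idempotent I),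
    (forall a, qr_arrow X a = q (of_path k (arrow_path a))) /\
    (forall c, qr_sc X c = q (c *: (1 : kQ))).
Proof.
unshelve refine (ex_intro _ (@QuiverRing k Q A _ _ bsc
   (fun a => q (of_path k (arrow_path a))) bhpart
   (fun v => bcf (trivial_path v)) (fun a => bcf (arrow_path a))
   _ _ _ _ _ _ _ _ _ _ _ _ _ _ _ _ _ _ _ _ _ _ _ _ _ _ _ _ _ _ _)
   (conj (fun _ => erefl) (fun _ => erefl))).
- by move=> c d; rewrite /bsc scalerDl to_quotD.
- by move=> c d; rewrite {2 3}/bsc bscMl /bsc scalerA.
- by rewrite /bsc scale1r.
- by move=> c; elim/to_quot_surj => x; rewrite bscMl bscMr.
- move=> v w; rewrite /bound_idempotent to_quot_mul of_pathM path_mul1p.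
  by rewrite -[path_target _]/w; case: eqP => [->|_]; rewrite ?to_quot0.
- by rewrite /bound_idempotent -to_quot_sum.
- by move=> a; rewrite /bound_idempotent to_quot_mul of_pathM path_mul1p eqxx.
- by move=> a; rewrite /bound_idempotent to_quot_mul of_pathM path_mulp1 eqxx.
- by move=> n u w [x hx <-] [y hy <-]; rewrite to_quot_add; apply/bgradingP/homogeneousD.
- by move=> m n u w [x hx <-] [y hy <-]; rewrite to_quot_mul; apply/bgradingP/homogeneousM.
- by move=> v; apply/bgradingP; exact: (@homogeneous_path (trivial_path v)).
- by move=> c; apply/bgradingP/homogeneousZ/homogeneous1.
- by move=> a; apply/bgradingP; exact: (@homogeneous_path (arrow_path a)).
- by move=> n u; apply: bgrading_dec.
- move=> n; elim/to_quot_surj => x; elim/to_quot_surj => y.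
  by rewrite to_quot_add !bhpartq (raddfD (hpart n)) to_quotD.
- by move=> n u; apply/bgradingP/hpart_homogeneous.
- move=> m n u [x hx <-]; rewrite bhpartq (hpart_homog _ hx).
  by case: (m == n); rewrite ?to_quot0.
- move=> m n u w [x hx <-]; elim/to_quot_surj: w => y.
  by rewrite to_quot_mul !bhpartq to_quot_mul (hpart_mull _ _ hx).
- move=> m n u w [x hx <-] lt; elim/to_quot_surj: w => y.
  by rewrite to_quot_mul !bhpartq (hpart_mull0 _ hx lt) to_quot0.
- move=> m n u w [x hx <-]; elim/to_quot_surj: u => y.
  by rewrite to_quot_mul !bhpartq to_quot_mul (hpart_mulr _ _ hx).
- move=> m n u w [x hx <-] lt; elim/to_quot_surj: u => y.
  by rewrite to_quot_mul !bhpartq (hpart_mulr0 _ hx lt) to_quot0.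
- elim/to_quot_surj => x; have [N e] := sum_hpart x; exists N.
  by rewrite {1}e to_quot_sum; apply: eq_bigr => n _; rewrite bhpartq.
- move=> v; elim/to_quot_surj => x; elim/to_quot_surj => y.
  by rewrite to_quot_add !bcfq // (raddfD (cf _)).
- move=> v; elim/to_quot_surj => x; elim/to_quot_surj => y.
  by rewrite to_quot_add !bcfq // (raddfD (cf _)).
- move=> v; elim/to_quot_surj => x; elim/to_quot_surj => y.
  by rewrite to_quot_mul !bcfq // cf_trivialM.
- move=> a; elim/to_quot_surj => x; elim/to_quot_surj => y.
  by rewrite to_quot_mul !bcfq // cf_arrowM.
- move=> v w; rewrite /bound_idempotent bcfq // /of_path -monoU cf_mono.
  case: eqP => [/(congr1 (@path_source Q)) e|n]; last first.
    by case: eqP n => // ->.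
  by rewrite -[v]/(path_source (trivial_path v)) e eqxx.
- move=> v c; by rewrite /bsc bcfq // cfZ cf_trivial1 mulr1.
- move=> a b; rewrite bcfq // /of_path -monoU cf_mono.
  case: eqP => [/(congr1 val) [_ ->]|n]; first by rewrite eqxx.
  by case: eqP n => // ->.
- by elim/to_quot_surj => x; rewrite bhpartq hpart0E to_quot_sum; apply: eq_bigr => v _;
  rewrite bscMl bcfq.
- by elim/to_quot_surj => x; rewrite bhpartq hpart1E to_quot_sum; apply: eq_bigr => v _;
  rewrite bscMl bcfq.
Qed.
End BoundQuiver.

(** * The projective cover of the degree-zero part *)
Section QuiverRingTheory.
Variables (k : fieldType) (Q : quiver) (A : pzRingType).
Variables (G : nat -> set A) (E : vertex Q -> A) (X : quiver_ring k G E).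
Local Notation sc := (qr_sc X).
Local Notation part := (qr_part X).
Local Notation vcoef := (qr_vcoef X).
Local Notation acoef := (qr_acoef X).
Implicit Types (u w : A) (v : vertex Q) (a b : arrow Q) (c : k) (n m : nat).

Lemma morphD_additive (U V : zmodType) (f : U -> V) : {morph f : x y / x + y} -> additive f.
Proof.
move=> fD x y; have f0 : f 0 = 0 by apply: (@addrI _ (f 0)); rewrite -fD !addr0.
by rewrite fD; congr (_ + _); apply: (@addrI _ (f y)); rewrite -fD !subrr.
Qed.
HB.instance Definition _ := GRing.isAdditive.Build k A sc (morphD_additive (scD X)).
HB.instance Definition _ n := GRing.isAdditive.Build A A (part n) (morphD_additive (partD X n)).
HB.instance Definition _ v :=
  GRing.isAdditive.Build A k (vcoef v) (morphD_additive (vcoefD X v)).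
HB.instance Definition _ a :=
  GRing.isAdditive.Build A k (acoef a) (morphD_additive (acoefD X a)).

Lemma GscM n c u : G n u -> G n (sc c * u).
Proof. by rewrite -{2}[n]add0n; apply: (GM X); apply: (G_sc X). Qed.

Lemma vcoef_part0 v u : vcoef v (part 0 u) = vcoef v u.
Proof.
rewrite (part0E X) raddf_sum /= (bigD1 v) //= (vcoefM X) (vcoef_sc X) (vcoef_idem X) eqxx mulr1.
rewrite big1 ?addr0 // => w nw.
by rewrite (vcoefM X) (vcoef_idem X) eq_sym (negbTE nw) mulr0.
Qed.

Lemma vcoefG v n u : G n u -> (0 < n)%N -> vcoef v u = 0.
Proof. by move=> Gu n0; rewrite -vcoef_part0 (part_homog X _ Gu) eq_sym -leqn0 leqNgt n0
  raddf0. Qed.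

Lemma sc_mul_eq0 c u : u <> 0 -> sc c * u = 0 -> c = 0.
Proof.
move=> u0 e; apply/eqP; apply: contra_notT u0 => cn0.
by rewrite -[u]mul1r -(sc1 X) -(mulVf cn0) (scM X) -mulrA e mulr0.
Qed.

Lemma sc_invert c u w : c != 0 -> u = sc c * w -> w = sc c^-1 * u.
Proof. by move=> cn0 ->; rewrite mulrA -(scM X) mulVf // (sc1 X) mul1r. Qed.

Definition positive u := forall v, vcoef v u = 0.

Lemma positive_part0 u : positive u <-> part 0 u = 0.
Proof.
split=> [h|h v]; last by rewrite -vcoef_part0 h raddf0.
by rewrite (part0E X) big1 // => v _; rewrite h raddf0 mul0r.
Qed.

Lemma positiveD u w : positive u -> positive w -> positive (u + w).
Proof. by move=> hu hw v; rewrite raddfD /= hu hw addr0. Qed.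
Lemma positiveMl u w : positive w -> positive (u * w).
Proof. by move=> hw v; rewrite (vcoefM X) hw mulr0. Qed.
Lemma positiveG n u : G n u -> (0 < n)%N -> positive u.
Proof. by move=> hu n0 v; apply: vcoefG hu n0. Qed.
Lemma positive0 : positive 0.
Proof. by move=> v; rewrite raddf0. Qed.

Lemma part_eq0 u : (forall n, part n u = 0) -> u = 0.
Proof. by move=> h; have [N ->] := sum_part X u; rewrite big1. Qed.

Lemma part_ge n m u w : (forall i, (i < m)%N -> part i u = 0) -> positive w -> (n <= m)%N ->
  part n (u * w) = 0.
Proof.
move=> hu /positive_part0 hw le.
have [N ->] := sum_part X u; rewrite mulr_suml raddf_sum /= big1 // => i _.
have [lt|ge] := ltnP i m; first by rewrite hu // mul0r raddf0.
have Gi := partG X i u.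
have [lt|le'] := ltnP n i; first by rewrite (part_mull0 X _ Gi lt).
have -> : n = (i + 0)%N by rewrite addn0; apply/eqP; rewrite eqn_leq le' (leq_trans le ge).
by rewrite (part_mull X _ _ Gi) hw mulr0.
Qed.

(** A positive idempotent lies in all powers of the augmentation ideal, whose
    intersection is zero by the grading. *)
Lemma positive_idem u : positive u -> u * u = u -> u = 0.
Proof.
move=> pu uu; suff h n : forall i, (i < n)%N -> part i u = 0.
  by apply: part_eq0 => n; apply: (h n.+1).
elim: n => [//|n IHn] i; rewrite ltnS => le.
by rewrite -uu; apply: part_ge IHn pu le.
Qed.

Lemma positive_partP u : submod_set (positive_part G) u <-> positive u.
Proof.
split=> [hu|pu U hU].
  have S : is_submod [set u : A^o | positive u].
    split=> [|b x y px py]; first exact: positive0.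
    by apply: positiveD => //; apply: positiveMl.
  apply: (hu (Submod S)) => x [i [i0 Gx]] /=; exact: positiveG Gx i0.
have [U0 Ulin] := submodP U.
have US x y : submod_set U x -> submod_set U y -> submod_set U (x + y) by
  rewrite -{2}[x]scale1r; apply: Ulin.
have [N ->] := sum_part X u; apply: (big_ind (submod_set U)) => // i _.
case: (val i) => [|n]; first by move/positive_part0: pu => ->.
by apply: hU; exists n.+1; split=> //; apply: (partG X).
Qed.

Lemma idem_id v : E v * E v = E v.
Proof. by rewrite (idemM X) eqxx. Qed.

Lemma part0_idem v u : part 0 u * E v = sc (vcoef v u) * E v.
Proof.
rewrite (part0E X) mulr_suml (bigD1 v) //= big1 ?addr0 -?mulrA ?idem_id // => w nw.
by rewrite -mulrA (idemM X) (negbTE nw) mulr0.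
Qed.

Lemma idem_suml u : u = \sum_v E v * u.
Proof. by rewrite -mulr_suml (sum_idem X) mul1r. Qed.
Lemma idem_sumr u : u = \sum_v u * E v.
Proof. by rewrite -mulr_sumr (sum_idem X) mulr1. Qed.

Lemma sum_part_widen u N N' : (N <= N')%N ->
  u = \sum_(i < N) part i u -> u = \sum_(i < N') part i u.
Proof.
move=> le eu; have z i : (N <= i)%N -> part i u = 0.
  move=> le'; rewrite eu raddf_sum /= big1 // => j _.
  rewrite (part_homog X i (partG X j u)); case: eqP => // ei.
  by have := leq_trans (ltn_ord j) le'; rewrite ei ltnn.
rewrite {1}eu (big_ord_widen _ (fun i => part i u) le) big_mkcond /=.
by apply: eq_bigr => i _; case: ltnP => // /z ->.
Qed.

Lemma sum_part_ge u n : exists2 N, (n <= N)%N & u = \sum_(i < N) part i u.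
Proof.
have [N eu] := sum_part X u; exists (maxn n N); first exact: leq_maxl.
exact: sum_part_widen (leq_maxr n N) eu.
Qed.

Section Cover.
Variables (P0 : lmodType A) (eps : {linear P0 -> degree_zero G}).
Hypothesis P0proj : projective P0.
Hypothesis eps_surj : forall y, exists x, eps x = y.
Hypothesis eps_min : superfluous [set x | eps x = 0].

Lemma scale_linear (P : lmodType A) (x : P) : linear (fun u : A^o => (u : A) *: x).
Proof. by move=> c u w; rewrite scalerDl scalerA. Qed.

Lemma to_quotmod_scale (M : lmodType A) (U : submod M) u (x : M) :
  to_quotmod U (u *: x) = u *: to_quotmod U x.
Proof. exact: to_quotmodZ. Qed.

Lemma to_quotmod0 (M : lmodType A) (U : submod M) : to_quotmod U 0 = 0.
Proof. by rewrite -(scale0r (0 : M)) to_quotmod_scale scale0r. Qed.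

Lemma is_submodZ (M : lmodType A) (W : submod M) u x : submod_set W x -> submod_set W (u *: x).
Proof. by have [W0 h] := submodP W => Wx; rewrite -[_ *: _]addr0; apply: h. Qed.

(** Let x0 lift the class of 1.  Its multiples and the kernel of the cover span
    [P0], so [u] mapped to [u *: x0] is onto by minimality and splits by
    projectivity; the kernel of the splitting is generated by a positive
    idempotent, which is zero. *)
Lemma cover_free : exists (x0 : P0) (sg : {linear P0 -> A^o}),
  [/\ eps x0 = to_quotmod (positive_part G) (1 : A^o), forall x, (sg x : A) *: x0 =
    x & sg x0 = 1].
Proof.
have [x0 e0] := eps_surj (to_quotmod (positive_part G) (1 : A^o)); exists x0.
pose h0 (u : A^o) : P0 := (u : A) *: x0.
pose h : {linear A^o -> P0} := HB.pack h0 (GRing.isLinear.Build _ _ _ _ h0 (@scale_linear P0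
  x0)).
have epsh u : eps (h u) = to_quotmod (positive_part G) u.
  by rewrite [LHS]linearZ /= e0 -to_quotmod_scale; congr to_quotmod; apply: mulr1.
have hW : is_submod [set x | exists u, h u = x].
  split=> [|c x y [u <-] [w <-]]; first by exists 0; apply: linear0.
  by exists (c *: (u : A^o) + (w : A^o)); rewrite linearP.
have hs y : exists u, h u = y.
  suff hWT : Submod hW = setT :> set P0.
    by have : submod_set (Submod hW) y by rewrite hWT.
  apply: eps_min => x; have [u eu] : exists u, to_quotmod (positive_part G) u = eps x.
    by exists (repr (eps x)); rewrite /to_quotmod reprK.
  exists (x - h u), (h u); split; [|by exists u|by rewrite subrK].
  by rewrite /= raddfB /= epsh eu subrr.
have [sg hsg] := @P0proj (A^o : lmodType A) P0 h (idfun : {linear P0 -> P0}) hs.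
exists sg; split=> [//|x|]; first exact: hsg.
pose d : A := 1 - sg x0.
have hd : h d = 0 by rewrite -[h d]/(d *: x0) scalerBl scale1r -[X in _ - X]/(h (sg x0)) hsg
  subrr.
have pd : positive d.
  apply/positive_partP; rewrite -[d]subr0; apply/to_quotmodP.
  by rewrite -!epsh hd !linear0.
have dd : d * d = d.
  rewrite {2}/d mulrBr mulr1 -[d * sg x0]/(d *: (sg x0 : A^o)) -linearZ /=.
  by rewrite -[d *: x0]/(h d) hd linear0 subr0.
by apply/eqP; rewrite eq_sym -subr_eq0; apply/eqP/(positive_idem pd dd).
Qed.

(** If a maximal left ideal L does not contain [u], then L and the positive
    elements span A.  Therefore L x0 and the kernel of the cover span [P0], and
    minimality gives L x0 = [P0], so 1 is in L. *)
Lemma positive_jacobson u : positive u -> jacobson u.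
Proof.
have [x0 [sg [e0 sgK sg0]]] := cover_free.
move=> pu L [Lneq Lmax].
have [L0 Llin] := submodP L.
have W_sub : is_submod [set w : A^o | exists l p, [/\ submod_set L l, positive p & w = l + p]].
  split=> [|c x y [l [p [hl hp ->]]] [l' [p' [hl' hp' ->]]]].
    by exists 0, 0; split=> //; [apply: positive0 | rewrite addr0].
  exists (c *: (l : A^o) + (l' : A^o)), (c *: (p : A^o) + (p' : A^o)); split; first exact: Llin.
    by apply: positiveD => //; apply: positiveMl.
  by rewrite scalerDr addrACA.
have Wu : submod_set (Submod W_sub) u by exists 0, u; split=> //; rewrite add0r.
have LW : L `<=` Submod W_sub.
  by move=> l Ll; exists l, 0; split=> //; [apply: positive0 | rewrite addr0].
have [WT|Wn] := pselect (Submod W_sub = setT :> set A^o); last by rewrite -(Lmax _ LW Wn).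
exfalso; apply: Lneq.
have hW : is_submod [set x : P0 | exists l, submod_set L l /\ x = (l : A) *: x0].
  split=> [|c x y [l [Ll ->]] [l' [Ll' ->]]]; first by exists 0; rewrite scale0r.
  exists (c *: (l : A^o) + (l' : A^o)); split; first exact: Llin.
  by rewrite scalerDl -scalerA.
have hT : Submod hW = setT :> set P0.
  apply: eps_min => x.
  have : submod_set (Submod W_sub) (sg x : A^o) by rewrite WT.
  move=> [l [p [Ll pp e]]]; exists (p *: x0), ((l : A) *: x0); split; [|by exists l|].
    rewrite /= linearZ /= e0 -to_quotmod_scale.
    apply: etrans (to_quotmod0 (positive_part G)).
    apply/to_quotmodP; rewrite subr0; apply/positive_partP.
    by rewrite -[p *: _]/(p * 1) mulr1.
  by rewrite -scalerDl addrC -e sgK.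
have [l [Ll el]] : submod_set (Submod hW) x0 by rewrite hT.
have l1 : l = 1 by rewrite -sg0 [in RHS]el linearZ /= sg0 -[RHS]/(l * 1) mulr1.
apply/seteqP; split=> // w _.
by rewrite -[w]mulr1 -l1; apply: is_submodZ.
Qed.

End Cover.
End QuiverRingTheory.

(** * Vertex modules and Loewy length *)
Lemma ann_submod (A : pzRingType) (s : A) : is_submod [set u : A^o | (u : A) * s = 0].
Proof.
split=> [|c u w /= hu hw]; first exact: mul0r.
by rewrite mulrDl hw addr0 -[c *: u]/(c * u) -mulrA hu mulr0.
Qed.

Section Loewy.
Variables (k : fieldType) (Q : quiver) (A : pzRingType).
Variables (G : nat -> set A) (E : vertex Q -> A) (X : quiver_ring k G E).
Local Notation vcoef := (qr_vcoef X).
Implicit Types (v : vertex Q).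

Section ProjectiveAtVertex.
Variable v : vertex Q.

(** The left ideal A e_v, presented as A modulo the annihilator of e_v. *)
Definition vertex_module : lmodType A := quot_mod (Submod (ann_submod (E v))).
Local Notation P := vertex_module.
Local Notation tq := (to_quotmod (Submod (ann_submod (E v)))).

Lemma tq_eq u w : tq u = tq w <-> u * E v = w * E v.
Proof.
split=> [/to_quotmodP|] /=; first by rewrite mulrBl => /eqP; rewrite subr_eq0 => /eqP.
by move=> e; apply/to_quotmodP; rewrite /= mulrBl e subrr.
Qed.

Lemma tqM (u w : A) : tq (u * w) = u *: (tq w : P).
Proof. exact: to_quotmod_scale. Qed.

Lemma tq_surj (z : P) : exists u : A, z = tq (u * E v).
Proof.
elim/to_quotmod_surj: z => x; exists x; apply/tq_eq.
by rewrite -mulrA (idem_id X).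
Qed.

Lemma vertex_module_projective : projective P.
Proof.
move=> M N g f gsurj; have [m em] := gsurj (f (tq (E v))).
pose h0 (z : P) : M := ((repr z : A) * E v) *: m.
have h0E (u : A) : h0 (tq u) = (u * E v) *: m.
  by congr (_ *: _); apply/tq_eq; rewrite /to_quotmod reprK.
have hlin : linear h0.
  move=> c; elim/to_quotmod_surj => x; elim/to_quotmod_surj => y.
  rewrite -[c *: _]to_quotmod_scale -[_ + _]to_quotmodD !h0E mulrDl scalerDl.
  by rewrite -[(c *: x : A^o)]/(c * x) -mulrA scalerA.
pose h : {linear P -> M} := HB.pack h0 (GRing.isLinear.Build _ _ _ _ h0 hlin).
exists h.
elim/to_quotmod_surj => x /=; rewrite h0E linearZ /= em -linearZ /= -tqM.
by congr (f _); apply/tq_eq; rewrite -!mulrA !(idem_id X).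
Qed.

(** The corner ring e_v A e_v is local: the coefficient at [v] of an idempotent is
    0 or 1, and then the idempotent or its complement is positive. *)
Lemma vertex_idem u : u = E v * u * E v -> u * u = u -> u = 0 \/ E v - u = 0.
Proof.
move=> eu uu.
have : vcoef v u * (vcoef v u - 1) = 0.
  by rewrite mulrBr mulr1 -(vcoefM X) uu subrr.
have pos w : w = E v * w * E v -> vcoef v w = 0 -> positive X w.
  move=> ew cw j; rewrite ew !(vcoefM X) !(vcoef_idem X).
  by case: eqP => [->|_]; rewrite ?mul0r // cw mulr0 mul0r.
move=> /eqP; rewrite mulf_eq0 => /orP[/eqP c|/eqP c]; [left|right].
  exact: positive_idem (pos _ eu c) uu.
have eE : E v * u = u by rewrite eu !mulrA (idem_id X).
have uE : u * E v = u by rewrite eu -[LHS]mulrA (idem_id X).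
apply: (positive_idem (X := X)).
  apply: pos; first by rewrite mulrBr eE mulrBl uE !(idem_id X).
  by rewrite raddfB /= (vcoef_idem X) eqxx -opprB c oppr0.
by rewrite mulrBl !mulrBr (idem_id X) eE uE uu subrr subr0.
Qed.

(** The two components of e_v in a direct decomposition are complementary
    idempotents of the corner ring e_v A e_v. *)
Lemma vertex_module_indecomposable : indecomposable P.
Proof.
split.
  exists (tq (E v)) => /(@etrans _ _ _ _)/(_ (esym (to_quotmod0 _)))/tq_eq.
  rewrite mul0r (idem_id X) => /(congr1 (vcoef v)); rewrite (vcoef_idem X) eqxx raddf0.
  by apply/eqP; rewrite oner_eq0.
move=> U W UW0 UWT.
have [u' [w' [Uu Ww e]]] := UWT (tq (E v)).
have [u0 eu0] := tq_surj u'; have [w0 ew0] := tq_surj w'.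
set u := u0 * E v in eu0; set w := w0 * E v in ew0.
have uE : u * E v = u by rewrite /u -mulrA (idem_id X).
have wE : w * E v = w by rewrite /w -mulrA (idem_id X).
have uw : u + w = E v.
  move: e; rewrite eu0 ew0 -[_ + _]to_quotmodD => /tq_eq.
  by rewrite (idem_id X) mulrDl uE wE => <-.
have tqE (a : A) : a *: (tq (E v) : P) = tq a.
  by rewrite -tqM; apply/tq_eq; rewrite -mulrA (idem_id X).
have cross (V V' : submod P) (a b : A) : V `&` V' = [set 0] -> a * E v = a -> b * E v = b ->
    a + b = E v -> submod_set V (tq a) -> submod_set V' (tq b) -> a * b = 0 /\ a * a = a.
  move=> V0 aE bE ab Va Vb.
  have ab0 : a * b = 0.
    have : (V `&` V') (a *: (tq b : P)).
      split; last exact: is_submodZ.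
      have -> : a *: (tq b : P) = tq a - a *: (tq a : P).
        have eab : a = a * a + a * b by rewrite -mulrDr ab aE.
        rewrite -!tqM; apply: (addrI (tq (a * a))).
        rewrite [RHS]addrC subrK [in RHS]eab; exact: esym (to_quotmodD _ _ _).
      have [_ h] := submodP V; rewrite addrC -scaleNr; exact: h.
    by rewrite V0 -tqM => /= /(@etrans _ _ _ _)/(_ (esym (to_quotmod0 _)))/tq_eq;
      rewrite -mulrA bE mul0r.
  by split=> //; rewrite -[RHS]aE -ab mulrDr ab0 addr0.
have [uw0 uu] : u * w = 0 /\ u * u = u.
  by apply: (cross U W) => //; rewrite -?eu0 -?ew0.
have [wu0 ww] : w * u = 0 /\ w * w = w.
  by apply: (cross W U) => //; rewrite -?eu0 -?ew0 // 1?addrC // setIC.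
have triv (V V' : submod P) : V `&` V' = [set 0] -> submod_set V' (tq (E v)) -> V =
  [set 0] :> set P.
  move=> V0 V'E; rewrite -V0; apply/seteqP; split=> [z Vz|z []//]; split=> //.
  by have [a ->] := tq_surj z; rewrite tqM; apply: is_submodZ.
have Eu : E v * u * E v = u by rewrite -uw mulrDl uu wu0 addr0 uw uE.
have [u0'|Eu0] := vertex_idem (esym Eu) uu; [left|right].
  apply: (triv U W) => //; have -> : tq (E v) = w'; last by [].
  by rewrite ew0; apply/tq_eq; rewrite (idem_id X) wE -uw u0' add0r.
apply: (triv W U); rewrite 1?setIC //; have -> : tq (E v) = u'; last by [].
by rewrite eu0; apply/tq_eq; rewrite (idem_id X) uE; apply/eqP; rewrite -subr_eq0 Eu0.
Qed.

End ProjectiveAtVertex.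

Hypothesis loewy : forall P : lmodType A, projective P -> indecomposable P -> loewy_length P 4.
Hypothesis rad : forall u, positive X u -> jacobson u.

Lemma rad_powerS (P : lmodType A) n (a : A) (x : P) :
  jacobson a -> rad_power n x -> rad_power n.+1 (a *: x).
Proof. by move=> ja rx U SU; apply: SU; exists a, x. Qed.

(** Arrows act through the radical, and the fourth radical power of each A e_v
    is zero. *)
Lemma G1_mul4 (a b c d : A) : G 1%N a -> G 1%N b -> G 1%N c -> G 1%N d -> a * (b * (c * d)) = 0.
Proof.
move=> ha hb hc hd.
have J u : G 1%N u -> jacobson u by move=> /(positiveG X)/(_ isT)/rad.
rewrite [LHS](idem_sumr X) big1 // => v _.
have [r4 _] := loewy (@vertex_module_projective v) (@vertex_module_indecomposable v).
pose t := to_quotmod (Submod (ann_submod (E v))) (GRing.one A).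
have : @rad_power _ (vertex_module v) 4 (a *: (b *: (c *: (d *: t)))).
  by do 4 (apply: rad_powerS; first exact: J).
have -> : a *: (b *: (c *: (d *: t))) = to_quotmod (Submod (ann_submod (E v)))
    (a * (b * (c * d))).
  by rewrite -[d in RHS]mulr1 !tqM.
rewrite r4 => /(@etrans _ _ _ _)/(_ (esym (to_quotmod0 _)))/tq_eq ->.
exact: mul0r.
Qed.

Lemma G4_zero u w : G 1%N u -> G 3%N w -> u * w = 0.
Proof.
move=> hu /(G_decomp X)[F [hF ->]]; rewrite mulr_sumr big1 // => a _.
have [F' [hF' ->]] := G_decomp X (hF a); rewrite !mulr_sumr big1 // => b _.
by apply: G1_mul4 => //; apply: (G_arrow X).
Qed.

End Loewy.

(** * The socle and nondegeneracy *)
Section Socle.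
Variables (k : fieldType) (Q : quiver) (A : pzRingType).
Variables (G : nat -> set A) (E : vertex Q -> A) (X : quiver_ring k G E).
Local Notation sc := (qr_sc X).
Local Notation Y := (qr_arrow X).
Local Notation vcoef := (qr_vcoef X).
Implicit Types (v : vertex Q).
Hypothesis G4 : forall u w, G 1%N u -> G 3%N w -> u * w = 0.
Hypothesis selfinj : self_injective A.
Hypothesis triv : trivial_translation G 2 E.

(** The element of A_3 e_v that corresponds to e_v under the isomorphism with
    A_0 e_v generates the line. *)
Lemma socle v : exists s, [/\ G 3%N s, E v * s = s, s * E v = s, s <> 0
  & forall u, G 3%N u -> exists c, u * E v = sc c * s].
Proof.
have [f [[fT finj fsurj] fD fM]] := triv v.
have Ecol : column G 0 (E v) (E v) by exists (E v); rewrite ?(idem_id X) //; apply: (G_idem X).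
have [s cs fs] := fsurj _ Ecol; have [s' Gs' es] := cs.
have Gs : G 3%N s by rewrite -es; have := GM X Gs' (G_idem X v).
have sE : s * E v = s by rewrite -es -mulrA (idem_id X).
have colZ u : column G 3 (E v) u -> column G 3 (E v) (E v * u).
  by case=> w Gw <-; exists (E v * w); rewrite ?mulrA //; exact: (GM X (G_idem X v) Gw).
have colsc c u : column G 3 (E v) u -> column G 3 (E v) (sc c * u).
  by case=> w Gw <-; exists (sc c * w); rewrite ?mulrA //; exact: (GscM X).
exists s; split=> //.
- apply: finj; rewrite ?inE //; first exact: colZ.
  by rewrite (fM _ _ (G_idem X v) cs) fs (idem_id X).
- move=> s0; have := fD s s cs cs; rewrite s0 addr0 -s0 fs.
  rewrite -[E v in LHS]addr0 => /addrI /(congr1 (vcoef v)).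
  by rewrite (vcoef_idem X) eqxx raddf0 => /eqP; rewrite eq_sym oner_eq0.
move=> u Gu; have cu : column G 3 (E v) (u * E v) by exists u.
have := fT _ cu; case=> w Gw ew.
exists (vcoef v w); apply: finj; rewrite ?inE //; first exact: colsc.
rewrite (fM _ _ (G_sc X _) cs) fs -ew -(part0_idem X).
by rewrite (part_homog X 0 Gw).
Qed.

(** A path of positive length acts through its first arrow, which kills [u], so
    only the coefficient at [v] is felt. *)
Lemma annihilated v u : (forall a, Y a * u = 0) -> E v * u = u ->
  forall w, w * u = sc (vcoef v w) * u.
Proof.
move=> Yu Eu.
have h0 w : G 0%N w -> w * u = sc (vcoef v w) * u.
  by move=> Gw; rewrite -Eu !mulrA -(part0_idem X) (part_homog X 0 Gw) eqxx.
have hn n w : G n.+1 w -> w * u = 0.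
  elim: n w => [|n IHn] w /(G_decomp X)[F [hF ->]]; rewrite mulr_suml big1 // => a _;
    rewrite -mulrA.
    by rewrite (h0 _ (hF a)) mulrA -(scC X) -mulrA Yu mulr0.
  by rewrite IHn ?mulr0.
move=> w; have [[|N] lt ->] := sum_part_ge X w 1; first by [].
rewrite big_ord_recl mulrDl mulr_suml big1 ?addr0; last first.
  by move=> i _; apply: (hn i); apply: (partG X).
rewrite raddfD /= raddf_sum /= [X in _ + X]big1 ?addr0.
  by rewrite (h0 _ (partG X 0 w)).
by move=> i _; apply: (vcoefG X v (partG X _ _)).
Qed.

Section AnnihilatorQuotient.
Variable s : A.
Local Notation M := (quot_mod (Submod (ann_submod s)) : lmodType A).

(** The quotient of A by the left annihilator of s is the left ideal A s, so this
    is the extension of s |-> u to a linear map from A s. *)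
Lemma ann_quot_map (u : A) : (forall w, w * s = 0 -> w * u = 0) ->
  exists f : {linear M -> A^o}, forall w : A, f (to_quotmod (Submod (ann_submod s)) w) = w * u.
Proof.
move=> su; pose f0 (z : M) : A^o := (repr z : A) * u.
have f0E (w : A) : f0 (to_quotmod (Submod (ann_submod s)) w) = w * u.
  apply/eqP; rewrite -subr_eq0 -mulrBl; apply/eqP/su.
  have : to_quotmod (Submod (ann_submod s)) (repr (to_quotmod (Submod (ann_submod s)) w)) =
    to_quotmod (Submod (ann_submod s)) w.
    by rewrite /to_quotmod reprK.
  by move/to_quotmodP.
have flin : linear f0.
  move=> c; elim/to_quotmod_surj => x; elim/to_quotmod_surj => y.
  by rewrite -[c *: _]to_quotmod_scale -[_ + _]to_quotmodD !f0E mulrDl -mulrA.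
pose f : {linear M -> A^o} := HB.pack f0 (GRing.isLinear.Build _ _ _ _ f0 flin).
by exists f.
Qed.
End AnnihilatorQuotient.

(** Both [u] and a socle generator s at the same vertex are killed by the arrows,
    so s |-> u defines a linear map from A s to A.  Self-injectivity extends it
    to A, that is to a right multiplication: u is in s A, which starts in degree
    three. *)
Lemma left_nondegenerate t u : (t < 3)%N -> G t u -> (forall a, Y a * u = 0) -> u = 0.
Proof.
move=> t3 Gu Yu; rewrite (idem_suml X u) big1 // => v _.
have Yu' a : Y a * (E v * u) = 0.
  rewrite mulrA -(arrow_source X) -(mulrA (Y a)) (idemM X); case: eqP => _; last by
    rewrite mulr0 mul0r.
  by rewrite (arrow_source X) Yu.
have Eu' : E v * (E v * u) = E v * u by rewrite mulrA (idem_id X).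
have Gu' : G t (E v * u) by exact: (GM X (G_idem X v) Gu).
move: (E v * u) Yu' Eu' Gu' => {Yu}{}u Yu Eu {}Gu.
have [s [Gs Es sE s0 _]] := socle v.
have Ys a : Y a * s = 0 by apply: G4 => //; apply: (G_arrow X).
have hsu w : w * s = 0 -> w * u = 0.
  by rewrite (annihilated Ys Es) (annihilated Yu Eu) => /(sc_mul_eq0 s0) ->;
    rewrite raddf0 mul0r.
have [g gE] := ann_quot_map (fun w h => h : w * s = 0).
have [f fE] := ann_quot_map hsu.
have ginj : injective g.
  elim/to_quotmod_surj => x; elim/to_quotmod_surj => y.
  rewrite !gE => e; apply/to_quotmodP => /=.
  by rewrite mulrBl e subrr.
have [h hE] := selfinj f ginj.
have e : u = s * h 1.
  have -> : s * h 1 = h s.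
    by rewrite -[s * h 1]/(s *: (h 1 : A^o)) -linearZ; congr (h _); apply: mulr1.
  by rewrite -[s]mul1r -gE hE fE mul1r.
have := part_homog X t Gu; rewrite eqxx => <-.
by rewrite e (part_mull0 X _ Gs t3).
Qed.

End Socle.

(** * Functionals on a minimal resolution *)
Section Koszul.
Variables (k : fieldType) (Q : quiver) (A : pzRingType).
Variables (G : nat -> set A) (E : vertex Q -> A) (X : quiver_ring k G E).
Local Notation sc := (qr_sc X).
Local Notation Y := (qr_arrow X).
Local Notation part := (qr_part X).
Local Notation vcoef := (qr_vcoef X).
Local Notation acoef := (qr_acoef X).
Implicit Types (v : vertex Q) (a b : arrow Q) (w : seq (arrow Q)).
Variable res : minimal_graded_projective_resolution G (@degree_zero_grading A G).
Local Notation P := (res_mod res).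
Local Notation d t := (res_diff res t).
Local Notation eps := (res_aug res).
Local Notation H t := (@res_deg _ _ _ _ res t).
Local Notation tq := (to_quotmod (positive_part G)).

Lemma tq_eqP (u u' : A) : tq u = tq u' <-> forall v, vcoef v u = vcoef v u'.
Proof.
split=> [/to_quotmodP/(positive_partP X) h v | h].
  by apply/eqP; rewrite -subr_eq0 -raddfB; apply/eqP/h.
apply/to_quotmodP/(positive_partP X) => v.
by rewrite raddfB /= h subrr.
Qed.

(** A map to A which is linear modulo positive elements is a linear map to A_0;
    projectivity lifts it to A. *)
Lemma lift_functional (P' : lmodType A) (F : P' -> A) : projective P' ->
  (forall v (u : A) x y, vcoef v (F (u *: x + y)) = vcoef v (u * F x + F y)) ->
  exists L : {linear P' -> A^o}, forall x v, vcoef v (L x) = vcoef v (F x).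
Proof.
move=> proj Flin.
pose f0 (x : P') : degree_zero G := tq (F x).
have flin : linear f0.
  move=> u x y; rewrite /f0 -(to_quotmod_scale _ u (F x : A^o)) -to_quotmodD; apply/tq_eqP => v.
  exact: Flin.
pose f : {linear P' -> degree_zero G} := HB.pack f0 (GRing.isLinear.Build _ _ _ _ f0 flin).
pose g0 : A^o -> degree_zero G := tq.
have glin : linear g0 by move=> u x y; rewrite /g0 to_quotmodD to_quotmod_scale.
pose g : {linear A^o -> degree_zero G} := HB.pack g0 (GRing.isLinear.Build _ _ _ _ g0 glin).
have gsurj z : exists x, g x = z.
  by exists (repr z); rewrite /= /g0 /to_quotmod reprK.
have [L hL] := @proj (A^o : lmodType A) (degree_zero G) g f gsurj.
by exists L => x; apply/tq_eqP; apply: hL.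
Qed.

Lemma diff_in_kernel t (x : P t.+1) : syzygy (res_diff res) eps (d t x).
Proof. by rewrite -(res_exact res t); exists x. Qed.

(** Otherwise the kernel of this coefficient and the syzygy would span the module
    P^t, against minimality. *)
Lemma vcoef_diff t (L : {linear P t -> A^o}) v (x : P t.+1) : vcoef v (L (d t x)) = 0.
Proof.
apply: contrapT => /eqP cn.
have Wsub : is_submod [set y : P t | vcoef v (L y) = 0].
  split=> [|u y z /= hy hz]; first by rewrite /= linear0 raddf0.
  by rewrite /= linearP (vcoefD X) hz addr0 -[u *: _]/(u * L y) (vcoefM X) hy mulr0.
have WT : Submod Wsub = setT :> set (P t).
  apply: (@res_minimal _ _ _ _ res t (Submod Wsub)) => y.
  pose c := sc (vcoef v (L y) / vcoef v (L (d t x))).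
  exists (c *: d t x), (y - c *: d t x); split; last by rewrite addrC subrK.
    by rewrite -linearZ; apply: diff_in_kernel.
  rewrite /= linearB linearZ (raddfB (vcoef v)) /= -[c *: _]/(c * L (d t x)) (vcoefM X)
    (vcoef_sc X).
  by rewrite divfK // subrr.
have : submod_set (Submod Wsub) (d t x) by rewrite WT.
by move=> /= e; rewrite e eqxx in cn.
Qed.

Lemma base_functional v : exists L : {linear P 0%N -> A^o}, forall x u,
  vcoef u (L x) = if u == v then vcoef v (repr (eps x)) else 0.
Proof.
have [|L hL] := lift_functional (F := fun x => (repr (eps x) : A) * E v) (@res_projective _ _
  _ _ res 0).
  move=> b u x y; rewrite mulrA -mulrDl !(vcoefM X); congr (_ * _); move: b.
  apply/tq_eqP; rewrite to_quotmodD to_quotmod_scale.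
  by rewrite /to_quotmod !reprK linearP.
exists L => x u; rewrite hL (vcoefM X) (vcoef_idem X).
by case: eqP => [->|_]; rewrite ?mulr1 ?mulr0.
Qed.

(** As [L (d t x)] is positive, its coefficient at the arrow [a] is linear in x
    modulo positive elements. *)
Lemma next_functional t (L : {linear P t -> A^o}) a :
  exists L' : {linear P t.+1 -> A^o}, forall x v,
  vcoef v (L' x) = if v == target a then acoef a (L (d t x)) else 0.
Proof.
have [|L' hL] := lift_functional (F := fun x => sc (acoef a (L (d t x))) * E (target a))
  (@res_projective _ _ _ _ res t.+1).
  move=> v u x y; rewrite mulrA -mulrDl !(vcoefM X) (vcoef_idem X).
  case: eqP => [->|_]; last by rewrite !mulr0.
  rewrite !mulr1 (vcoefD X) (vcoefM X) !(vcoef_sc X) !linearP (acoefD X).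
  by rewrite -[u *: _]/(u * L (d t x)) (acoefM X) vcoef_diff mulr0 addr0.
exists L' => x v; rewrite hL (vcoefM X) (vcoef_idem X) (vcoef_sc X).
by case: eqP; rewrite ?mulr1 ?mulr0.
Qed.

(** Words are read from right to left: the head is the last arrow.  On P^t the
    functional of a word of length [t] from [v] has, in degree zero, the
    coefficient along this word and, after the differential, the coefficients
    along its prolongations by one arrow in degree one. *)
Fixpoint functional v t w : {linear P t -> A^o} :=
  match t return {linear P t -> A^o} with
  | 0%N => projT1 (cid (base_functional v))
  | t'.+1 => if w is a :: w' then projT1 (cid (next_functional (functional v t' w') a))
             else \0
  end.

Definition word_end v w := if w is a :: _ then target a else v.

Definition fcoef v t w (x : P t) : k := vcoef (word_end v w) (functional v t w x).

Lemma vcoef_functional v t w (x : P t) u : size w = t ->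
  vcoef u (functional v t w x) = if u == word_end v w then fcoef v w x else 0.
Proof.
rewrite /fcoef; case: t w x => [|t] [|a w] x //= _.
  by case: (cid _) => L /= hL; rewrite !hL eqxx; case: eqP.
by case: (cid _) => L /= hL; rewrite !hL eqxx; case: eqP.
Qed.

Lemma fcoefS v t a w (x : P t.+1) :
  fcoef v (a :: w) x = acoef a (functional v t w (d t x)).
Proof. by rewrite /fcoef /=; case: (cid _) => L /= hL; rewrite hL eqxx. Qed.

Lemma fcoef0 v (x : P 0%N) : fcoef v [::] x = vcoef v (repr (eps x)).
Proof. by rewrite /fcoef /=; case: (cid _) => L /= hL; rewrite hL eqxx. Qed.

Lemma part0_functional v t w (x : P t) : size w = t ->
  part 0 (functional v t w x) = sc (fcoef v w x) * E (word_end v w).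
Proof.
move=> sw; rewrite (part0E X) (bigD1 (word_end v w)) //= vcoef_functional // eqxx.
rewrite big1 ?addr0 // => u nu.
by rewrite vcoef_functional // (negbTE nu) raddf0 mul0r.
Qed.

Lemma part1_functional v t w (x : P t.+1) :
  part 1 (functional v t w (d t x)) = \sum_a sc (fcoef v (a :: w) x) * Y a.
Proof. by rewrite (part1E X); apply: eq_bigr => a _; rewrite fcoefS. Qed.

(** Coefficients [u i] of degree one meet only the degree-zero values of the
    functional of [w]. *)
Lemma fcoef_dec v t a w (x : P t.+1) (K : Type) (l : seq K) (u : K -> A) (g : K -> P t) :
  size w = t -> (forall i, G 1%N (u i)) ->
  d t x = \sum_(i <- l) u i *: g i ->
  fcoef v (a :: w) x = if source a == word_end v w then \sum_(i <- l) acoef a (u i) * fcoef v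
    w (g i) else 0.
Proof.
move=> sw Gu e; rewrite fcoefS e raddf_sum /= raddf_sum /=.
have h i : acoef a (functional v t w (u i *: g i)) =
           acoef a (u i) * (if source a == word_end v w then fcoef v w (g i) else 0).
  rewrite linearZ /= -[_ *: _]/(u i * functional v t w (g i)) (acoefM X).
  by rewrite (vcoefG X _ (Gu i)) // mul0r add0r vcoef_functional.
rewrite (eq_bigr _ (fun i _ => h i)); case: eqP => // _.
by rewrite big1 // => i _; rewrite mulr0.
Qed.

Section Grading.
Variable t : nat.
Local Notation Ht := (H t).

Lemma res_deg0 n : Ht n 0.
Proof. by have [[h _ _] _] := @res_graded _ _ _ _ res t; have [] := h n. Qed.
Lemma res_degB n x y : Ht n x -> Ht n y -> Ht n (x - y).
Proof. by have [[h _ _] _] := @res_graded _ _ _ _ res t; have [_] := h n; apply. Qed.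
Lemma res_degD n x y : Ht n x -> Ht n y -> Ht n (x + y).
Proof.
move=> hx hy; rewrite -[y]opprK; apply: res_degB => //.
by rewrite -[- y]sub0r; apply: res_degB => //; apply: res_deg0.
Qed.
Lemma res_deg_sum n (K : Type) (l : seq K) (p : pred K) (F : K -> P t) :
  (forall j, p j -> Ht n (F j)) -> Ht n (\sum_(j <- l | p j) F j).
Proof. by apply: (big_ind (Ht n)) => [|x y]; [apply: res_deg0 | apply: res_degD]. Qed.
Lemma res_degZ i n u x : G i u -> Ht n x -> Ht (n + i%:Z) (u *: x).
Proof. by have [_ h] := @res_graded _ _ _ _ res t; apply: h. Qed.
Lemma res_deg_direct (ns : seq int) (c : int -> P t) :
  uniq ns -> (forall n, Ht n (c n)) -> \sum_(n <- ns) c n = 0 ->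
  forall n, n \in ns -> c n = 0.
Proof. by have [[_ _ h] _] := @res_graded _ _ _ _ res t; apply: h. Qed.

Lemma sum_part_uniform (l : seq (A * P t)) m : exists N, (m < N)%N /\
  forall p, p \in l -> p.1 = \sum_(i < N) part i p.1.
Proof.
elim: l => [|p l [N [lt hN]]]; first by exists m.+1.
have [N' le e] := sum_part_ge X p.1 N.
exists N'; split; first exact: leq_trans lt le.
move=> p'; rewrite inE => /orP[/eqP ->//|/hN]; exact: sum_part_widen.
Qed.

(** Keep the parts of degree [m] of the coefficients in any expression of [y] by
    generators: the other parts cancel since the grading is a direct sum. *)
Lemma generated_homogeneous m (y : P t) :
  generated_in_degree Ht t%:Z -> Ht (t%:Z + m%:Z) y ->
  exists l : seq (A * P t), exists (F : A * P t -> A),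
   [/\ forall p, G m (F p), forall p, p \in l -> Ht t%:Z p.2 & y = \sum_(p <- l) F p *: p.2].
Proof.
move=> gen Hy.
have Ssub : is_submod [set z : P t | exists l : seq (A * P t),
    (forall p, p \in l -> Ht t%:Z p.2) /\ z = \sum_(p <- l) p.1 *: p.2].
  split=> [|u z z' [l [hl ->]] [l' [hl' ->]]]; first by exists [::]; rewrite big_nil.
  exists ([seq (u * p.1, p.2) | p <- l] ++ l'); split.
    by move=> p; rewrite mem_cat => /orP[/mapP[p' /hl h ->]|/hl'].
  rewrite big_cat big_map /= scaler_sumr; congr (_ + _).
  by apply: eq_bigr => p _; rewrite scalerA.
have [l [hl ey]] : submod_set (Submod Ssub) y.
  have : submod_set (submod_gen (Ht t%:Z)) y by rewrite gen.
  apply=> z Hz; exists [:: (1, z)]; split; last by rewrite big_seq1 scale1r.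
  by move=> p; rewrite inE => /eqP ->.
have [N [mN hN]] := sum_part_uniform l m.
exists l, (fun p => part m p.1); split=> // [p|]; first exact: partG.
pose yi i := \sum_(p <- l) part i p.1 *: p.2.
have Hyi i : Ht (t%:Z + i%:Z) (yi i).
  rewrite /yi big_seq; apply: res_deg_sum => p pl.
  by apply: res_degZ (hl p pl); apply: partG.
have ey' : y = \sum_(i < N) yi i.
  rewrite ey exchange_big /= big_seq [RHS]big_seq; apply: eq_bigr => p pl.
  by rewrite {1}(hN p pl) scaler_suml.
(* The grading is direct, so the components of this null sum vanish one by one. *)
pose term i := yi i - (if i == m then y else 0).
pose c (z : int) := \sum_(i < N | t%:Z + i%:Z == z) term i.
have Hterm (i : 'I_N) : Ht (t%:Z + i%:Z) (term i).
  by apply: res_degB => //; case: eqP => [->//|_]; apply: res_deg0.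
have Hc z : Ht z (c z) by apply: res_deg_sum => i /eqP <-.
have cE (i : 'I_N) : c (t%:Z + i%:Z) = term i.
  rewrite /c (big_pred1 i) // => j; apply/eqP/eqP => [/addrI|->//].
  by move=> [/val_inj].
pose ns := map (fun i : 'I_N => t%:Z + (i : nat)%:Z) (enum 'I_N).
have uns : uniq ns.
  by rewrite map_inj_uniq ?enum_uniq // => i j /addrI [/val_inj].
have sum0 : \sum_(z <- ns) c z = 0.
  rewrite big_map big_enum /= (eq_bigr _ (fun i _ => cE i)) sumrB -ey'.
  by rewrite (bigD1 (Ordinal mN)) //= eqxx big1 ?addr0 ?subrr // => i;
    rewrite -val_eqE /= => /negbTE ->.
have := res_deg_direct uns Hc sum0 (n := t%:Z + m%:Z).
have -> : t%:Z + m%:Z \in ns by apply/mapP; exists (Ordinal mN); rewrite ?mem_enum.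
move=> /(_ isT); rewrite -[m]/(val (Ordinal mN)) cE /term /= eqxx.
by move/eqP; rewrite subr_eq0 => /eqP <-.
Qed.

End Grading.

Lemma res_decomp t (x : P t) n : exists (ns : seq int) (c : int -> P t),
  [/\ uniq ns, n \in ns, forall m, H t m (c m) & x = \sum_(m <- ns) c m].
Proof.
have [[_ dec _] _] := @res_graded _ _ _ _ res t.
have [ns [c [Hc exs]]] := dec x.
pose c' z := c z *+ count_mem z ns.
have Hc' z : H t z (c' z).
  rewrite /c'; elim: (count_mem z ns) => [|m IHm]; first exact: res_deg0.
  by rewrite mulrS; apply: res_degD.
exists (undup (n :: ns)), c'.
split=> //; [exact: undup_uniq | by rewrite mem_undup mem_head|].
have ex' : x = \sum_(z <- undup ns) c' z by rewrite exs -[LHS]big_undup_iterop_count.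
rewrite /=; case: ifP => // nn; rewrite big_cons -ex' /c'.
by have /count_memPn -> : n \notin ns; rewrite ?nn // mulr0n add0r.
Qed.

(** The differential preserves degrees, so the component of degree [n] of any lift
    is again a lift. *)
Lemma lift_homogeneous t n (y : P t) : H t n y -> syzygy (res_diff res) eps y ->
  exists2 x, H t.+1 n x & d t x = y.
Proof.
move=> Hy; rewrite -(res_exact res t) => -[x _ ex].
have [ns [c [uns nin Hc exs]]] := res_decomp x n.
exists (c n) => //.
pose c2 z := d t (c z) - (if z == n then y else 0).
have Hc2 z : H t z (c2 z).
  apply: res_degB; first exact: res_diff_deg.
  by case: eqP => [->//|_]; apply: res_deg0.
have s0 : \sum_(z <- ns) c2 z = 0.
  rewrite sumrB -linear_sum -exs ex (bigD1_seq n) //= eqxx.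
  by rewrite big1 ?addr0 ?subrr // => z /negbTE ->.
by have := res_deg_direct uns Hc2 s0 nin; rewrite /c2 eqxx => /eqP; rewrite subr_eq0 => /eqP.
Qed.

Lemma lift_degree_zero v : exists2 x, H 0 0 x & eps x = tq (E v).
Proof.
have [x ex] := res_aug_surj res (tq (E v)).
(* The grading of A_0 is concentrated in degree 0, so the other components die. *)
have [ns [c [uns nin Hc exs]]] := res_decomp x 0.
exists (c 0) => //; rewrite -ex exs linear_sum (bigD1_seq 0) //= big1 ?addr0 // => z.
by move=> /negbTE z0; have := res_aug_deg (Hc z); rewrite /degree_zero_grading z0.
Qed.

Lemma diff_diff t (x : P t.+2) : d t (d t.+1 x) = 0.
Proof. exact: (diff_in_kernel x). Qed.

Section Linear.
Hypothesis gen : forall t, generated_in_degree (H t) t%:Z.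

Lemma degS t : t.+1%:Z = t%:Z + 1%:Z :> int.
Proof. by rewrite -PoszD addn1. Qed.

(** Let Th be the sum over [a] of the functional of [a :: w] times [a].  It agrees
    in degree one with the functional of [w] composed with the differential.  The
    latter kills [d x], and [d x] is a combination of elements of degree t+1 with
    coefficients of degree one; so Th (d x) has no part of degree two, and this
    part is the left-hand side. *)
Lemma fcoef_relation v t w (x : P t.+2) : size w = t -> H t.+2 t.+2%:Z x ->
  \sum_a (\sum_b sc (fcoef v (b :: a :: w) x) * Y b) * Y a = 0.
Proof.
move=> sw Hx; have Hd := res_diff_deg Hx; rewrite degS in Hd.
have [l [u [Gu hl ed]]] := generated_homogeneous (gen t.+1) Hd.
pose L := functional v t w; pose La a := functional v t.+1 (a :: w).
pose Th y := \sum_a La a y * Y a.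
have part0Th y : part 0 (Th y) = 0.
  by rewrite raddf_sum /= big1 // => a _; rewrite (part_mulr0 X _ (G_arrow X a)).
have part1Th y : part 1 (Th y) = part 1 (L (d t y)).
  rewrite /L part1_functional raddf_sum /=; apply: eq_bigr => a _.
  rewrite -[1%N]add0n (part_mulr X _ _ (G_arrow X a)) part0_functional /= ?sw //.
  by rewrite -mulrA (target_arrow X).
have ThZ y y' : Th (y + y') = Th y + Th y'.
  by rewrite -big_split; apply: eq_bigr => a _; rewrite linearD mulrDl.
have Thu c y : Th (c *: y) = c * Th y.
  rewrite mulr_sumr; apply: eq_bigr => a _.
  by rewrite linearZ /= -[c *: _]/(c * La a y) mulrA.
have Th0 : Th 0 = 0 by rewrite /Th big1 // => a _; rewrite linear0 mul0r.
have eL : \sum_(p <- l) u p * L (d t p.2) = 0.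
  have := congr1 (fun z => L (d t z)) ed; rewrite /= diff_diff linear0 !linear_sum /= => e0.
  by apply: etrans (esym e0); apply: eq_bigr => p _; rewrite !linearZ.
have eTh : Th (d t.+1 x) = \sum_(p <- l) u p * Th p.2.
  by rewrite ed (big_morph Th ThZ Th0); apply: eq_bigr => p _; rewrite Thu.
have : part 2 (Th (d t.+1 x)) = 0.
  have -> : Th (d t.+1 x) = \sum_(p <- l) u p * (Th p.2 - L (d t p.2)).
    rewrite eTh -[LHS]subr0 -[X in _ - X]eL -sumrB.
    by apply: eq_bigr => p _; rewrite mulrBr.
  rewrite raddf_sum /= big1 // => p _.
  by rewrite -[2%N]/(1 + 1)%N (part_mull X _ _ (Gu p)) raddfB /= part1Th subrr mulr0.
rewrite raddf_sum /= => e0; apply: etrans e0; apply: eq_bigr => a _.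
by rewrite -[2%N]/(1 + 1)%N (part_mulr X _ _ (G_arrow X a)) part1_functional.
Qed.

(** The coefficients of [a :: w] and [a :: w'] are given by the same combination of
    values at [w] and [w'], because the words have the same end. *)
Lemma fcoef_extend v t w w' (m m' : k) a : size w = t -> size w' = t ->
  word_end v w = word_end v w' ->
  (forall x : P t, H t t%:Z x -> m * fcoef v w x + m' * fcoef v w' x = 0) ->
  forall x : P t.+1, H t.+1 t.+1%:Z x -> m * fcoef v (a :: w) x + m' * fcoef v (a :: w') x = 0.
Proof.
move=> sw sw' ew hm x Hx; have Hd := res_diff_deg Hx; rewrite degS in Hd.
have [l [u [Gu hl ed]]] := generated_homogeneous (gen t) Hd.
rewrite (fcoef_dec _ _ sw Gu ed) (fcoef_dec _ _ sw' Gu ed) -ew.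
case: ifP => _; last by rewrite !mulr0 addr0.
rewrite !mulr_sumr -big_split /= big_seq big1 // => p pl.
by rewrite !(mulrCA _ (acoef a _)) -mulrDr hm ?mulr0 //; apply: hl.
Qed.

(** Lift the cycle to P^(t+1): its lift is a combination of elements of degree
    t+1, whose differentials have along [w] the coefficients of the words
    [a :: w] as values of degree one. *)
Lemma boundary_coef v t w (z : P t) : size w = t -> H t (t%:Z + 2%:Z) z ->
  syzygy (res_diff res) eps z ->
  exists (l : seq (A * P t.+1)) (u : A * P t.+1 -> A),
  [/\ forall p, G 1%N (u p), forall p, p \in l -> H t.+1 t.+1%:Z p.2 &
  part 2 (functional v t w z) = \sum_(p <- l) u p * \sum_a sc (fcoef v (a :: w) p.2) * Y a].
Proof.
move=> sw Hz zker; have [x Hx ex] := lift_homogeneous Hz zker.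
have e2 : t%:Z + 2%:Z = t.+1%:Z + 1%:Z by rewrite -!PoszD addn2 addn1.
rewrite e2 in Hx; have [l [u [Gu hl exl]]] := generated_homogeneous (gen t.+1) Hx.
exists l, u; split=> //.
rewrite -ex exl linear_sum linear_sum raddf_sum /=; apply: eq_bigr => p _.
rewrite !linearZ /= -[u p *: _]/(u p * _) -[2%N]/(1 + 1)%N (part_mull X _ _ (Gu p)).
by rewrite part1_functional.
Qed.

End Linear.
End Koszul.

(** * Triangles and rhombi in the McKay quiver *)
Section McKayGeometry.
Variables (s r : nat).
Hypotheses (hs : (4 <= s)%N) (hr : (4 <= r)%N).
Local Notation V := (mckay_vertex s r).
Local Notation shift := (@shift s r).
Implicit Types (x y z : mckay_dir) (i j : V).

Lemma Zp_int_eq0 n (m : int) : (4 <= n)%N -> (`|m| < 4)%N -> m%:~R = 0 :> 'Z_n -> m = 0.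
Proof.
move=> n4 m4 /eqP; case: m m4 => m m4 h.
  have mn : (m < n)%N by apply: leq_trans n4.
  by move: h; rewrite -pmulrn -val_eqE /= val_Zp_nat ?modn_small //; [move=> /eqP -> | lia].
have mn : (m.+1 < n)%N by apply: leq_trans n4.
by move: h; rewrite NegzE mulrNz oppr_eq0 -pmulrn -val_eqE /= val_Zp_nat ?modn_small //; lia.
Qed.

Definition shift1 x : int := match x with Alpha => 1 | Beta => 0 | Gamma => -1 end.
Definition shift2 x : int := match x with Alpha => 0 | Beta => 1 | Gamma => -1 end.

Lemma shiftE x : shift x = ((shift1 x)%:~R, (shift2 x)%:~R).
Proof.
case: x => //=; rewrite /e /e1 /e2.
by congr pair; rewrite /= ?addr0 ?add0r mulrN1z.
Qed.

Lemma shift1_lt4 x y z : (`|(shift1 x + shift1 y + shift1 z : int)| < 4)%N.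
Proof. by case: x; case: y; case: z. Qed.
Lemma shift2_lt4 x y z : (`|(shift2 x + shift2 y + shift2 z : int)| < 4)%N.
Proof. by case: x; case: y; case: z. Qed.

Lemma shift3_eq0 x y z : shift x + shift y + shift z = 0 <->
  shift1 x + shift1 y + shift1 z = 0 /\ shift2 x + shift2 y + shift2 z = 0.
Proof.
rewrite !shiftE; split=> [h|[h1 h2]]; last first.
  have add_pair (a b : 'Z_s) (a' b' : 'Z_r) : ((a, a') : V) + (b, b') = (a + b, a' + b') by [].
  by rewrite !add_pair -!intrD h1 h2.
have := congr1 snd h; have := congr1 fst h; rewrite /= -!intrD.
move=> /(Zp_int_eq0 hs) h1 /(Zp_int_eq0 hr) h2.
by split; [apply: h1; apply: shift1_lt4 | apply: h2; apply: shift2_lt4].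
Qed.

Definition dir_code x : nat := match x with Alpha => 0 | Beta => 1 | Gamma => 2 end.
(** Compares codes rather than directions, so that the test reduces by
    computation. *)
Definition distinct x y z : bool := uniq [:: dir_code x; dir_code y; dir_code z].

(** Each coordinate of a sum of three steps is represented by an integer of
    absolute value at most three, so it vanishes modulo a number greater than
    three only if this integer is zero. *)
Lemma shift3_uniq x y z : shift x + shift y + shift z = 0 <-> distinct x y z.
Proof.
have <- : (shift1 x + shift1 y + shift1 z == 0) && (shift2 x + shift2 y + shift2 z == 0)
  = distinct x y z by case: x; case: y; case: z.
rewrite shift3_eq0; split; first by case=> -> ->.
by case/andP => /eqP -> /eqP ->.
Qed.

Lemma shift_uniq_sum0 x y z i : distinct x y z -> i + shift x + shift y + shift z = i.
Proof.
by move=> /shift3_uniq e; rewrite -!addrA [X in i + X]addrA e addr0.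
Qed.

Lemma shift_loop x y d i : i + shift x + shift y + shift d = i -> distinct x y d.
Proof.
move=> e; apply/shift3_uniq; apply: (@addrI _ i); rewrite addr0 -[RHS]e.
by rewrite !addrA.
Qed.

Lemma uniq_rot x y z : distinct x y z -> distinct y z x.
Proof. by case: x; case: y; case: z. Qed.
Lemma uniq_swap x y z : distinct x y z -> distinct y x z.
Proof. by case: x; case: y; case: z. Qed.
Lemma distinct_neq x y z : distinct x y z -> [/\ x <> y, y <> z & x <> z].
Proof. by case: x; case: y; case: z. Qed.
Lemma third_direction x y : x <> y -> exists z, distinct x y z.
Proof. by case: x; case: y => // _; [exists Gamma|exists Beta|exists Gamma|exists Alpha|exists
  Beta|exists Alpha]. Qed.

(** The direction [z] closes both pairs of steps to a loop, so [d], [d'] and [z]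
    are the three directions. *)
Lemma two_steps x y z d d' i : distinct x y z ->
  i + shift d + shift d' = i + shift x + shift y ->
  (d = x /\ d' = y) \/ (d = y /\ d' = x).
Proof.
move=> u e; have := shift_uniq_sum0 i u; rewrite -e => /shift_loop.
by move: u; case: x {e}; case: y; case: z => //; case: d; case: d' => //; auto.
Qed.

Lemma shift_inj x y : shift x = shift y -> x = y.
Proof.
move=> e; apply: contrapT => /third_direction[z /shift3_uniq u].
have : shift x + shift x + shift z = 0 by rewrite {2}e.
by move/shift3_uniq; rewrite /distinct /= inE eqxx.
Qed.

Lemma period z i : exists2 t, (0 < t)%N & i + shift z *+ t = i.
Proof.
exists (s * r)%N; first by rewrite muln_gt0; lia.
rewrite shiftE; set a := _%:~R; set b := _%:~R.
have e n : ((a, b) : V) *+ n = (a *+ n, b *+ n).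
  by elim: n => [|n IHn]; rewrite ?mulr0n // !mulrS IHn.
rewrite e -[a *+ _]mulr_natr -[b *+ _]mulr_natr !natrM.
have -> : (s%:R : 'Z_s) = 0 by apply: pchar_Zp; lia.
have -> : (r%:R : 'Z_r) = 0 by apply: pchar_Zp; lia.
by rewrite mul0r !mulr0 addr0.
Qed.

Local Notation Q := (mckay s r).

(** Words are read from right to left: the head of the list is the last step. *)
Fixpoint vend (i : V) (w : seq mckay_dir) : V :=
  if w is x :: w' then vend i w' + shift x else i.
Fixpoint arrows (i : V) (w : seq mckay_dir) : seq (arrow Q) :=
  if w is x :: w' then (vend i w', x) :: arrows i w' else [::].

Lemma size_arrows i w : size (arrows i w) = size w.
Proof. by elim: w => //= x w ->. Qed.
Lemma vend_nseq i n z : vend i (nseq n z) = i + shift z *+ n.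
Proof. by elim: n => [|n IHn] /=; rewrite ?addr0 // IHn mulrSr addrA. Qed.
Lemma vend_cat i w w' : vend i (w ++ w') = vend (vend i w') w.
Proof. by elim: w => //= x w ->. Qed.

End McKayGeometry.

(** * Nonvanishing of paths of length two *)
Section McKayAlgebra.
Variables (s r : nat).
Hypotheses (hs : (4 <= s)%N) (hr : (4 <= r)%N).
Local Notation V := (mckay_vertex s r).
Local Notation shift := (@shift s r).
Local Notation Q := (mckay s r).
Variables (k : fieldType) (A : pzRingType).
Variables (G : nat -> set A) (E : vertex Q -> A) (X : quiver_ring k G E).
Local Notation sc := (qr_sc X).
Local Notation acoef := (qr_acoef X).
Implicit Types (x y z : mckay_dir) (i j : V).
Hypothesis nondeg : forall t (u : A), (t < 3)%N -> G t u ->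
  (forall a, qr_arrow X a * u = 0) -> u = 0.
Hypothesis soc : forall v, exists s0, [/\ G 3%N s0, E v * s0 = s0, s0 * E v = s0, s0 <> 0
  & forall u, G 3%N u -> exists c, u * E v = sc c * s0].

Definition arrow_elt x i : A := qr_arrow X ((i, x) : arrow Q).
Local Notation step := arrow_elt.
Definition two_step y x i : A := step y (i + shift x) * step x i.
Local Notation step2 := two_step.
Definition two_step_nz y x i : Prop := step2 y x i <> 0.
Local Notation nz := two_step_nz.

Lemma Estep x i : E (i + shift x) * step x i = step x i.
Proof. exact: (target_arrow X ((i, x) : arrow Q)). Qed.
Lemma stepE x i : step x i * E i = step x i.
Proof. exact: (arrow_source X ((i, x) : arrow Q)). Qed.
Lemma Gstep x i : G 1%N (step x i). Proof. exact: (G_arrow X). Qed.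
Lemma Gstep2 y x i : G 2%N (step2 y x i).
Proof. by have := GM X (Gstep y (i + shift x)) (Gstep x i). Qed.
Lemma Estep2 y x i : E (i + shift x + shift y) * step2 y x i = step2 y x i.
Proof. by rewrite /two_step mulrA Estep. Qed.
Lemma step2E y x i : step2 y x i * E i = step2 y x i.
Proof. by rewrite /two_step -mulrA stepE. Qed.
Lemma E_neq i j : i <> j -> E i * E j = 0.
Proof. by rewrite (idemM X); case: eqP. Qed.

Lemma step_E_neq x i j : i <> j -> step x i * E j = 0.
Proof. by move=> n; rewrite -stepE -mulrA E_neq // mulr0. Qed.

Lemma degree3_loop (u : A) i j : G 3%N u -> E j * u = u -> u * E i = u -> u <> 0 -> j = i.
Proof.
move=> Gu Eu uE u0; apply: contrapT => nji.
have [s0 [_ Es _ _ h]] := soc i; have [c] := h _ Gu; rewrite uE => e.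
by apply: u0; rewrite -Eu e -Es mulrA -(scC X) -!mulrA (mulrA (E j)) E_neq ?mul0r ?mulr0.
Qed.

Lemma degree3_line (u w : A) i : G 3%N u -> G 3%N w -> u * E i = u -> w * E i = w -> u <> 0 ->
  exists c, w = sc c * u.
Proof.
move=> Gu Gw uE wE u0; have [s0 [_ _ _ _ h]] := soc i.
have [cu eu] := h _ Gu; have [cw ew] := h _ Gw; rewrite uE in eu; rewrite wE in ew.
have cu0 : cu != 0 by apply: contra_notN u0 => /eqP cu0;
  rewrite eu cu0 (raddf0 (qr_sc X)) mul0r.
by exists (cw / cu); rewrite eu mulrA -(scM X) divfK.
Qed.

(** Nondegeneracy gives an arrow which does not kill [u], and a nonzero element of
    degree three is a loop. *)
Lemma degree2_extend (u : A) i j : G 2%N u -> E j * u = u -> u * E i = u -> u <> 0 ->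
  exists2 x, j + shift x = i & step x j * u <> 0.
Proof.
move=> Gu Eu uE u0.
have [a na] : exists a, qr_arrow X a * u <> 0.
  apply: contrapT => h; apply: u0; apply: (nondeg _ Gu) => // a.
  by apply: contrapT => n; apply: h; exists a.
case: a na => j' x; rewrite -/(step x j') => n.
have ej : j' = j by apply: contrapT => nj; apply: n; rewrite -Eu mulrA step_E_neq // mul0r.
subst j'; exists x => //; apply: (degree3_loop (u := step x j * u)) => //.
- by have := GM X (Gstep x j) Gu.
- by rewrite mulrA Estep.
- by rewrite -mulrA uE.
Qed.

(** A nonzero square would extend to a nonzero loop of three steps with a repeated
    direction. *)
Lemma step_square x i : step2 x x i = 0.
Proof.
apply: contrapT => n.
have [d e _] := degree2_extend (Gstep2 x x i) (Estep2 x x i) (step2E x x i) n.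
by have := shift_loop hs hr e; case: x {n e} => //; case: d.
Qed.

Lemma step3_nz x y z (u : A) i : distinct x y z ->
  G 2%N u -> E (i + shift x + shift y) * u = u -> u * E i = u -> u <> 0 ->
  step z (i + shift x + shift y) * u <> 0.
Proof.
move=> dxyz Gu Eu uE u0; have [d e h] := degree2_extend Gu Eu uE u0.
suff -> : z = d by [].
by have := shift_loop hs hr e; case: x dxyz {Eu e h} => //; case: y; case: z => // _; case: d.
Qed.

(** A nonzero yx extends to a nonzero zyx, which has zy as a factor. *)
Lemma nz_rot x y z i : distinct x y z -> nz y x i -> nz z y (i + shift x).
Proof.
move=> d n e; apply: (step3_nz d (Gstep2 y x i) (Estep2 y x i) (step2E y x i) n).
by rewrite /two_step mulrA -/(step2 z y (i + shift x)) e mul0r.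
Qed.

Lemma nz_rot2 x y z i : distinct x y z -> nz y x i -> nz x z (i + shift x + shift y).
Proof. by move=> d /(nz_rot d); apply: nz_rot; apply: uniq_rot. Qed.

Lemma step_neq0 x i : step x i <> 0.
Proof.
move=> /(congr1 (acoef (i, x))); rewrite (acoef_arrow X) eqxx raddf0 /=.
by apply/eqP; apply: oner_neq0.
Qed.

(** The step [z] that closes both ways around the rhombus to loops is not killed
    by all arrows, and zz = 0; the paths xz and yz are on the same triangles as yx
    and xy, respectively. *)
Lemma nz_or x y z i : distinct x y z -> nz y x i \/ nz x y i.
Proof.
move=> dxyz; pose j := i + shift x + shift y.
have ej : j + shift z = i by apply: shift_uniq_sum0.
have [[i' d] na] : exists a, qr_arrow X a * step z j <> 0.
  apply: contrapT => h; apply: (@step_neq0 z j); apply: (nondeg _ (Gstep z j)) => // a.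
  by apply: contrapT => n; apply: h; exists a.
have ei : i' = i.
  by apply: contrapT => n; apply: na; rewrite -/(step d i') -(Estep z j) ej mulrA step_E_neq
    // mul0r.
subst i'; have ndz : nz d z j by rewrite /two_step_nz /two_step ej.
have [ed|[ed|ed]] : d = x \/ d = y \/ d = z.
  by move: dxyz; clear; case: x; case: y; case: z => //; case: d; auto.
- left; rewrite -ej; apply: (nz_rot (x := z) (y := x)); last by rewrite -ed.
  exact/uniq_rot/uniq_rot.
- right; rewrite -ej; apply: (nz_rot (x := z) (y := y)); last by rewrite -ed.
  exact/uniq_rot/uniq_rot/uniq_swap.
by case: ndz; rewrite ed; apply: step_square.
Qed.

(** Multiplication by the step [z] back to [i] is injective, and the loops of
    degree three at [i] form a line. *)
Lemma degree2_line x y z (p q : A) i : distinct x y z ->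
  G 2%N p -> G 2%N q ->
  E (i + shift x + shift y) * p = p -> E (i + shift x + shift y) * q = q ->
  p * E i = p -> q * E i = q -> p <> 0 -> exists c, q = sc c * p.
Proof.
move=> d Gp Gq Ep Eq pE qE p0.
set j := i + shift x + shift y in Ep Eq.
have np : step z j * p <> 0 by apply: step3_nz d Gp Ep pE p0.
have [c ec] : exists c, step z j * q = sc c * (step z j * p).
  apply: (degree3_line (i := i)) => //.
  - by have := GM X (Gstep z j) Gp.
  - by have := GM X (Gstep z j) Gq.
  - by rewrite -mulrA pE.
  - by rewrite -mulrA qE.
exists c; apply/eqP; rewrite -subr_eq0; apply/eqP; apply: contrapT => n.
apply: (step3_nz (x := x) (y := y) (z := z) (i := i) d _ _ _ n).
- rewrite -mulN1r -[-1]/(- 1 : A).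
  have -> : -1 * (sc c * p) = sc (- c) * p by rewrite (raddfN (qr_sc X)) mulN1r mulNr.
  by apply: (GD X) => //; apply: (GscM X).
- by rewrite -/j mulrBr Eq mulrA -(scC X) -mulrA Ep.
- by rewrite mulrBl qE -mulrA pE.
by rewrite -/j mulrBr ec [step z j * (_ * p)]mulrA -(scC X) -mulrA subrr.
Qed.

Lemma square_relation x y z i : distinct x y z -> nz y x i ->
  exists c, step2 x y i = sc c * step2 y x i.
Proof.
move=> d n; apply: (degree2_line (i := i) d) => //; try exact: Gstep2; try exact: step2E.
- exact: Estep2.
- by rewrite addrAC Estep2.
Qed.

End McKayAlgebra.

(** * Degenerate rhombi contradict linearity *)
Section McKayKoszul.
Variables (s r : nat).
Hypotheses (hs : (4 <= s)%N) (hr : (4 <= r)%N).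
Local Notation V := (mckay_vertex s r).
Local Notation shift := (@shift s r).
Local Notation Q := (mckay s r).
Variables (k : fieldType) (A : pzRingType).
Variables (G : nat -> set A) (E : vertex Q -> A) (X : quiver_ring k G E).
Local Notation sc := (qr_sc X).
Local Notation part := (qr_part X).
Local Notation vcoef := (qr_vcoef X).
Local Notation acoef := (qr_acoef X).
Local Notation step := (@arrow_elt s r k A G E X).
Local Notation step2 := (@two_step s r k A G E X).
Local Notation nz := (@two_step_nz s r k A G E X).
Implicit Types (x y z : mckay_dir) (i j v : V) (ds : seq mckay_dir).
Hypothesis nondeg : forall t (u : A), (t < 3)%N -> G t u ->
  (forall a, qr_arrow X a * u = 0) -> u = 0.
Hypothesis soc : forall v, exists s0, [/\ G 3%N s0, E v * s0 = s0, s0 * E v = s0, s0 <> 0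
  & forall u, G 3%N u -> exists c, u * E v = sc c * s0].
Variable res : minimal_graded_projective_resolution G (@degree_zero_grading A G).
Local Notation P := (res_mod res).
Local Notation d t := (res_diff res t).
Local Notation eps := (res_aug res).
Local Notation H t := (@res_deg _ _ _ _ res t).
Local Notation tq := (to_quotmod (positive_part G)).
Local Notation ker t z := (@syzygy _ (degree_zero G) P (res_diff res) eps t z).

Definition coef v t ds (x : P t) : k := fcoef X v (arrows v ds) x.

Lemma word_end_arrows v ds : @word_end Q v (arrows v ds) = vend v ds.
Proof. by case: ds. Qed.

(** Once the end points are fixed, only the two ways around a rhombus
    contribute. *)
Lemma two_step_sum x y z i (phi : arrow Q -> arrow Q -> k) : distinct x y z ->
  E (i + shift x + shift y) *
    (\sum_a (\sum_b sc (phi b a) * qr_arrow X b) * qr_arrow X a) * E i =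
  sc (phi (i + shift x, y) (i, x)) * step2 y x i +
  sc (phi (i + shift y, x) (i, y)) * step2 x y i.
Proof.
move=> dxyz; set j := i + _ + _.
have e1 : E j * (\sum_a (\sum_b sc (phi b a) * qr_arrow X b) * qr_arrow X a) * E i =
   \sum_(p : arrow Q * arrow Q)
     sc (phi p.2 p.1) * (E j * qr_arrow X p.2 * (qr_arrow X p.1 * E i)).
  rewrite mulr_sumr mulr_suml -(pair_bigA _ (fun a b => sc (phi b a) * (E j * qr_arrow X b *
    (qr_arrow X a * E i)))) /=.
  apply: eq_bigr => a _; rewrite mulr_suml mulr_sumr mulr_suml.
  apply: eq_bigr => b _; rewrite -!mulrA (mulrA (E j) (sc _)) -(scC X).
  by rewrite -!mulrA.
rewrite e1 (bigD1 ((i, x) : arrow Q, (i + shift x, y) : arrow Q)) //=.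
have [nxy _ _] := distinct_neq dxyz.
rewrite (bigD1 ((i, y) : arrow Q, (i + shift y, x) : arrow Q)) /=; last first.
  by apply/eqP => -[] e _ _; apply: nxy.
rewrite -/(step x i) -/(step y i) -/(step y (i + shift x)) -/(step x (i + shift y)).
rewrite !stepE Estep [j in X in _ + (X + _)]addrAC Estep big1 ?addr0 //.
move=> [[i1 d1] [i2 d2]] /andP[/eqP n1 /eqP n2] /=.
rewrite -/(step d1 i1) -/(step d2 i2).
case: (EM (i1 = i)) => [e1'|ne]; last by rewrite step_E_neq // !mulr0.
subst i1; rewrite stepE.
case: (EM (i2 = i + shift d1)) => [e2|ne]; last first.
  by rewrite -(Estep X d1) -(stepE X d2) -!mulrA (mulrA (E i2)) (E_neq X) // mul0r !mulr0.
subst i2; case: (EM (i + shift d1 + shift d2 = j)) => [e3|ne]; last first.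
  by rewrite -(Estep X d2) (mulrA (E j)) (E_neq X) ?mul0r ?mulr0 // => e; apply: ne.
by have [[e4 e5]|[e4 e5]] := two_steps hs hr dxyz e3; [case: n1 | case: n2]; rewrite e4 e5.
Qed.

Lemma coef_cons v x ds t (p : P t.+1) :
  coef v (x :: ds) p = acoef (vend v ds, x) (functional X res v t (arrows v ds) (d t p)).
Proof. exact: fcoefS. Qed.

Lemma part0_functional_arrows v ds t (p : P t) : size ds = t ->
  part 0 (functional X res v t (arrows v ds) p) = sc (coef v ds p) * E (vend v ds).
Proof. by move=> sds; rewrite part0_functional ?size_arrows ?word_end_arrows. Qed.

Lemma vcoef_functional_arrows v ds t (p : P t) : size ds = t ->
  vcoef (vend v ds) (functional X res v t (arrows v ds) p) = coef v ds p.
Proof.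
by move=> sds; rewrite vcoef_functional ?size_arrows // word_end_arrows eqxx.
Qed.

Lemma acoef_step i x j y (u : A) :
  acoef (i, x) (step y j * u) = if (i, x) == (j, y) then vcoef i u else 0.
Proof.
rewrite (acoefM X) (vcoefG X _ (Gstep X y j)) // mul0r add0r /arrow_elt (acoef_arrow X).
by case: eqP => [[-> ->]|_]; rewrite ?mul1r ?mul0r.
Qed.

Lemma functionalZ v t w (u : A) (p : P t) :
  functional X res v t w (u *: p) = u * functional X res v t w p :> A.
Proof. by rewrite linearZ. Qed.

Section PowerChain.
Variables (z : mckay_dir) (v : V).
Local Notation vz n := (v + shift z *+ n).

(** The lifts of the powers of [z]: as zz = 0, [z] times the n-th of them is a
    cycle, and the next one is chosen to have it as differential. *)
Fixpoint chain n : P n :=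
  match n return P n with
  | 0%N => xget 0 [set p | H 0%N 0 p /\ eps p = tq (E v)]
  | n'.+1 => xget 0 [set p | H n'.+1 n'.+1%:Z p /\ d n' p = step z (vz n') *: chain n']
  end.

Lemma vzS n : vz n.+1 = vz n + shift z.
Proof. by rewrite mulrSr addrA. Qed.

Lemma chain0P : H 0%N 0 (chain 0) /\ eps (chain 0) = tq (E v).
Proof.
rewrite /=; case: xgetP => [p _ //|no]; exfalso.
by have [p Hp ep] := lift_degree_zero E res v; apply: (no p).
Qed.

Lemma to_quotmod_positive (u : A) : positive X u -> tq u = 0.
Proof.
move=> pu; rewrite -(to_quotmod0 (positive_part G)); apply/(tq_eqP X) => w.
by rewrite pu raddf0.
Qed.

Lemma res_augZ (u : A) p : eps (u *: p) = u *: eps p.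
Proof. exact: linearZ. Qed.

Lemma chainP n : H n n%:Z (chain n) /\ ker n (step z (vz n) *: chain n) /\
  d n (chain n.+1) = step z (vz n) *: chain n.
Proof.
have next m : H m m%:Z (chain m) -> ker m (step z (vz m) *: chain m) ->
    H m.+1 m.+1%:Z (chain m.+1) /\ d m (chain m.+1) = step z (vz m) *: chain m.
  move=> Hm km; rewrite [chain m.+1]/=; case: xgetP => [p _ //|no]; exfalso.
  have Hs : H m (m%:Z + 1%:Z) (step z (vz m) *: chain m) by apply: res_degZ (Gstep X _ _) Hm.
  have [p Hp ep] := lift_homogeneous Hs km; apply: (no p); split=> //.
  by rewrite degS.
suff [Hn kn] : H n n%:Z (chain n) /\ ker n (step z (vz n) *: chain n).
  by split=> //; split=> //; have [] := next n Hn kn.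
elim: n => [|n [Hn kn]].
  have [H0 e0] := chain0P; split=> //=.
  rewrite res_augZ e0 -to_quotmod_scale; apply: to_quotmod_positive => w.
  by rewrite (vcoefM X) (vcoefG X _ (Gstep X _ _)) // mul0r.
have [Hn' en'] := next n Hn kn; split=> //=.
rewrite linearZ /= en' scalerA vzS -/(step2 z z (vz n)).
by rewrite (step_square hs hr nondeg soc) scale0r.
Qed.

Lemma coef_chain n : coef v (nseq n z) (chain n) = 1.
Proof.
elim: n => [|n IHn].
  have [_ e0] := chain0P; rewrite /coef [arrows _ _]/= fcoef0.
  have : tq (repr (eps (chain 0))) = tq (E v) by rewrite /to_quotmod reprK.
  by move=> /(tq_eqP X) ->; rewrite (vcoef_idem X) eqxx.
have [_ [_ e]] := chainP n.
rewrite [nseq n.+1 z]/= coef_cons e functionalZ vend_nseq acoef_step eqxx.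
by rewrite -vend_nseq vcoef_functional_arrows ?IHn ?size_nseq.
Qed.

End PowerChain.

(** The step [z] times the [q]-th power of [z] is a cycle of degree q+1 which is
    not zero, since the functional of that power takes a nonzero value on it. *)
Lemma linear_range_infinite q : ~ (forall p : P q, ker q p -> H q (q%:Z + 3%:Z) p).
Proof.
move=> hq; pose i : V := 0; pose z := Alpha.
have [Hc [kc _]] := chainP z i q.
have H1 := res_degZ (Gstep X z (i + shift z *+ q)) Hc.
set p := step z _ *: chain z i q in kc H1.
have H3 := hq _ kc.
have p0 : p = 0.
  have := @res_deg_direct A G res q [:: q%:Z + 1%:Z; q%:Z + 3%:Z]
    (fun n => if n == q%:Z + 1%:Z then p else if n == q%:Z + 3%:Z then - p else 0).
  move=> /(_ _ _ _ (q%:Z + 1%:Z)); rewrite eqxx mem_head; apply=> //.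
  - by rewrite /= inE andbT -!PoszD eqz_nat eqn_add2l.
  - move=> n; case: eqP => [->//|_]; case: eqP => [->|_]; last exact: res_deg0.
    by rewrite -[- p]sub0r; apply: res_degB => //; apply: res_deg0.
  have ne : (q%:Z + 3%:Z == q%:Z + 1%:Z) = false by rewrite -!PoszD eqz_nat eqn_add2l.
  by rewrite !big_cons big_nil eqxx ne eqxx addr0 subrr.
have : acoef (i + shift z *+ q, z) (functional X res i q (arrows i (nseq q z)) p) = 1.
  rewrite /p functionalZ acoef_step eqxx -vend_nseq.
  by rewrite vcoef_functional_arrows ?size_nseq // coef_chain.
by rewrite p0 linear0 raddf0 => /esym/eqP; rewrite oner_eq0.
Qed.

Section Vanishing.
Variables (x y z : mckay_dir) (v : V).
Hypothesis dxyz : distinct x y z.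
Local Notation vz n := (v + shift z *+ n).

(** Starting from a lift of [x] and given [p] for [n], a relation xz = c zx at v_n
    makes [x] times the power n+1 of [z], minus [c z] times [p], a cycle, whose
    lift is the next [p].  Its coefficient is that of the power of [z]. *)
Lemma cross_chain n : (forall m, nz z x (vz m)) ->
  exists p : P n.+1, [/\ H n.+1 n.+1%:Z p, coef v (x :: nseq n z) p = 1 &
   exists q : P n, d n p = step z (vz n + shift x - shift z) *: q
     + step x (vz n) *: chain z v n].
Proof.
move=> nzD; elim: n => [|n [p [Hp cp [q eq]]]].
  have [H0 [_ _]] := chainP z v 0; have [_ e0] := chain0P z v.
  have k0 : ker 0 (step x (vz 0) *: chain z v 0).
    rewrite /= res_augZ e0 -to_quotmod_scale; apply: to_quotmod_positive => w.
    by rewrite (vcoefM X) (vcoefG X _ (Gstep X _ _)) // mul0r.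
  have Hs : H 0%N (0%:Z + 1%:Z) (step x (vz 0) *: chain z v 0)
    by apply: res_degZ (Gstep X _ _) H0.
  have [p Hp ep] := lift_homogeneous Hs k0; exists p; split; first by rewrite degS.
    rewrite coef_cons ep functionalZ /= addr0 acoef_step eqxx.
    by rewrite -[v in vcoef v]/(vend v [::]) vcoef_functional_arrows // (coef_chain z v 0).
  by exists 0; rewrite scaler0 add0r.
have [c ec] := square_relation hs hr nondeg soc (uniq_swap (uniq_rot (uniq_rot dxyz))) (nzD n).
have [Hn [_ en]] := chainP z v n; have [Hn1 _] := chainP z v n.+1.
pose q' := sc (- c) *: p.
pose t := step z (vz n + shift x) *: q' + step x (vz n.+1) *: chain z v n.+1.
have Ht : H n.+1 (n.+1%:Z + 1%:Z) t.
  apply: res_degD; apply: res_degZ (Gstep X _ _) _ => //.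
  by rewrite -[n.+1%:Z]addr0; apply: res_degZ (G_sc X _) Hp.
have kt : ker n.+1 t.
  rewrite /= /t /q' linearD !linearZ /= eq en !scalerDr !scalerA.
  have -> : step z (vz n + shift x) * sc (- c) * step z (vz n + shift x - shift z) = 0.
    rewrite -(scC X) -mulrA.
    set w := vz n + shift x - shift z.
    have -> : vz n + shift x = w + shift z by rewrite subrK.
    by rewrite -/(step2 z z w) (step_square hs hr nondeg soc) mulr0.
  rewrite scale0r add0r -scalerDl vzS -/(step2 x z (vz n)) ec.
  rewrite -(scC X) -mulrA -/(step2 z x (vz n)) -mulrDl (raddfN (qr_sc X)) /=.
  by rewrite addNr mul0r scale0r.
have [p' Hp' ep'] := lift_homogeneous Ht kt.
have ev : vz n + shift x = vz n.+1 + shift x - shift z by rewrite vzS [X in X - _]addrAC addrK.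
exists p'; split; first by rewrite degS.
  rewrite coef_cons ep' /t linearD (acoefD X) !functionalZ vend_nseq !acoef_step eqxx.
  have -> : ((vz n.+1, x) == (vz n + shift x, z)) = false.
    by apply/eqP => -[_ _] ezx; have [_ _ []] := distinct_neq dxyz.
  by rewrite add0r -vend_nseq vcoef_functional_arrows ?size_nseq // coef_chain.
by exists q'; rewrite ep' /t ev.
Qed.

End Vanishing.

Section Linear.
Hypothesis gen : forall t, generated_in_degree (H t) t%:Z.

(** Between opposite corners of a rhombus, the orthogonality of coefficients and
    relations has two terms. *)
Lemma coef_relation v ds x y z t (p : P t.+2) : size ds = t -> distinct x y z ->
  H t.+2 t.+2%:Z p ->
  sc (coef v (y :: x :: ds) p) * step2 y x (vend v ds) +
  sc (coef v (x :: y :: ds) p) * step2 x y (vend v ds) = 0.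
Proof.
move=> sds dxyz Hp.
have := fcoef_relation X gen v (w := arrows v ds) (etrans (size_arrows v ds) sds) Hp.
move=> /(congr1 (fun u => E (vend v ds + shift x + shift y) * u * E (vend v ds))).
by rewrite (two_step_sum _ _ dxyz) mulr0 mul0r.
Qed.

Lemma coef_relation_vanish v ds x y z t (p : P t.+2) i : size ds = t -> distinct x y z ->
  H t.+2 t.+2%:Z p -> vend v ds = i -> nz y x i ->
  coef v (x :: y :: ds) p = 0 \/ step2 x y i = 0 -> coef v (y :: x :: ds) p = 0.
Proof.
move=> sds d Hp <- n h; have := coef_relation v sds d Hp.
move: (coef v [:: x, y & ds] p) (coef v [:: y, x & ds] p) h => c c' h e.
apply: (sc_mul_eq0 n); apply: etrans e.
by case: h => ->; rewrite ?(raddf0 (qr_sc X)) ?mul0r ?mulr0 addr0.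
Qed.

Lemma coef_extend v ds ds' t (m m' : k) u : size ds = t -> size ds' = t ->
  vend v ds = vend v ds' ->
  (forall p : P t, H t t%:Z p -> m * coef v ds p + m' * coef v ds' p = 0) ->
  forall p : P (size u + t), H (size u + t) (size u + t)%N%:Z p ->
    m * coef v (u ++ ds) p + m' * coef v (u ++ ds') p = 0.
Proof.
move=> sds sds' e h; elim: u => [|x u IHu] //= p Hp.
have e' : vend v (u ++ ds) = vend v (u ++ ds') by rewrite !vend_cat e.
rewrite /coef /= -e'; apply: (@fcoef_extend k Q A G E X res gen v (size u + t)
  (arrows v (u ++ ds)) (arrows v (u ++ ds')) m m' ((vend v (u ++ ds), x) : arrow Q)) => //.
- by rewrite size_arrows size_cat sds.
- by rewrite size_arrows size_cat sds'.
- by rewrite !word_end_arrows.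
Qed.

Lemma coef_extend0 v ds t x : size ds = t ->
  (forall p : P t, H t t%:Z p -> coef v ds p = 0) ->
  forall p : P t.+1, H t.+1 t.+1%:Z p -> coef v (x :: ds) p = 0.
Proof.
move=> sds h p Hp.
have h' p' : H t t%:Z p' -> 1 * coef v ds p' + 0 * coef v ds p' = 0.
  by move=> Hp'; rewrite h // !mulr0 addr0.
have := @coef_extend v ds ds t 1 0 [:: x] sds sds erefl h' p Hp.
by rewrite mul1r mul0r addr0.
Qed.

(** The value along [ds] of a boundary is a combination of the two ways around the
    rhombus, in which yx comes with coefficients along [x :: ds] and xy with
    coefficients along [y :: ds]. *)
Lemma boundary_vanish v ds t x y z (xi : P t) : size ds = t -> distinct x y z ->
  H t (t%:Z + 2%:Z) xi -> ker t xi ->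
  ((forall p : P t.+1, H t.+1 t.+1%:Z p -> coef v (x :: ds) p =
    0) \/ step2 y x (vend v ds) = 0) ->
  ((forall p : P t.+1, H t.+1 t.+1%:Z p -> coef v (y :: ds) p =
    0) \/ step2 x y (vend v ds) = 0) ->
  E (vend v ds + shift x + shift y) *
    part 2 (functional X res v t (arrows v ds) xi) * E (vend v ds) = 0.
Proof.
move=> sds dxyz Hxi kxi hx hy.
have [l [u [Gu hl ->]]] := boundary_coef X gen v (etrans (size_arrows v ds) sds) Hxi kxi.
pose phi b a := \sum_(p <- l) acoef b (u p) * fcoef X v (a :: arrows v ds) p.2.
have -> : \sum_(p <- l) u p * (\sum_a sc (fcoef X v (a :: arrows v ds) p.2) * qr_arrow X a) =
   \sum_a (\sum_b sc (phi b a) * qr_arrow X b) * qr_arrow X a.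
  rewrite (eq_bigr (fun p => \sum_a \sum_b sc (acoef b (u p) * fcoef X v (a :: arrows v ds)
    p.2) * qr_arrow X b * qr_arrow X a)); last first.
    move=> p _; rewrite mulr_sumr; apply: eq_bigr => a _.
    have := part_homog X 1%N (Gu p); rewrite eqxx => {1}<-.
    rewrite (part1E X) mulr_suml; apply: eq_bigr => b _.
    by rewrite (scM X) -!mulrA; congr (_ * _); rewrite !mulrA (scC X).
  rewrite exchange_big; apply: eq_bigr => a _ /=.
  rewrite exchange_big /= mulr_suml; apply: eq_bigr => b _.
  by rewrite raddf_sum /= !mulr_suml.
rewrite (two_step_sum _ _ dxyz).
have z0 a b : (forall p : P t.+1, H t.+1 t.+1%:Z p -> fcoef X v (a :: arrows v ds) p = 0) ->
  phi b a = 0.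
  by move=> h; rewrite /phi big_seq big1 // => p pl; rewrite h ?mulr0 //; apply: hl.
have h1 : sc (phi (vend v ds + shift x, y) (vend v ds, x)) * step2 y x (vend v ds) = 0.
  by case: hx => [h|->]; [rewrite (z0 (vend v ds, x) _ h) (raddf0 (qr_sc X)) mul0r |
    rewrite mulr0].
have h2 : sc (phi (vend v ds + shift y, x) (vend v ds, y)) * step2 x y (vend v ds) = 0.
  by case: hy => [h|->]; [rewrite (z0 (vend v ds, y) _ h) (raddf0 (qr_sc X)) mul0r |
    rewrite mulr0].
by apply: etrans (congr2 +%R h1 h2) (addr0 0).
Qed.

Section Obstruction.
Variables (x y z : mckay_dir) (v : V).
Hypothesis dxyz : distinct x y z.
Local Notation vz n := (v + shift z *+ n).

Let dyzx : distinct y z x := uniq_rot dxyz.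
Let dzxy : distinct z x y := uniq_rot dyzx.
Let dyxz : distinct y x z := uniq_swap dxyz.
Let dxzy : distinct x z y := uniq_rot dyxz.
Let dzyx : distinct z y x := uniq_rot dxzy.

(** By rotation, the three paths of length two on the triangle at [i] with
    successive sides x, y, z vanish together. *)
Lemma nz_upP i : [/\ nz y x i -> nz z y (i + shift x), nz z y (i + shift x) -> nz y x i,
  nz y x i -> nz x z (i - shift z) & nz x z (i - shift z) -> nz y x i].
Proof.
have e : i + shift x + shift y = i - shift z.
  by rewrite -[i in RHS](shift_uniq_sum0 hs hr i dxyz) addrK.
have nr := nz_rot hs hr nondeg soc.
split=> h.
- exact: nr dxyz h.
- by have := nr _ _ _ _ dzxy (nr _ _ _ _ dyzx h); rewrite shift_uniq_sum0.
- by rewrite -e; exact: nr _ _ _ _ dyzx (nr _ _ _ _ dxyz h).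
- by have := nr _ _ _ _ dzxy h; rewrite subrK.
Qed.

(** The same for the opposite orientation, with successive sides x, z, y. *)
Lemma nz_downP i : [/\ nz z x i -> nz y z (i + shift x), nz y z (i + shift x) -> nz z x i,
  nz z x i -> nz x y (i + shift x + shift z) & nz x y (i + shift x + shift z) -> nz z x i].
Proof.
have nr := nz_rot hs hr nondeg soc.
split=> h.
- exact: nr dxzy h.
- by have := nr _ _ _ _ dyxz (nr _ _ _ _ dzyx h); rewrite shift_uniq_sum0.
- exact: nr _ _ _ _ dzyx (nr _ _ _ _ dxzy h).
- by have := nr _ _ _ _ dyxz h; rewrite shift_uniq_sum0.
Qed.

Hypothesis U0 : ~ nz y x v.

Lemma U0_zy : step2 z y (v + shift x) = 0.
Proof. by apply: contrapT => n; have [_ /(_ n)] := nz_upP v. Qed.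

Lemma step3_nonloop x1 x2 x3 i : ~~ distinct x1 x2 x3 ->
  step2 x3 x2 (i + shift x1) * step x1 i = 0.
Proof.
move=> nd; apply: contrapT => n; move/negP: nd; apply.
apply: (shift_loop hs hr (i := i)); apply: (degree3_loop soc _ _ _ n).
- by have := GM X (Gstep2 X x3 x2 (i + shift x1)) (Gstep X x1 i).
- by rewrite mulrA Estep2.
- by rewrite -mulrA stepE.
Qed.

(** As long as yz is nonzero, a coefficient along y z ... is a multiple of the
    coefficient along z y ..., so the step [y] moves towards the start of the word
    until it meets the vanishing path zy. *)
Lemma coef_yz_vanish o i ds n : (forall m, (m < n)%N -> nz y z (i + shift z *+ m)) ->
  step2 z y i = 0 -> vend o ds = i ->
  forall p : P (n.+1 + size ds), H (n.+1 + size ds)%N (n.+1 + size ds)%N%:Z p ->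
  (0 < n)%N -> coef o (y :: nseq n z ++ ds) p = 0.
Proof.
move=> hD zy0 ei; case: n hD => // n hD p Hp _; elim: n hD p Hp => [|n IHn] hD p Hp.
  apply: (coef_relation_vanish (erefl (size ds)) dzyx Hp ei); last by right.
  by have := hD 0%N isT; rewrite addr0.
have IH := IHn (fun m lt => hD m (ltnW lt)).
have sds : size (nseq n.+1 z ++ ds) = (n.+1 + size ds)%N by rewrite size_cat size_nseq.
have sds' : size (y :: nseq n.+1 z ++ ds) = (n.+2 + size ds)%N by apply: (congr1 S sds).
have ei' : vend o (nseq n.+1 z ++ ds) = i + shift z *+ n.+1 by rewrite vend_cat ei vend_nseq.
apply: (coef_relation_vanish sds dzyx Hp ei'); first exact: hD.
by left; exact: (@coef_extend0 o (y :: nseq n.+1 z ++ ds) (n.+2 + size ds)%N z sds' IH p Hp).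
Qed.

(** At the first failure, zy after a power of [z] from v + x is a cycle: zyz is
    zero since it is no loop.  Along this power it has the value zy, which is
    nonzero, whereas a boundary has the value 0 there because yz vanishes at the
    end of the power and the coefficients along [y] times it are zero by the
    previous vertices. *)
Lemma down_nonzero m : nz z x (vz m).
Proof.
elim/ltn_ind: m => m IHm; apply: contrapT => Dm.
have yz0 : step2 y z (vz m + shift x) = 0.
  by apply: contrapT => n; have [_ /(_ n)] := nz_downP (vz m).
have nzy : nz z y (vz m + shift x).
  by have [//|n] := nz_or hs hr nondeg soc (vz m + shift x) dyzx; case: n.
case: m IHm Dm yz0 nzy => [|m] IHm Dm yz0 nzy.
  by rewrite addr0 in nzy; apply: nzy; apply: U0_zy.
pose i := v + shift x.
have ei n : i + shift z *+ n = vz n + shift x by rewrite /i addrAC.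
have [Hc [_ ec]] := chainP z i m; have [Hc1 _] := chainP z i m.+1.
pose xi := step2 z y (i + shift z *+ m.+1) *: chain z i m.+1.
have kxi : ker m.+1 xi.
  rewrite /= /xi linearZ /= ec scalerA.
  rewrite vzS step3_nonloop ?scale0r //.
  by clear; case: z; case: y.
have Hxi : H m.+1 (m.+1%:Z + 2%:Z) xi by apply: res_degZ (Gstep2 X _ _ _) Hc1.
have sz := size_nseq m.+1 z.
have hD n : (n < m.+1)%N -> nz y z (i + shift z *+ n).
  by move=> lt; rewrite ei; have [h _ _ _] := nz_downP (vz n); apply/h/IHm.
have yvan (p : P m.+2) : H m.+2 m.+2%:Z p -> coef i (y :: nseq m.+1 z) p = 0.
  have := @coef_yz_vanish i i [::] m.+1 hD U0_zy erefl.
  by rewrite cats0 /= addn0 => h Hp; apply: h.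
have := boundary_vanish sz dyzx Hxi kxi (or_introl yvan).
rewrite vend_nseq ei => /(_ (or_intror yz0)).
rewrite /xi functionalZ -[2%N]addn0 (part_mull X _ _ (Gstep2 X _ _ _)).
rewrite part0_functional_arrows ?size_nseq // coef_chain (sc1 X) mul1r.
by rewrite vend_nseq step2E ei Estep2 step2E => /nzy.
Qed.

Lemma cat_nseq_cons n (ds : seq mckay_dir) : nseq n z ++ z :: ds = nseq n.+1 z ++ ds.
Proof. by elim: n => //= n ->. Qed.

(** Between zeros of yx the path xz is nonzero, so [x] can be exchanged with each
    of the steps [z] before it, up to scalars.  Once it comes first, the walk from
    v + x applies. *)
Lemma coef_yzx_vanish l n : (forall m, (0 < m <= l)%N -> nz y x (vz m)) -> (0 < n + l)%N ->
  forall N (p : P N), N = (n + l).+2 -> H N N%:Z p ->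
  coef v (y :: nseq n z ++ x :: nseq l z) p = 0.
Proof.
elim: l n => [|l IHl] n hU n0 N p eN Hp.
  rewrite addn0 in n0 eN; rewrite [nseq 0 z]/=.
  have hD m : (m < n)%N -> nz y z (v + shift x + shift z *+ m).
    by move=> _; rewrite addrAC; have [h _ _ _] := nz_downP (vz m); apply/h/down_nonzero.
  have h := @coef_yz_vanish v (v + shift x) [:: x] n hD U0_zy erefl.
  have e1 : N = (n.+1 + size [:: x])%N by rewrite eN /= addn1.
  by subst N; move: p Hp; rewrite e1 => p Hp; apply: h.
have nxz : nz x z (vz l).
  have := hU l.+1; rewrite ltnS leqnn => /(_ isT); have [_ _ h _] := nz_upP (vz l.+1).
  by move/h; rewrite vzS addrK.
have [c ec] := square_relation hs hr nondeg soc dzxy nxz.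
have sl : size (nseq l z) = l by rewrite size_nseq.
have pair (q : P l.+2) : H l.+2 l.+2%:Z q ->
    1 * coef v (x :: z :: nseq l z) q + c * coef v (z :: x :: nseq l z) q = 0.
  move=> Hq; have := coef_relation v sl dzxy Hq.
  move: (coef v [:: x, z & nseq l z] q) (coef v [:: z, x & nseq l z] q) => m1 m2.
  rewrite vend_nseq ec mulrA -(scM X) -mulrDl -(scD X) mul1r => /(sc_mul_eq0 nxz).
  by rewrite [c * _]mulrC.
have sl2 (a b : mckay_dir) : size (a :: b :: nseq l z) = l.+2 by rewrite /= sl.
have ev : vend v (x :: z :: nseq l z) = vend v (z :: x :: nseq l z).
  by rewrite /= addrAC.
have eN1 : N = (size (y :: nseq n z) + l.+2)%N by rewrite eN /= size_nseq !addnS.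
have h0 : coef v (y :: nseq n.+1 z ++ x :: nseq l z) p = 0.
  apply: (IHl n.+1 _ isT N p _ Hp); last by rewrite eN addSnnS.
  by move=> m /andP[m0 ml]; apply: hU; rewrite m0 ltnW.
rewrite -cat_nseq_cons in h0.
have : 1 * coef v ((y :: nseq n z) ++ x :: z :: nseq l z) p +
       c * coef v ((y :: nseq n z) ++ z :: x :: nseq l z) p = 0.
  move: p Hp {h0}; rewrite eN1 => p Hp.
  exact: (coef_extend (sl2 _ _) (sl2 _ _) ev pair).
have -> : coef v ((y :: nseq n z) ++ z :: x :: nseq l z) p = 0 by exact: h0.
by rewrite mulr0 addr0 mul1r.
Qed.

(** If the next zero is at v_(t+1), the loops yzx and xyz at v_t are proportional,
    xyz being nonzero.  So the corresponding combination of the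
    generators with coefficient one along x z^t and z^(t+1) is a cycle; along
    x z^t its value is yz, which is nonzero.  For a boundary this value is zero:
    the coefficients along z x z^t vanish, and so do those along y x z^t or, if
    t = 0, the path zy. *)
Lemma no_second_zero t : (0 < t)%N -> ~ nz y x (vz t) ->
  (forall m, (0 < m < t)%N -> nz y x (vz m)) -> False.
Proof.
case: t => // t _ Ut hU.
have yvan : (forall h : P t.+2, H t.+2 t.+2%:Z h -> coef v (y :: x :: nseq t z) h = 0) \/
    step2 z y (vz t + shift x) = 0.
  case: t {Ut} hU => [|t] hU; first by right; rewrite addr0; apply: U0_zy.
  left=> h Hh; apply: (@coef_yzx_vanish t.+1 0 _ _ _ h) => //.
have [p [Hp cp [q eq]]] := cross_chain dxyz t down_nonzero.
have [Hg [_ eg]] := chainP z v t; have [Hg1 _] := chainP z v t.+1.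
set w := vz t + shift x.
have ew : vz t.+1 + shift y + shift x = vz t.
  by rewrite vzS shift_uniq_sum0.
have nyz : nz y z w by have [h _ _ _] := nz_downP (vz t); apply/h/down_nonzero.
have nxy : nz x y (vz t.+1).
  by have [/Ut|] := nz_or hs hr nondeg soc (vz t.+1) dxyz.
(* Two loops in degree three at v_t, hence proportional. *)
pose u1 := step2 x y (vz t.+1) * step z (vz t).
pose u2 := step2 y z w * step x (vz t).
have G2u (a b c : mckay_dir) i j : G 3%N (step2 a b i * step c j).
  by have := GM X (Gstep2 X a b i) (Gstep X c j).
have n1 : u1 <> 0.
  have nyz' : nz y z (vz t).
    by rewrite -ew; apply: (nz_rot2 hs hr nondeg soc dyxz).
  have := step3_nz hs hr nondeg soc dzyx (Gstep2 X y z (vz t)) (Estep2 X y z (vz t)) (step2E X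
    y z (vz t)) nyz'.
  by rewrite /u1 vzS /two_step mulrA.
have [c ec] : exists c, u2 = sc c * u1.
  apply: (degree3_line soc (i := vz t)) => //; first exact: G2u.
  - exact: G2u.
  - by rewrite /u1 -mulrA stepE.
  - by rewrite /u2 -mulrA stepE.
pose xi := step2 y z w *: p + (sc (- c) * step2 x y (vz t.+1)) *: chain z v t.+1.
have kxi : ker t.+1 xi.
  rewrite /= /xi linearD !linearZ /= eq eg scalerDr !scalerA.
  have -> : step2 y z w * step z (w - shift z) = 0.
    have -> : w = w - shift z + shift z by rewrite subrK.
    rewrite addrK step3_nonloop //; by clear; case: z; case: y.
  rewrite scale0r add0r -scalerDl -mulrA -/u1 -/u2 ec -mulrDl -(scD X) subrr.
  by rewrite (raddf0 (qr_sc X)) mul0r scale0r.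
have Hxi : H t.+1 (t.+1%:Z + 2%:Z) xi.
  apply: res_degD; first by apply: res_degZ (Gstep2 X _ _ _) Hp.
  by apply: res_degZ Hg1; apply: GscM; apply: Gstep2.
have sw : size (x :: nseq t z) = t.+1 by rewrite /= size_nseq.
have vw : vend v (x :: nseq t z) = w by rewrite /= vend_nseq.
have zvan (h : P t.+2) : H t.+2 t.+2%:Z h -> coef v (z :: x :: nseq t z) h = 0.
  move=> Hh; apply: (coef_relation_vanish (size_nseq t z) dxzy Hh (vend_nseq v t z)).
    exact: down_nonzero.
  right; apply: contrapT => n; apply: Ut; have [_ _ _ h'] := nz_upP (vz t.+1).
  by apply: h'; rewrite vzS addrK.
have := boundary_vanish sw dzyx Hxi kxi (or_introl zvan).
rewrite vw => /(_ yvan).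
rewrite linearD (partD X) !functionalZ -[2%N]addn0 (part_mull X _ _ (Gstep2 X _ _ _)).
rewrite (part_mull X _ _ (GscM X _ (Gstep2 X _ _ _))) !part0_functional_arrows // cp (sc1 X)
  mul1r vw step2E.
have kill c' : step2 x y (vz t.+1) * (sc c' * E w) = 0.
  rewrite mulrA -(scC X) -mulrA -(step2E X) -mulrA (E_neq X) ?mulr0 //.
  by rewrite /w vzS => /addrI /(shift_inj hs hr) ezx; have [_ _ []] := distinct_neq dxyz.
by rewrite -[_ * step2 x y _ * _]mulrA kill mulr0 addr0 Estep2 step2E => /nyz.
Qed.

End Obstruction.

(** A vanishing path yx is met again along the periodic walk in direction [z],
    and the first return is excluded. *)
Lemma two_step_neq0 x y i : x <> y -> nz y x i.
Proof.
move=> /third_direction[z dxyz]; apply: contrapT => U0.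
pose bad t := (0 < t)%N && `[< ~ nz y x (i + shift z *+ t) >].
have ex : exists t, bad t.
  have [t t0 et] := period hs hr z i; exists t; rewrite /bad t0 /=.
  by apply/asboolP; rewrite et.
have [t /andP[t0 /asboolP Ut] tmin] := ex_minnP ex.
apply: (no_second_zero dxyz U0 t0 Ut) => m /andP[m0 mt].
apply: contrapT => Um; have := tmin m; rewrite /bad m0 /= => /(_ _).
by rewrite leqNgt mt => h; have := h (asboolT Um).
Qed.

End Linear.

End McKayKoszul.

(** * The algebra presented by squares and rhombi *)
Section Presented.
Variables (s r : nat).
Hypotheses (hs : (4 <= s)%N) (hr : (4 <= r)%N).
Local Notation V := (mckay_vertex s r).
Local Notation shift := (@shift s r).
Local Notation Q := (mckay s r).
Variables (k : fieldType) (A : pzRingType).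
Variables (G : nat -> set A) (E : vertex Q -> A) (X : quiver_ring k G E).
Local Notation sc := (qr_sc X).
Local Notation step := (@arrow_elt s r k A G E X).
Local Notation step2 := (@two_step s r k A G E X).
Implicit Types (x y z : mckay_dir) (i j v : V).
Hypothesis square0 : forall x i, step2 x x i = 0.
Hypothesis swap : forall x y i, x <> y -> exists c, step2 x y i = sc c * step2 y x i.

Definition three_step z y x i : A := step z (i + shift x + shift y) * step2 y x i.

Definition line (m u : A) : Prop := exists c, u = sc c * m.

Lemma line_sc m c u : line m u -> line m (sc c * u).
Proof. by case=> a ->; exists (c * a); rewrite (scM X) mulrA. Qed.
Lemma line0 m : line m 0.
Proof. by exists 0; rewrite (raddf0 (qr_sc X)) mul0r. Qed.
Lemma lineD m u w : line m u -> line m w -> line m (u + w).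
Proof. by case=> a -> [b ->]; exists (a + b); rewrite (scD X) mulrDl. Qed.
Lemma line_sum m (K : finType) (F : K -> A) : (forall a, line m (F a)) -> line m (\sum_a F a).
Proof. by move=> h; apply: (big_ind (line m)) => //; [apply: line0 | apply: lineD]. Qed.

Lemma step3_alt z y x i : three_step z y x i = step2 z y (i + shift x) * step x i.
Proof. by rewrite /three_step /two_step mulrA. Qed.

Lemma line_swap12 m z y x i : x <> y -> line m (three_step z x y i) ->
  line m (three_step z y x i).
Proof.
move=> n h; have [c e] := swap i (fun e : y = x => n (esym e)).
rewrite /three_step e mulrA -(scC X) -mulrA; apply: line_sc.
by rewrite [_ + shift y]addrAC.
Qed.

Lemma line_swap23 m z y x i : y <> z -> line m (three_step y z x i) ->
  line m (three_step z y x i).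
Proof.
move=> n h; have [c e] := swap (i + shift x) (fun e : z = y => n (esym e)).
by rewrite step3_alt e -mulrA -step3_alt; apply: line_sc.
Qed.

(** Exchanging adjacent distinct directions changes a path by a scalar, and
    repeated adjacent directions give zero: a word with a repetition vanishes, and
    the others are permutations of zyx. *)
Lemma step3_line z y x i d3 d2 d1 : distinct x y z ->
  line (three_step z y x i) (three_step d3 d2 d1 i).
Proof.
set m := three_step z y x i => d.
have [nxy nyz nxz] := distinct_neq d.
have ne u w : u <> w :> mckay_dir -> w <> u by move=> n e; apply: n.
have b1 : line m (three_step z y x i) by exists 1; rewrite (sc1 X) mul1r.
have b2 : line m (three_step z x y i) by apply: line_swap12 (ne _ _ nxy) b1.
have b3 : line m (three_step y z x i) by apply: line_swap23 (ne _ _ nyz) b1.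
have b4 : line m (three_step x z y i) by apply: line_swap23 (ne _ _ nxz) b2.
have b5 : line m (three_step y x z i) by apply: line_swap12 (ne _ _ nxz) b3.
have b6 : line m (three_step x y z i) by apply: line_swap12 (ne _ _ nyz) b4.
have s12 u w : line m (three_step u w w i) by rewrite /three_step square0 mulr0; apply: line0.
have s23 u w : line m (three_step w w u i) by rewrite step3_alt square0 mul0r; apply: line0.
have s13 u w : line m (three_step u w u i).
  by case: (EM (u = w)) => [->//|n]; apply: line_swap12.
have all u : [\/ u = x, u = y | u = z].
  by move: d; clear; case: x; case: y; case: z => //; case: u => _; (try by constructor 1);
    (try by constructor 2); (try by constructor 3).
by case: (all d1) => ->; case: (all d2) => ->; case: (all d3) => ->.
Qed.

Lemma G1_sum (u : A) : G 1%N u -> u = \sum_a sc (qr_acoef X a u) * qr_arrow X a.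
Proof. by move=> Gu; rewrite -(part1E X) (part_homog X _ Gu). Qed.

Lemma degree2_line_presented (u : A) i j m : G 2%N u -> E j * u = u -> u * E i = u ->
  (forall x y, x <> y -> i + shift x + shift y = j -> line m (step2 y x i)) -> line m u.
Proof.
move=> Gu Eu uE hm; rewrite -Eu -uE.
have [F [hF ->]] := G_decomp X Gu; rewrite mulr_suml mulr_sumr; apply: line_sum => -[i2 d2].
rewrite (G1_sum (hF _)) mulr_sumr mulr_suml mulr_sumr; apply: line_sum => -[i1 d1].
rewrite -/(step d2 i2) -/(step d1 i1).
move: (qr_acoef X _ _) => c.
rewrite -!mulrA (mulrA (step d2 i2) (sc c)) -(scC X) -!mulrA (mulrA (E j) (sc c)) -(scC X)
  -!mulrA.
apply: line_sc.
case: (EM (i1 = i)) => [->|ne]; last by rewrite step_E_neq // !mulr0; apply: line0.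
rewrite stepE; case: (EM (i2 = i + shift d1)) => [->|ne]; last first.
  by rewrite -(Estep X d1) -(stepE X d2) -!mulrA (mulrA (E i2)) (E_neq X) // mul0r !mulr0;
    apply: line0.
case: (EM (i + shift d1 + shift d2 = j)) => [ej|ne]; last first.
  rewrite -(Estep X d2) !mulrA (E_neq X) ?mul0r; first exact: line0.
  by move=> e; apply: ne.
rewrite -ej -/(step2 d2 d1 i) Estep2.
case: (EM (d1 = d2)) => [->|nd]; first by rewrite square0; apply: line0.
exact: hm.
Qed.

Lemma degree3_line_presented (u : A) x y z i : distinct x y z -> G 3%N u -> u * E i = u ->
  line (three_step z y x i) u.
Proof.
move=> d Gu <-.
have [F [hF ->]] := G_decomp X Gu; rewrite mulr_suml; apply: line_sum => -[i3 d3].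
have [F' [hF' ->]] := G_decomp X (hF (i3, d3)); rewrite mulr_sumr mulr_suml;
  apply: line_sum => -[i2 d2].
rewrite (G1_sum (hF' _)) !mulr_sumr mulr_suml; apply: line_sum => -[i1 d1].
rewrite -/(step d3 i3) -/(step d2 i2) -/(step d1 i1).
move: (qr_acoef X _ _) => c.
rewrite -!mulrA (mulrA (step d2 i2) (sc c)) -(scC X) -!mulrA (mulrA (step d3 i3) (sc c)) -(scC
  X) -!mulrA.
apply: line_sc.
case: (EM (i1 = i)) => [->|ne]; last by rewrite step_E_neq // !mulr0; apply: line0.
rewrite stepE; case: (EM (i2 = i + shift d1)) => [->|ne]; last first.
  by rewrite -(Estep X d1) -(stepE X d2) -!mulrA (mulrA (E i2)) (E_neq X) // mul0r !mulr0;
    apply: line0.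
rewrite -/(step2 d2 d1 i).
case: (EM (i3 = i + shift d1 + shift d2)) => [->|ne]; last first.
  by rewrite -(Estep2 X d2) -(stepE X d3) -!mulrA (mulrA (E i3)) (E_neq X) // mul0r !mulr0;
    apply: line0.
exact: step3_line.
Qed.

(** The first three steps are a multiple of any loop in three distinct directions;
    choose the one that ends in the direction of the fourth step, which creates a
    square. *)
Lemma degree4_presented n (u : A) : G n.+4 u -> u = 0.
Proof.
elim: n u => [|n IHn] u Gu; last first.
  by have [F [hF ->]] := G_decomp X Gu; rewrite big1 // => a _; rewrite (IHn _ (hF a)) mulr0.
have [F [hF ->]] := G_decomp X Gu; rewrite big1 // => -[i4 d4] _.
rewrite (idem_sumr X (F _)) mulr_sumr big1 // => i _.
have GF : G 3%N (F (i4, d4) * E i) by have := GM X (hF (i4, d4)) (G_idem X i).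
have FE : F (i4, d4) * E i * E i = F (i4, d4) * E i by rewrite -mulrA (idem_id X).
have [x [y d]] : exists x y, distinct x y d4.
  by case: d4 {hF GF FE}; [exists Beta, Gamma | exists Alpha, Gamma | exists Alpha, Beta].
have [c ->] := degree3_line_presented d GF FE.
rewrite mulrA -(scC X) -mulrA -/(step d4 i4) /three_step (mulrA (step d4 i4)).
case: (EM (i4 = i + shift x + shift y + shift d4)) => [->|ne].
  by rewrite -/(step2 d4 d4 _) square0 mul0r mulr0.
by rewrite -(Estep X d4 (i + shift x + shift y)) (mulrA (step d4 i4)) step_E_neq // !mul0r
  mulr0.
Qed.

End Presented.

(** * Relations in the path algebra of the McKay quiver *)
Section Relations.
Variables (k : fieldType) (Q : quiver).
Local Notation kQ := (path_algebra k Q).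
Implicit Types (x y : kQ) (i j : vertex Q).

(** The condition of [is_relation] for given length, source and target, in terms
    of coefficients. *)
Definition uniform n i j x : Prop :=
  forall p, cf p x != 0 -> [/\ path_length p = n, path_source p = i & path_target p = j].

Lemma uniformP n i j x : uniform n i j x <-> forall p, p \in msupp x ->
  [/\ path_length p = n, path_source p = i & path_target p = j].
Proof. by split=> h p; have := h p; rewrite cf_in. Qed.

Lemma uniformD n i j x y : uniform n i j x -> uniform n i j y -> uniform n i j (x + y).
Proof.
move=> hx hy p; rewrite (raddfD (cf p)) /=.
have [px|/hx//] := eqVneq (cf p x) 0.
by rewrite px add0r => /hy.
Qed.

Lemma uniformZ n i j c x : uniform n i j x -> uniform n i j (c *: x).
Proof. by move=> hx p; rewrite cfZ mulf_eq0 negb_or => /andP[_ /hx]. Qed.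

Lemma uniform_arrow2 (a b : arrow Q) : target a = source b ->
  uniform 2 (source a) (target b) (of_path k (arrow_path b) * of_path k (arrow_path a)).
Proof.
move=> e p; rewrite of_pathM cf_monomial.
have [|r [-> r1 r2]] := @path_mulP Q (arrow_path b) (arrow_path a); first exact: e.
case: (Some r =P Some p) => [[<-] _|_]; last by rewrite eqxx.
by rewrite /path_length /path_source /path_target r1 r2 /=.
Qed.

Lemma sum_mono x : x = \sum_(p <- msupp x) mono (cf p x) p.
Proof. by rewrite {1}[x]monalgE; apply: eq_bigr => p _; rewrite monoU cfE. Qed.

Lemma uniform_ends n i j x : uniform n i j x ->
  of_path k (trivial_path j) * x = x /\ x * of_path k (trivial_path i) = x.
Proof.
move/uniformP => hx; rewrite /of_path -!monoU; split; apply: etrans (esym (sum_mono x)).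
- rewrite {1}(sum_mono x) mulr_sumr big_seq [RHS]big_seq; apply: eq_bigr => p /hx [_ _ <-].
  by rewrite monoM path_mul1p eqxx mul1r /= monoU.
- rewrite {1}(sum_mono x) mulr_suml big_seq [RHS]big_seq; apply: eq_bigr => p /hx [_ <- _].
  by rewrite monoM path_mulp1 eqxx mulr1 /= monoU.
Qed.

End Relations.

Section McKayRelations.
Variables (s r : nat) (k : fieldType).
Local Notation V := (mckay_vertex s r).
Local Notation shift := (@shift s r).
Local Notation Q := (mckay s r).
Local Notation kQ := (path_algebra k Q).
Implicit Types (x y z : mckay_dir) (i : V).

Definition arr x i : kQ := of_path k (@arrow_path Q (i, x)).
Definition arr2 y x i : kQ := arr y (i + shift x) * arr x i.
Definition arr3 z y x i : kQ := arr z (i + shift x + shift y) * arr2 y x i.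
Definition rhombus c y x i : kQ := c *: arr2 y x i + arr2 x y i.

Lemma uniform_arr2 y x i : uniform 2 (i : vertex Q) (i + shift x + shift y) (arr2 y x i).
Proof. exact: (@uniform_arrow2 k Q (i, x) (i + shift x, y)). Qed.

Lemma uniform_rhombus c y x i :
  uniform 2 (i : vertex Q) (i + shift x + shift y) (rhombus c y x i).
Proof.
apply: uniformD; first by apply: uniformZ; apply: uniform_arr2.
by rewrite addrAC; apply: uniform_arr2.
Qed.

Lemma rho_relation a b c (x : kQ) : rho a b c x -> is_relation x.
Proof.
have rel i j (y : kQ) : uniform 2 (i : vertex Q) j y -> is_relation y.
  by move=> /uniformP h; exists 2%N, i, j.
case=> -[i] [] ->.
- exact: rel (@uniform_rhombus (a i) Beta Gamma i).
- exact: rel (@uniform_rhombus (b i) Alpha Gamma i).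
- exact: rel (@uniform_rhombus (c i) Beta Alpha i).
- exact: rel (@uniform_arr2 Alpha Alpha i).
- exact: rel (@uniform_arr2 Beta Beta i).
- exact: rel (@uniform_arr2 Gamma Gamma i).
Qed.

Lemma rho_square a b c x i : rho a b c (arr2 x x i).
Proof.
by right; exists i; case: x; [constructor 1 | constructor 2 | constructor 3].
Qed.

Section Quotient.
Variable J : ideal kQ.
Local Notation q := (to_quot J).
Variable X : quiver_ring k (bound_grading J) (bound_idempotent J).
Hypothesis XY : forall a, qr_arrow X a = q (of_path k (arrow_path a)).
Hypothesis Xsc : forall c, qr_sc X c = q (c *: (1 : kQ)).

Lemma to_quot_eq0 (x : kQ) : q x = 0 :> bound_algebra J <-> ideal_set J x.
Proof. by rewrite -(to_quot0 J) to_quotP subr0. Qed.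

Lemma step2_quot y x i : two_step X y x i = q (arr2 y x i).
Proof. by rewrite /two_step /arrow_elt !XY to_quot_mul. Qed.

Lemma step3_quot z y x i : three_step X z y x i = q (arr3 z y x i).
Proof. by rewrite /three_step step2_quot /arrow_elt XY to_quot_mul. Qed.

Lemma sc_quot c (x : kQ) : qr_sc X c * q x = q (c *: x).
Proof. by rewrite Xsc; apply: (bscMl J c x). Qed.

Lemma rhombus_quot c y x i :
  ideal_set J (rhombus c y x i) <-> two_step X x y i = qr_sc X (- c) * two_step X y x i.
Proof.
have e : q (rhombus c y x i) = qr_sc X c * two_step X y x i + two_step X x y i.
  by rewrite !step2_quot sc_quot; apply: to_quotD.
apply: iff_trans (iff_sym (to_quot_eq0 (rhombus c y x i))) _; rewrite e.
move: (two_step X y x i) (two_step X x y i) => u w; rewrite (raddfN (qr_sc X)) mulNr addrC.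
by split=> [/eqP|->]; [rewrite addr_eq0 => /eqP | rewrite addNr].
Qed.

End Quotient.
End McKayRelations.

(** * The ideal of relations *)
Section Presentation.
Variables (s r : nat) (k : fieldType).
Hypotheses (hs : (4 <= s)%N) (hr : (4 <= r)%N).
Local Notation V := (mckay_vertex s r).
Local Notation shift := (@shift s r).
Local Notation Q := (mckay s r).
Local Notation kQ := (path_algebra k Q).
Variable I : ideal kQ.
Hypothesis hI : exists S : set kQ,
       (forall x, S x -> is_relation x) /\ I = ideal_gen S :> set kQ.
Variable X : quiver_ring k (bound_grading I) (bound_idempotent I).
Hypothesis XY : forall a, qr_arrow X a = to_quot I (of_path k (arrow_path a)).
Hypothesis Xsc : forall c, qr_sc X c = to_quot I (c *: (1 : kQ)).
Hypothesis square0 : forall x i, two_step X x x i = 0.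
Hypothesis step2_neq0 : forall x y i, x <> y -> two_step X y x i <> 0.
Hypothesis step3_neq0 : forall x y z i, distinct x y z -> three_step X z y x i <> 0.

Variables (a b c : V -> k).
Hypothesis abc0 : forall i, [/\ a i != 0, b i != 0 & c i != 0].
Hypothesis aI : forall i, ideal_set I (rhombus (a i) Beta Gamma i).
Hypothesis bI : forall i, ideal_set I (rhombus (b i) Alpha Gamma i).
Hypothesis cI : forall i, ideal_set I (rhombus (c i) Beta Alpha i).
Local Notation J := (ideal_gen (rho a b c)).

Lemma rho_sub_ideal : ideal_set J `<=` ideal_set I.
Proof.
move=> x; apply=> {}x [] [i [] ->].
- exact: aI.
- exact: bI.
- exact: cI.
- by apply/(to_quot_eq0 I); have := square0 Alpha i; rewrite (step2_quot XY).
- by apply/(to_quot_eq0 I); have := square0 Beta i; rewrite (step2_quot XY).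
- by apply/(to_quot_eq0 I); have := square0 Gamma i; rewrite (step2_quot XY).
Qed.

(** A generator of I is homogeneous with fixed end points, so modulo rho it is a
    multiple of one path.  This path is not in I, hence the multiple is zero. *)
Lemma ideal_sub_rho : ideal_set I `<=` ideal_set J.
Proof.
have hJ : exists S : set kQ, (forall x, S x -> is_relation x) /\ J = ideal_gen S :> set kQ.
  by exists (rho a b c); split=> // x; apply: rho_relation.
have [X' [XY' Xsc']] := bound_quiver_ring hJ.
have rhoJ x : rho a b c x -> ideal_set J x by move=> rx K; apply.
have sq' x i : two_step X' x x i = 0.
  rewrite (step2_quot XY'); apply/(to_quot_eq0 J)/rhoJ; exact: rho_square.
have swap0 e y x i : e != 0 -> ideal_set J (rhombus e y x i) ->
    (exists e', two_step X' x y i = qr_sc X' e' * two_step X' y x i) /\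
    (exists e', two_step X' y x i = qr_sc X' e' * two_step X' x y i).
  move=> e0 /(rhombus_quot XY' Xsc') h; split; first by exists (- e).
  by exists (- e)^-1; refine (sc_invert _ h); rewrite oppr_eq0.
have swap x y i : x <> y -> exists e, two_step X' x y i = qr_sc X' e * two_step X' y x i.
  move: x y.
  have [a0 b0 cn0] := abc0 i.
  have [ha1 ha2] := swap0 _ Beta Gamma i a0 (rhoJ _ (or_introl (ex_intro _ i (Or31 _ _
    erefl)))).
  have [hb1 hb2] := swap0 _ Alpha Gamma i b0 (rhoJ _ (or_introl (ex_intro _ i (Or32 _ _
    erefl)))).
  have [hc1 hc2] := swap0 _ Beta Alpha i cn0 (rhoJ _ (or_introl (ex_intro _ i (Or33 _ _
    erefl)))).
  move=> [] [] n; try by case: n.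
  - exact: hc1.
  - exact: hb2.
  - exact: hc2.
  - exact: ha2.
  - exact: hb1.
  - exact: ha1.
(* As rho is contained in I, the multiple of [w] is in I; as [w] is not, it is 0. *)
have kill (x w : kQ) (e : k) (v : bound_algebra I) (u : bound_algebra J) :
    ideal_set I x -> v = to_quot I w -> v <> 0 -> u = to_quot J w ->
    to_quot J x = qr_sc X' e * u -> ideal_set J x.
  move=> Ix -> wI -> h.
  have Ixw : ideal_set I (x - e *: w).
    by apply: rho_sub_ideal; apply/to_quotP; rewrite -(sc_quot Xsc').
  have : ideal_set I (e *: w).
    by have := idealB Ix Ixw; rewrite opprB addrC subrK.
  move=> /(to_quot_eq0 I); rewrite -(sc_quot Xsc) => /(sc_mul_eq0 wI) e0.
  by apply/(to_quot_eq0 J); rewrite h e0 (raddf0 (qr_sc X')) mul0r.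
have [S [Srel IS]] := hI.
move=> x Ix; suff : ideal_set (ideal_gen S) `<=` ideal_set J by apply; rewrite -IS.
move=> {x Ix} x; apply=> {}x Sx.
have Ix : ideal_set I x by rewrite IS => K; apply.
have [n [i [j [n2 hx']]]] := Srel _ Sx; have /uniformP hx := hx'.
have [Ex xE] := uniform_ends hx.
have Gx : bound_grading J n (to_quot J x) by apply: bgradingP => p /hx' [].
have Eu : bound_idempotent J j * to_quot J x = to_quot J x by
  rewrite /bound_idempotent to_quot_mul Ex.
have uE : to_quot J x * bound_idempotent J i = to_quot J x by
  rewrite /bound_idempotent to_quot_mul xE.
case: n n2 {hx hx'} Gx => [|[|[|[|n]]]] // _ Gx.
- have [[y [z [nyz eij]]]|no] := EM (exists y z, y <> z /\ i + shift y + shift z = j).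
    have [e he] : line X' (two_step X' z y i) (to_quot J x).
      apply: (degree2_line_presented sq' Gx Eu uE) => y' z' nyz'; rewrite -eij => e'.
      have [w d] := third_direction nyz; have [[-> ->]|[-> ->]] := two_steps hs hr d e'.
        by exists 1; rewrite (sc1 X') mul1r.
      by apply: swap => e1; apply: nyz.
    exact (kill _ _ _ _ _ Ix (step2_quot XY z y i) (step2_neq0 nyz) (step2_quot XY' z y i) he).
  have [e he] : line X' 0 (to_quot J x).
    apply: (degree2_line_presented sq' Gx Eu uE) => y z nyz eij.
    by case: no; exists y, z.
  by apply/(to_quot_eq0 J); rewrite he mulr0.
- have d : distinct Alpha Beta Gamma by [].
  have [e he] := degree3_line_presented sq' swap d Gx uE.
  exact (kill _ _ _ _ _ Ix (step3_quot XY Gamma Beta Alpha i) (step3_neq0 d)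
    (step3_quot XY' Gamma Beta Alpha i) he).
by apply/(to_quot_eq0 J); apply: (degree4_presented sq' swap Gx).
Qed.

End Presentation.

Theorem proposition5p3 (k : fieldType) (s r : nat)
    (hs : (4 <= s)%N) (hr : (4 <= r)%N)
    (I : ideal (path_algebra k (mckay s r)))
    (hI : exists S : set (path_algebra k (mckay s r)),
       (forall x, S x -> is_relation x) /\
       I = ideal_gen S :> set (path_algebra k (mckay s r)))
    (hstable : stable_translation_algebra (bound_grading I) 2)
    (htrivial :
       trivial_translation (bound_grading I) 2 (bound_idempotent I)) :
  exists a b c : mckay_vertex s r -> k,
    (forall i, [/\ a i != 0, b i != 0 & c i != 0]) /\
    I = ideal_gen (rho a b c) :> set (path_algebra k (mckay s r)).
Proof.
have [X [XY Xsc]] := bound_quiver_ring hI.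
have [selfinj loewy [q [q2 [res hres]]]] := hstable.
have rad u : positive X u -> jacobson u.
  exact: (positive_jacobson (@res_projective _ _ _ _ res 0) (res_aug_surj res)
    (@res_minimal _ _ _ _ res 0)).
have G4 u w := G4_zero loewy rad (u := u) (w := w).
have nondeg t u : (t < 3)%N -> bound_grading I t u -> (forall a, qr_arrow X a * u = 0) -> u = 0.
  exact: (left_nondegenerate (X := X) G4 selfinj htrivial).
have soc := socle X htrivial.
have gen t : generated_in_degree (@res_deg _ _ _ _ res t) t%:Z.
  case: q q2 hres => [q|] _ hres; last exact: hres.
  by case: (linear_range_infinite hs hr nondeg soc (q := q) hres.2).
have nzA x y i : x <> y -> two_step_nz X y x i by apply: two_step_neq0.
have sq x i := step_square hs hr nondeg soc x i.
have st3 x y z i : distinct x y z -> three_step X z y x i <> 0.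
  move=> d; apply: (step3_nz hs hr nondeg soc d); [exact: Gstep2|exact: Estep2|exact: step2E|].
  by apply: nzA; have [] := distinct_neq d.
have coef x y i : x <> y -> exists e, e != 0 /\ ideal_set I (rhombus e y x i).
  move=> nxy; have [z d] := third_direction nxy.
  have [e he] := square_relation hs hr nondeg soc d (nzA x y i nxy).
  exists (- e); split; last by apply/(rhombus_quot XY Xsc); rewrite opprK.
  rewrite oppr_eq0; apply/eqP => e0; apply: (nzA y x i (fun h => nxy (esym h))).
  by rewrite he e0 (raddf0 (qr_sc X)) mul0r.
have [a ha] := choice (fun i => coef Gamma Beta i (ltac:(discriminate))).
have [b hb] := choice (fun i => coef Gamma Alpha i (ltac:(discriminate))).
have [c hc] := choice (fun i => coef Alpha Beta i (ltac:(discriminate))).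
have abc0 i : [/\ a i != 0, b i != 0 & c i != 0].
  by split; [case: (ha i) | case: (hb i) | case: (hc i)].
exists a, b, c; split=> //; apply/seteqP; split.
  apply: (ideal_sub_rho hs hr hI XY Xsc sq nzA st3 abc0) => i.
  - by case: (ha i).
  - by case: (hb i).
  - by case: (hc i).
apply: (rho_sub_ideal XY sq) => i.
- by case: (ha i).
- by case: (hb i).
- by case: (hc i).
Qed.
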